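(* Let $m\ge2$ and let $\mathfrak K_1$ be a linear subspace with $\mathfrak K_{\min}\subseteq\mathfrak K_1\subseteq\mathfrak K_{\max}$; all notation is that of the context. Let $U:\mathcal H_1\to\mathfrak H_m\oplus\mathfrak K_1$, $f+k\mapsto(f,k)$, be the natural unitary operator onto the external Hilbert sum. 1) Let $\Theta$ be a closed relation in $\mathbb C^d$. For $z\in\rho(\mathcal B_\Theta)\cap\rho(\mathcal B_0)$ the resolvent of the closed operator $\mathcal B_\Theta$ is given by $$U(\mathcal B_\Theta-z)^{-1}U^*=\begin{pmatrix}\mathcal R^{11}_\Theta(z)&\mathcal R^{12}_\Theta(z)\\ \mathcal R^{21}_\Theta(z)&\mathcal R^{22}_\Theta(z)\end{pmatrix}:\ \mathfrak H_m\oplus\mathfrak K_1\to\mathfrak H_m\oplus\mathfrak K_1,$$ where $$\mathcal R^{11}_\Theta(z)=(L-z)^{-1}+G_z\bigl(\mathcal C(\Theta-M_{\mathsf\Gamma}(z))^{-1}\mathcal C^*\langle\varphi,(L-z)^{-1}\cdot\rangle\bigr),$$ $$\mathcal R^{12}_\Theta(z)=-G_z\bigl(\mathcal C(\Theta-M_{\mathsf\Gamma}(z))^{-1}\mathcal G_b^*d((l_1-z)^{-1}\cdot)\bigr),$$ $$\mathcal R^{21}_\Theta(z)=-(l_1-z)^{-1}k_{\min}\bigl((\Theta-M_{\mathsf\Gamma}(z))^{-1}\mathcal C^*\langle\varphi,(L-z)^{-1}\cdot\rangle\bigr),$$ $$\mathcal R^{22}_\Theta(z)=(l_1-z)^{-1}+(l_1-z)^{-1}k_{\min}\bigl((\Theta-M_{\mathsf\Gamma}(z))^{-1}\mathcal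 G_b^*d((l_1-z)^{-1}\cdot)\bigr).$$ 2) Let $\Theta$ be a self-adjoint relation in $\mathbb C^d$. To the generalized resolvent $P_{\mathfrak H_m}(\mathcal B_\Theta-z)^{-1}|_{\mathfrak H_m}$ of $L_{\min}$ there corresponds, via the generalized Krein–Naimark resolvent formula, the Nevanlinna family $$\tau: z\mapsto(\mathcal C^{-1})^*(\mathcal Q(z)-\Theta)\mathcal C^{-1}.$$
   Context: **Relations.** Scalar products and duality pairings are conjugate-linear in the first argument. Operators are identified with their graphs; a (linear) relation in $\mathfrak H$ is a linear subspace of $\mathfrak H^2$; sums such as $\mathcal Q(z)-\Theta$ and $\Theta-M$, products and inverses are taken in the sense of relations (operatorwise sums). $\hat+$ denotes the componentwise linear sum of relations as subspaces, $T|_X:=\{(f,f')\in T:f\in X\}$. A matrix Nevanlinna function $M$ is analytic on $\mathbb C\setminus\mathbb R$ with $M(z)^*=M(\bar z)$, $\operatorname{Im}M(z)/\operatorname{Im}z\ge0$; Nevanlinna families are the analogous relation-valued functions. **Scale.** $L$ is a self-adjoint operator (not assumed semibounded) in a separable complex Hilbert space $\mathfrak H_0$. For integers $n\ge0$, $\mathfrak H_n=\operatorname{dom}L^{n/2}$ ($=\operatorname{dom}|L|^{n/2}$) with $\langle f,g\rangle_n=\langle\Omega_nf,\Omega_ng\rangle_0$, where $\Omega_n:\mathfrak H_n\to\mathfrak H_0$ is unitary, $\Omega_0=I$, $\Omega_1(\mathfrak H_2)=\mathfrak H_1$, $\Omega_n(\mathfrak H_{n+2})=\mathfrak H_2$,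 $L\Omega_n=\Omega_nL$, $\Omega_n$ is self-adjoint in $\mathfrak H_0$, and the $\Omega_n$ mutually commute. $\mathfrak H_{-n}$ is the dual of $\mathfrak H_n$ with pairing $\langle\cdot,\cdot\rangle:\mathfrak H_{-n}\times\mathfrak H_n\to\mathbb C$ and $\langle\psi,\phi\rangle_{-n}=\langle\tilde\Omega_n^{-1}\psi,\tilde\Omega_n^{-1}\phi\rangle_0$, where $\tilde\Omega_n:\mathfrak H_0\to\mathfrak H_{-n}$ is the unitary with $\langle\tilde\Omega_nu,f\rangle=\langle u,\Omega_nf\rangle_0$. $L$ restricted to $\mathfrak H_{n+2}$ is self-adjoint in $\mathfrak H_n$ (denoted $L_n$) and $L$ extends by continuity to a self-adjoint operator in $\mathfrak H_{-n}$ with domain $\mathfrak H_{2-n}$; these, the resolvents and $\Omega_n,\tilde\Omega_n$ are denoted by the same symbols $L$, $(L-z)^{-1}$, $\Omega_n$. **Functionals.** Let $m\geq 2$, $1\le d<\infty$, $\varphi_1,\dots,\varphi_d\in\mathfrak H_{-m-2}\setminus\mathfrak H_{-m-1}$ linearly independent, and $\langle\varphi,f\rangle:=(\langle\varphi_s,f\rangle)_{s}$. $L_{\min}$ is the restriction of $L$ to $\{f\in\mathfrak H_{m+2}:\langle\varphi,f\rangle=0\}$; it is closed, densely defined, symmetric in $\mathfrak H_m$ with defect numbers $(d,d)$ (standing). $P(L):=\Omega_m^2$. For $z\in\rho(L)$, $c\in\mathbb C^d$: $g_s(z)=(L-z)^{-1}\varphi_s$, $g_z(c)=\sum_sc_sg_s(z)$,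 $G_s(z)=P(L)^{-1}g_s(z)$, $G_z(c)=\sum_sc_sG_s(z)$. The functionals $\langle\varphi_s,\cdot\rangle$ on $\mathfrak H_{m+2}$ have fixed linear continuations to $\mathfrak H_m$ (same notation) such that $R(z)=(\langle\varphi_s,G_{s'}(z)\rangle)_{s,s'}$, $z\in\rho(L)$, is a matrix Nevanlinna function (extended to $\rho(L)$). $L_{\max}=\{(\psi,\phi)\in\mathfrak H_{-m}^2:\langle\phi,f\rangle=\langle\psi,Lf\rangle\ \forall f\in\operatorname{dom}L_{\min}\}$. **Krein–Naimark formula for $L_{\min}$.** $\operatorname{dom}L_{\min}^*=\mathfrak H_{m+2}\dotplus G_z(\mathbb C^d)$ (adjoint in $\mathfrak H_m$), and $\Gamma_0(f+G_z(c))=c$, $\Gamma_1(f+G_z(c))=\langle\varphi,f\rangle+R(z)c$ define a boundary triple for $L_{\min}^*$ with $\gamma$-field $\gamma_\Gamma(z)=G_z(\cdot)$, Weyl function $M_\Gamma=R$ and $L_{\min}^*|_{\ker\Gamma_0}=L_m$. For a self-adjoint extension $\widetilde T$ of $L_{\min}$ in a Hilbert space containing $\mathfrak H_m$, the Nevanlinna family $\tau$ corresponding to the generalized resolvent $P_{\mathfrak H_m}(\widetilde T-z)^{-1}|_{\mathfrak H_m}$ is the unique one satisfying $P_{\mathfrak H_m}(\widetilde T-z)^{-1}|_{\mathfrak H_m}=(L_m-z)^{-1}-\gamma_\Gamma(z)(\tau(z)+M_\Gamma(z))^{-1}\gamma_\Gamma(\bar z)^*$ for $z\in\rho(\widetilde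 T)\cap\rho(L)$. **Exit space.** Let $z_1,\dots,z_m\in\rho(L)$ be distinct; $s,s'$ run over $\{1,\dots,d\}$, $j,j'$ over $\{1,\dots,m\}$, and $i=m(s-1)+j$, $i'=m(s'-1)+j'$. $\mathfrak K=\operatorname{span}\{g_i:=g_s(z_j)\}$ is $md$-dimensional with scalar product $\langle\cdot,\cdot\rangle_{-m}$, $k=\sum_id_i(k)g_i$ and $d(k)=(d_i(k))\in\mathbb C^{md}$. $\mathcal H=\mathfrak H_m\dotplus\mathfrak K$ with $\langle f+k,f'+k'\rangle_{\mathcal H}=\langle f,f'\rangle_m+\langle k,k'\rangle_{-m}$. $\widetilde P(L)=\prod_j(L-z_j)$, $f_s=\widetilde P(L)^{-1}\varphi_s$, $\mathfrak K_{\min}=\mathfrak K\cap\mathfrak H_{m-2}=\operatorname{span}\{f_s\}$, $k_{\min}(\chi)=\sum_s\chi_sf_s$, $\mathcal G_b=(\langle g_i,f_{s'}\rangle_{-m})$ ($md\times d$). $e_s=P(L)^{-1}\varphi_s$, $\mathcal C=\mathcal B^{-1}\mathcal A$ with $\mathcal A=(\langle e_s,f_{s'}\rangle_{-m})$, $\mathcal B=(\langle e_s,e_{s'}\rangle_{-m})$; it is standing that $f_s=\sum_{s'}\mathcal C_{s's}e_{s'}$ and $\mathcal C$ is nonsingular. $\widetilde G_z(c):=G_z(\mathcal Cc)=\widetilde P(L)^{-1}g_z(c)$, $\widetilde R(z):=\mathcal C^*R(z)\mathcal C$. **Operators in $\mathcal H$.** $l$ is the operator in $\mathfrak K$ with $lg_s(z_j)=z_jg_s(z_j)$;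 $A_0=L_m\hat+l$ (domain $\mathfrak H_{m+2}\dotplus\mathfrak K$); $A_{\max}=L_{\max}\cap\mathcal H^2$, an operator with $A_{\max}=A_0\hat+\{(\widetilde G_z(c),z\widetilde G_z(c)+k_{\min}(c)):c\in\mathbb C^d\}$ for any $z\in\rho(A_0)=\rho(L)\setminus\{z_1,\dots,z_m\}$. $\widetilde\Gamma=(\widetilde\Gamma_0,\widetilde\Gamma_1):\operatorname{dom}A_{\max}\to\mathbb C^{2d}$ is given, for $f\in\mathfrak H_{m+2}$, $k\in\mathfrak K$, $c\in\mathbb C^d$, by $\widetilde\Gamma_0(f+k+\widetilde G_z(c))=c$, $\widetilde\Gamma_1(f+k+\widetilde G_z(c))=\mathcal C^*\langle\varphi,f\rangle+\widetilde R(z)c-\mathcal G_b^*d(k)$ (independent of $z$). **Exit subspace.** $c(k)=(c_s(k))$, $c_s(k)=\sum_jd_{m(s-1)+j}(k)$; $\mathcal M$ is the $d\times md$ matrix $\mathcal M_{si'}=R_{ss'}(z_{j'})$; $\mathfrak K_{\max}=\{k\in\mathfrak K:\operatorname{Im}\langle c(k),\mathcal Md(k)\rangle_{\mathbb C^d}=0\}$. $\mathfrak K_1$ carries $\langle\cdot,\cdot\rangle_{-m}$; $\mathcal H_1=\mathfrak H_m\dotplus\mathfrak K_1\subseteq\mathcal H$. $l_1=P_{\mathfrak K_1}l|_{\mathfrak K_1}$ ($P_{\mathfrak K_1}$ orthogonal projection in $\mathfrak K$ onto $\mathfrak K_1$), self-adjoint in $\mathfrak K_1$. $\mathcal B_0=L_m\hat+l_1$,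 a self-adjoint operator in $\mathcal H_1$; $\mathcal B_{\max}=P_{\mathcal H_1}A_{\max}|_{\mathcal H_1}$ ($P_{\mathcal H_1}$ orthogonal projection in $\mathcal H$ onto $\mathcal H_1$); $\mathsf\Gamma=(\mathsf\Gamma_0,\mathsf\Gamma_1)=\widetilde\Gamma|_{\mathcal H_1}:\operatorname{dom}\mathcal B_{\max}\to\mathbb C^{2d}$. $\mathcal Q(z)=(\langle f_s,(l_1-z)^{-1}f_{s'}\rangle_{-m})_{s,s'}$ for $z\in\rho(l_1)$, and $M_{\mathsf\Gamma}(z)=\widetilde R(z)+\mathcal Q(z)$ for $z\in\rho(\mathcal B_0)$. For a closed relation $\Theta$ in $\mathbb C^d$, $\mathcal B_\Theta$ is the restriction of $\mathcal B_{\max}$ to $\operatorname{dom}\mathcal B_\Theta=\{f\in\operatorname{dom}\mathcal B_{\max}:(\mathsf\Gamma_0f,\mathsf\Gamma_1f)\in\Theta\}$. *)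

(* Defs.v *)
From HB Require Import structures.
From mathcomp Require Import all_boot all_order all_algebra.
From mathcomp Require Import complex.
From mathcomp Require Import mathcomp_extra boolp classical_sets functions.
From mathcomp Require Import reals topology normedtype sequences derive.

Set Implicit Arguments.
Unset Strict Implicit.
Unset Printing Implicit Defensive.

Import Order.TTheory GRing.Theory Num.Theory numFieldNormedType.Exports.
Local Open Scope classical_set_scope.
Local Open Scope ring_scope.
Local Open Scope complex_scope.

(* Several Hilbert spaces (H_n, H_{-n}, K, K_1 and their sums with H_m) live in
   one vector space and carry different scalar products, so a space is a subset of an ambient vector space with a scalar product that
   is meaningful on that subset only. *)
Record hspace (R : realType) (V : lmodType R[i]) := HSpace {
  hcar :> V -> Prop;
  hip : V -> V -> R[i] }.

Definition linsubspace {R : realType} {V : lmodType R[i]} (S : set V) : Prop :=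
  S 0 /\ forall (a : R[i]) u v, S u -> S v -> S (a *: u + v).

Definition hnorm {R : realType} {V : lmodType R[i]} (E : hspace V) (x : V) : R :=
  Num.sqrt (complex.Re (hip E x x)).

Definition hcvg {R : realType} {V : lmodType R[i]} (E : hspace V)
    (u : nat -> V) (x : V) : Prop :=
  (fun n => hnorm E (u n - x)) @ \oo --> (0 : R).

Definition hcauchy {R : realType} {V : lmodType R[i]} (E : hspace V)
    (u : nat -> V) : Prop :=
  forall e : R, 0 < e -> exists N : nat, forall n k : nat,
    (N <= n)%N -> (N <= k)%N -> hnorm E (u n - u k) < e.

(* The scalar product is conjugate-linear in the first argument. *)
Record is_hilbert {R : realType} {V : lmodType R[i]} (E : hspace V) : Prop := {
  hilbert_sub : linsubspace E;
  hilbert_linr : forall (a : R[i]) x y z, E x -> E y -> E z ->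
    hip E x (a *: y + z) = a * hip E x y + hip E x z;
  hilbert_sym : forall x y, E x -> E y -> hip E y x = Num.conj (hip E x y);
  hilbert_ge0 : forall x, E x -> 0 <= hip E x x;
  hilbert_def : forall x, E x -> hip E x x = 0 -> x = 0;
  hilbert_complete : forall u : nat -> V, (forall n, E (u n)) -> hcauchy E u ->
    exists2 x, E x & hcvg E u x }.

Definition hdense {R : realType} {V : lmodType R[i]} (E : hspace V) (S : set V)
    : Prop :=
  forall x (e : R), E x -> 0 < e -> exists y, [/\ S y, E y & hnorm E (y - x) < e].

Definition hseparable {R : realType} {V : lmodType R[i]} (E : hspace V) : Prop :=
  exists s : nat -> V, hdense E (range s).

Definition bounded_map {R : realType} {V W : lmodType R[i]} (E : hspace V)
    (F : hspace W) (f : V -> W) : Prop :=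
  (forall x, E x -> F (f x)) /\
  exists M : R, forall x, E x -> hnorm F (f x) <= M * hnorm E x.

Definition linear_on {R : realType} {V : lmodType R[i]} (S : set V)
    (F : V -> R[i]) : Prop :=
  forall (a : R[i]) x y, S x -> S y -> F (a *: x + y) = a * F x + F y.

Definition bounded_functional {R : realType} {V : lmodType R[i]} (E : hspace V)
    (F : V -> R[i]) : Prop :=
  linear_on E F /\
  exists M : R, forall x, E x -> `|F x| <= (M * hnorm E x)%:C.

(* Inverse of f on A, with a junk value outside the image. *)
Definition inv_on {R : realType} {V W : lmodType R[i]} (A : set V) (f : V -> W)
    (y : W) : V :=
  xget 0 [set x | A x /\ f x = y].

Definition oproj {R : realType} {V : lmodType R[i]} (E : hspace V) (S : set V)
    (u : V) : V :=
  xget 0 [set v | S v /\ forall w, S w -> hip E w (u - v) = 0].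

Definition setsum {R : realType} {V : lmodType R[i]} (A B : set V) : set V :=
  [set u | exists a b, [/\ A a, B b & u = a + b]].

Definition components {R : realType} {V : lmodType R[i]} (A B : set V) (u : V)
    : V * V :=
  xget 0 [set p : V * V | [/\ A p.1, B p.2 & u = p.1 + p.2]].

(* Meaningful for subspaces with trivial intersection only. *)
Definition hdirsum {R : realType} {V : lmodType R[i]} (E F : hspace V)
    : hspace V :=
  HSpace (setsum E F) (fun u v =>
    hip E (components E F u).1 (components E F v).1 +
    hip F (components E F u).2 (components E F v).2).

Definition hextsum {R : realType} {V W : lmodType R[i]} (E : hspace V)
    (F : hspace W) : hspace (V * W)%type :=
  HSpace [set p : V * W | E p.1 /\ F p.2]
         (fun p q => hip E p.1 q.1 + hip F p.2 q.2).

Definition subhspace {R : realType} {V : lmodType R[i]} (E : hspace V)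
    (S : set V) : hspace V := HSpace S (hip E).

Definition adjmx {R : realType} {p q : nat} (A : 'M[R[i]]_(p, q))
    : 'M[R[i]]_(q, p) := (map_mx Num.conj A)^T.

Definition cdot {R : realType} {d : nat} (x y : 'cV[R[i]]_d) : R[i] :=
  \sum_i Num.conj (x i 0) * y i 0.

Definition Cspace (R : realType) (d : nat) : hspace 'cV[R[i]]_d :=
  HSpace setT cdot.

Definition lincomb {R : realType} {V : lmodType R[i]} {d : nat}
    (e : 'I_d -> V) (c : 'cV[R[i]]_d) : V := \sum_s c s 0 *: e s.

Definition linindep {R : realType} {V : lmodType R[i]} {d : nat}
    (e : 'I_d -> V) : Prop :=
  forall c, lincomb e c = 0 -> c = 0.

Definition has_dim {R : realType} {V : lmodType R[i]} (S : set V) (n : nat)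
    : Prop :=
  exists2 e : 'I_n -> V, linindep e & S = range (lincomb e).

Definition lrel {R : realType} (V W : lmodType R[i]) := set (V * W)%type.

Definition graph {R : realType} {V W : lmodType R[i]} (f : V -> W) : lrel V W :=
  [set p | p.2 = f p.1].

Definition rdom {R : realType} {V W : lmodType R[i]} (T : lrel V W) : set V :=
  [set x | exists y, T (x, y)].

Definition rrestr {R : realType} {V W : lmodType R[i]} (T : lrel V W)
    (S : set V) : lrel V W := [set p | T p /\ S p.1].

Definition single_valued {R : realType} {V W : lmodType R[i]} (T : lrel V W)
    : Prop := forall x y z, T (x, y) -> T (x, z) -> y = z.

(* Meaningful for a single-valued T with x in its domain only. *)
Definition rapp {R : realType} {V W : lmodType R[i]} (T : lrel V W) (x : V) : W :=
  xget 0 [set y | T (x, y)].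

Definition rinv {R : realType} {V W : lmodType R[i]} (T : lrel V W) : lrel W V :=
  [set p | T (p.2, p.1)].

Definition rcomp {R : realType} {U V W : lmodType R[i]} (S : lrel V W)
    (T : lrel U V) : lrel U W :=
  [set p | exists2 y, T (p.1, y) & S (y, p.2)].
Notation "S '\oR' T" := (rcomp S T) (at level 40, left associativity).

(* radd and rsub are operatorwise; rhatsum is the componentwise sum of
   subspaces. *)
Definition radd {R : realType} {V W : lmodType R[i]} (S T : lrel V W)
    : lrel V W :=
  [set p | exists y z, [/\ S (p.1, y), T (p.1, z) & p.2 = y + z]].

Definition rsub {R : realType} {V W : lmodType R[i]} (S T : lrel V W)
    : lrel V W :=
  [set p | exists y z, [/\ S (p.1, y), T (p.1, z) & p.2 = y - z]].

Definition ropp {R : realType} {V W : lmodType R[i]} (T : lrel V W)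
    : lrel V W := [set p | T (p.1, - p.2)].

Definition rhatsum {R : realType} {V W : lmodType R[i]} (S T : lrel V W)
    : lrel V W := setsum S T.

Definition resolvent {R : realType} {V : lmodType R[i]} (T : lrel V V)
    (z : R[i]) : lrel V V := rinv (rsub T (graph (fun x => z *: x))).

Fixpoint rpow {R : realType} {V : lmodType R[i]} (S : set V) (T : lrel V V)
    (n : nat) : lrel V V :=
  if n is n'.+1 then T \oR rpow S T n' else rrestr (graph id) S.

Definition radj {R : realType} {V W : lmodType R[i]} (E : hspace V)
    (F : hspace W) (T : lrel V W) : lrel W V :=
  [set p | [/\ F p.1, E p.2 &
    forall x y, T (x, y) -> hip F p.1 y = hip E p.2 x]].

Definition is_lrel {R : realType} {V W : lmodType R[i]} (E : hspace V)
    (F : hspace W) (T : lrel V W) : Prop :=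
  linsubspace T /\ forall p, T p -> E p.1 /\ F p.2.

Definition is_closed {R : realType} {V W : lmodType R[i]} (E : hspace V)
    (F : hspace W) (T : lrel V W) : Prop :=
  is_lrel E F T /\
  forall (u : nat -> (V * W)%type) x y, (forall n, T (u n)) -> E x -> F y ->
    hcvg E (fun n => (u n).1) x -> hcvg F (fun n => (u n).2) y -> T (x, y).

Definition is_symmetric {R : realType} {V : lmodType R[i]} (E : hspace V)
    (T : lrel V V) : Prop := is_lrel E E T /\ T `<=` radj E E T.

Definition is_selfadjoint {R : realType} {V : lmodType R[i]} (E : hspace V)
    (T : lrel V V) : Prop := is_lrel E E T /\ T = radj E E T.

Definition is_selfadjoint_operator {R : realType} {V : lmodType R[i]}
    (E : hspace V) (T : lrel V V) : Prop :=
  [/\ single_valued T, hdense E (rdom T) & is_selfadjoint E T].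

Definition is_nonneg {R : realType} {V : lmodType R[i]} (E : hspace V)
    (T : lrel V V) : Prop := forall x y, T (x, y) -> 0 <= hip E x y.

(* Such an S is unique. *)
Definition is_sqrt {R : realType} {V : lmodType R[i]} (E : hspace V)
    (T S : lrel V V) : Prop :=
  [/\ is_selfadjoint_operator E S, is_nonneg E S & S \oR S = T].

Definition rho {R : realType} {V : lmodType R[i]} (E : hspace V) (T : lrel V V)
    : set R[i] :=
  [set z | [/\ single_valued (resolvent T z),
               rdom (resolvent T z) = E,
               (forall x y, resolvent T z (x, y) -> E y) &
               exists M : R, forall x y, resolvent T z (x, y) ->
                 hnorm E y <= M * hnorm E x]].

(* Both defect numbers of T in E are equal to n. *)
Definition defect_numbers {R : realType} {V : lmodType R[i]} (E : hspace V)
    (T : lrel V V) (n : nat) : Prop :=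
  forall z : R[i], complex.Im z != 0 ->
    has_dim [set x | radj E E T (x, z *: x)] n.

Definition holomorphic_at {R : realType} (f : R[i] -> R[i]) (z : R[i]) : Prop :=
  derivable (f : R[i]^o -> R[i]^o) z 1.

Definition nevanlinna_matrix {R : realType} {d : nat} (M : R[i] -> 'M[R[i]]_d)
    : Prop :=
  forall z : R[i], complex.Im z != 0 ->
  [/\ forall i j, holomorphic_at (fun w => M w i j) z,
      adjmx (M z) = M (Num.conj z) &
      forall x, 0 <= complex.Im (cdot x (M z *m x)) / complex.Im z].

(* Nevanlinna family in C^d: tau(z) is maximal dissipative (accumulative) for z
   in the upper (lower) half-plane, tau(z)^* = tau(conj z), and for every w in
   the half-plane of z the inverse (tau(z) + w)^{-1} is an everywhere defined
   operator, holomorphic in z. *)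
Definition nevanlinna_family {R : realType} {d : nat}
    (tau : R[i] -> lrel 'cV[R[i]]_d 'cV[R[i]]_d) : Prop :=
  [/\ forall z, complex.Im z != 0 ->
        [/\ linsubspace (tau z),
            radj (Cspace R d) (Cspace R d) (tau z) = tau (Num.conj z) &
            forall x y, tau z (x, y) ->
              0 <= complex.Im (cdot x y) / complex.Im z] &
      forall w, complex.Im w != 0 -> exists N : R[i] -> 'M[R[i]]_d,
        forall z, 0 < complex.Im z * complex.Im w ->
          rinv (radd (tau z) (graph (fun x => w *: x))) = graph (mulmx (N z)) /\
          forall i j, holomorphic_at (fun v => N v i j) z].

(* X is the union of the spaces H_{-n}; all spaces H_n, H_{-n} lie in X.
   The extensions of L and Omega_n to X are denoted by sL and sOm n. *)
Record scale (R : realType) (X : lmodType R[i]) := Scale {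
  sH0 : hspace X;
  sL0 : lrel X X;                  (* the operator L in H_0 *)
  sabs : lrel X X;                 (* |L| *)
  shalf : lrel X X;                (* |L|^{1/2} *)
  sL : {linear X -> X};
  sOm : nat -> {linear X -> X};
  sneg : nat -> set X;             (* the set H_{-n} *)
  spair : X -> X -> R[i] }.        (* H_{-n} x H_n -> C, for every n *)

(* H_n = dom |L|^{n/2} *)
Definition Hpos {R : realType} {X : lmodType R[i]} (S : scale X) (n : nat)
    : hspace X :=
  HSpace (rdom (rpow (sH0 S) (shalf S) n))
         (fun f g => hip (sH0 S) (sOm S n f) (sOm S n g)).

Definition Hneg {R : realType} {X : lmodType R[i]} (S : scale X) (n : nat)
    : hspace X :=
  HSpace (sneg S n)
         (fun p q => hip (sH0 S) (inv_on (sH0 S) (sOm S n) p)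
                                 (inv_on (sH0 S) (sOm S n) q)).

Definition Hscale {R : realType} {X : lmodType R[i]} (S : scale X) (k : int)
    : hspace X :=
  match k with Posz n => Hpos S n | Negz n => Hneg S n.+1 end.

Record is_scale {R : realType} {X : lmodType R[i]} (S : scale X) : Prop := {
  scale_hilbert : is_hilbert (sH0 S);
  scale_separable : hseparable (sH0 S);
  scale_selfadjoint : is_selfadjoint_operator (sH0 S) (sL0 S);
  scale_abs : is_sqrt (sH0 S) (sL0 S \oR sL0 S) (sabs S);
  scale_half : is_sqrt (sH0 S) (sabs S) (shalf S);
  (* H_n = dom L^{n/2} = dom |L|^{n/2} for even exponents *)
  scale_dom : forall n, rdom (rpow (sH0 S) (sL0 S) n) = Hpos S n.*2;
  scale_Om0 : forall x, sOm S 0%N x = x;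
  scale_Om_unitary : forall n, set_bij (Hpos S n) (sH0 S) (sOm S n);
  scale_Om1 : sOm S 1%N @` Hpos S 2 = Hpos S 1;
  scale_Om2 : forall n, sOm S n @` Hpos S n.+2 = Hpos S 2;
  scale_Om_selfadjoint : forall n,
    is_selfadjoint_operator (sH0 S) (rrestr (graph (sOm S n)) (Hpos S n));
  scale_Om_L : forall n x, sL S (sOm S n x) = sOm S n (sL S x);
  scale_Om_comm : forall n k x, sOm S n (sOm S k x) = sOm S k (sOm S n x);
  (* H_{-n} is the dual of H_n, the pairing being conjugate-linear in its first
     argument *)
  scale_neg_sub : forall n, linsubspace (sneg S n);
  scale_pair_functional : forall n p, sneg S n p ->
    bounded_functional (Hpos S n) (spair S p);
  scale_pair_conj : forall n (a : R[i]) p q f,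
    sneg S n p -> sneg S n q -> Hpos S n f ->
    spair S (a *: p + q) f = Num.conj a * spair S p f + spair S q f;
  scale_pair_inj : forall n p, sneg S n p ->
    (forall f, Hpos S n f -> spair S p f = 0) -> p = 0;
  scale_pair_surj : forall n (F : X -> R[i]), bounded_functional (Hpos S n) F ->
    exists2 p, sneg S n p & forall f, Hpos S n f -> spair S p f = F f;
  (* the identifications H_0 = H_{-0} (by n = 0 in scale_Omt_unitary),
     H_{-n} in H_{-n-1}, and X is the union of the H_{-n} *)
  scale_neg_incl : forall n, sneg S n `<=` sneg S n.+1;
  scale_union : forall x, exists n, sneg S n x;
  (* the extension of Omega_n to H_0 -> H_{-n}; for n = 0 the second formula
     says that the pairing extends the scalar product of H_0 *)
  scale_Omt_unitary : forall n, set_bij (sH0 S) (sneg S n) (sOm S n);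
  scale_Omt_pair : forall n u f, sH0 S u -> Hpos S n f ->
    spair S (sOm S n u) f = hip (sH0 S) u (sOm S n f);
  (* sL is the extension of L by continuity to maps H_{2-n} -> H_{-n} *)
  scale_L_ext : forall x y, sL0 S (x, y) -> sL S x = y;
  scale_L_bounded : forall n : nat,
    bounded_map (Hscale S (2 - n%:Z)) (Hscale S (- n%:Z)) (sL S) }.

Definition rhoL {R : realType} {X : lmodType R[i]} (S : scale X) : set R[i] :=
  rho (sH0 S) (sL0 S).

(* L_n, the operator L in H_n with domain H_{n+2} *)
Definition Lpos {R : realType} {X : lmodType R[i]} (S : scale X) (n : nat)
    : lrel X X := rrestr (graph (sL S)) (Hpos S n.+2).

(* (L - z)^{-1} on the whole scale *)
Definition resL {R : realType} {X : lmodType R[i]} (S : scale X) (z : R[i])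
    : X -> X := inv_on setT (fun x => sL S x - z *: x).

Record model (R : realType) (X : lmodType R[i]) (m d : nat) := Model {
  mS :> scale X;
  phi : 'I_d -> X;
  phic : 'I_d -> X -> R[i];  (* continuation of <phi_s, .> to H_m *)
  zpt : 'I_m -> R[i] }.

Section Model.
Context {R : realType} {X : lmodType R[i]} {m d : nat} (D : model X m d).

(* <phi, f> for f in H_{m+2} *)
Definition phipair (f : X) : 'cV[R[i]]_d := \col_s spair D (phi D s) f.

Definition Lmin : lrel X X :=
  rrestr (graph (sL D)) [set f | Hpos D m.+2 f /\ phipair f = 0].

Definition Lmax : lrel X X :=
  [set p | [/\ Hneg D m p.1, Hneg D m p.2 &
    forall f, rdom Lmin f -> spair D p.2 f = spair D p.1 (sL D f)]].

(* P(L) = Omega_m^2 *)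
Definition PL (x : X) : X := sOm D m (sOm D m x).
Definition PLinv : X -> X := inv_on setT PL.

Definition gs (z : R[i]) (s : 'I_d) : X := resL D z (phi D s).
Definition Gs (z : R[i]) (s : 'I_d) : X := PLinv (gs z s).
Definition Gz (z : R[i]) (c : 'cV[R[i]]_d) : X := lincomb (Gs z) c.

Definition Rmx (z : R[i]) : 'M[R[i]]_d :=
  \matrix_(s, s') phic D s (Gs z s').

(* the vectors f_s, where Ptilde(L) = prod_j (L - z_j) *)
Definition PtL (x : X) : X :=
  foldr (fun j y => sL D y - zpt D j *: y) x (enum 'I_m).
Definition fs (s : 'I_d) : X := inv_on setT PtL (phi D s).
Definition kmin (chi : 'cV[R[i]]_d) : X := lincomb fs chi.

Definition es (s : 'I_d) : X := PLinv (phi D s).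

Definition ipm : X -> X -> R[i] := hip (Hneg D m).

Definition Amx : 'M[R[i]]_d := \matrix_(s, s') ipm (es s) (fs s').
Definition Bmx : 'M[R[i]]_d := \matrix_(s, s') ipm (es s) (es s').
Definition Cmx : 'M[R[i]]_d := invmx Bmx *m Amx.

Definition Gtz (z : R[i]) (c : 'cV[R[i]]_d) : X := Gz z (Cmx *m c).
Definition Rtmx (z : R[i]) : 'M[R[i]]_d := adjmx Cmx *m Rmx z *m Cmx.

(* The index i = m(s-1)+j of the pair (s,j) is mxvec_index s j (counted from 0):
   a family indexed by i is the mxvec of a d x m matrix. *)
Definition Kcomb (A : 'M[R[i]]_(d, m)) : X :=
  \sum_s \sum_j A s j *: gs (zpt D j) s.
Definition Kspace : hspace X := subhspace (Hneg D m) (range Kcomb).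
Definition Kcoef (k : X) : 'M[R[i]]_(d, m) := xget 0 [set A | Kcomb A = k].
Definition dcoef (k : X) : 'cV[R[i]]_(d * m) := (mxvec (Kcoef k))^T.
Definition ccoef (k : X) : 'cV[R[i]]_d :=
  \col_s \sum_j dcoef k (mxvec_index s j) 0.

Definition Gb : 'M[R[i]]_(d * m, d) :=
  (\matrix_(s' < d) mxvec (\matrix_(s < d, j < m)
     ipm (gs (zpt D j) s) (fs s')))^T.

Definition Mmx : 'M[R[i]]_(d, d * m) :=
  \matrix_(s < d) mxvec (\matrix_(s' < d, j < m) Rmx (zpt D j) s s').

Definition Kmin : set X := Kspace `&` Hpos D (m - 2).
Definition Kmax : set X :=
  [set k | Kspace k /\ complex.Im (cdot (ccoef k) (Mmx *m dcoef k)) = 0].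

Definition Hm : hspace X := Hpos D m.
Definition Hcal : hspace X := hdirsum Hm Kspace.

Definition lop (k : X) : X :=
  Kcomb (\matrix_(s, j) (zpt D j * Kcoef k s j)).

Definition Amax : lrel X X := [set p | [/\ Lmax p, Hcal p.1 & Hcal p.2]].

(* (Gammatilde_0, Gammatilde_1) on dom A_max; the pair does not depend on the
   choice of z in rho(L) \ {z_1, ..., z_m} *)
Definition Gammat (u : X) : 'cV[R[i]]_d * 'cV[R[i]]_d :=
  xget 0 [set p : 'cV[R[i]]_d * 'cV[R[i]]_d | exists z f k c,
    [/\ rhoL D z, forall j, z != zpt D j,
        Hpos D m.+2 f /\ Kspace k,
        u = f + k + Gtz z c &
        p = (c, adjmx Cmx *m phipair f + Rtmx z *m c
                - adjmx Gb *m dcoef k)]].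

Section ExitSubspace.
Context (K1 : set X).

Definition K1space : hspace X := subhspace Kspace K1.
Definition H1 : hspace X := subhspace Hcal (setsum Hm K1).

Definition l1 : lrel X X :=
  rrestr (graph (fun k => oproj Kspace K1 (lop k))) K1.
Definition B0 : lrel X X := rhatsum (Lpos D m) l1.
Definition Bmax : lrel X X := graph (oproj Hcal H1) \oR rrestr Amax H1.

Definition Qmx (z : R[i]) : 'M[R[i]]_d :=
  \matrix_(s, s') ipm (fs s) (rapp (resolvent l1 z) (fs s')).
Definition MGamma (z : R[i]) : 'M[R[i]]_d := Rtmx z + Qmx z.

Definition BTheta (Theta : lrel 'cV[R[i]]_d 'cV[R[i]]_d) : lrel X X :=
  rrestr Bmax [set u | Theta (Gammat u)].

(* f + k |-> (f, k) *)
Definition Umap : lrel X (X * X)%type :=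
  [set p | [/\ Hm p.2.1, K1 p.2.2 & p.1 = p.2.1 + p.2.2]].

(* The Krein-Naimark formula for a relation T in H_1 at the point z, with
   gamma-field G_z and Weyl function R. *)
Definition KN_formula (T : lrel X X) (tau : lrel 'cV[R[i]]_d 'cV[R[i]]_d)
    (z : R[i]) : Prop :=
  graph (oproj H1 Hm) \oR rrestr (resolvent T z) Hm =
  rsub (resolvent (Lpos D m) z)
       (graph (Gz z)
        \oR rinv (radd tau (graph (mulmx (Rmx z))))
        \oR radj (Cspace R d) Hm (graph (Gz (Num.conj z)))).

(* tau is the Nevanlinna family that corresponds to the generalized resolvent
   P (T - z)^{-1} restricted to H_m. The family is determined by the nonreal z;
   dom is the set of all z for which tau is given. *)
Definition KN_corresponds (T : lrel X X) (dom : set R[i])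
    (tau : R[i] -> lrel 'cV[R[i]]_d 'cV[R[i]]_d) : Prop :=
  [/\ is_selfadjoint H1 T /\ Lmin `<=` T,
      nevanlinna_family tau,
      forall z, rho H1 T z -> rhoL D z -> dom z -> KN_formula T (tau z) z &
      forall tau', nevanlinna_family tau' ->
        (forall z, complex.Im z != 0 -> KN_formula T (tau' z) z) ->
        forall z, complex.Im z != 0 -> tau' z = tau z].

End ExitSubspace.

Record standing : Prop := {
  standing_scale : is_scale D;
  standing_phi : forall s, sneg D m.+2 (phi D s) /\ ~ sneg D m.+1 (phi D s);
  standing_indep : linindep (phi D);
  standing_Lmin_closed : is_closed Hm Hm Lmin;
  standing_Lmin_dense : hdense Hm (rdom Lmin);
  standing_Lmin_symmetric : is_symmetric Hm Lmin;
  standing_Lmin_defect : defect_numbers Hm Lmin d;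
  standing_phic_linear : forall s, linear_on Hm (phic D s);
  standing_phic_ext : forall s f, Hpos D m.+2 f ->
    phic D s f = spair D (phi D s) f;
  standing_R : nevanlinna_matrix Rmx;
  standing_z_inj : injective (zpt D);
  standing_z : forall j, rhoL D (zpt D j);
  standing_fs : forall s, fs s = \sum_s' Cmx s' s *: es s';
  standing_C : Cmx \in unitmx }.

End Model.

(* The operator matrix with entries T_ij : X_j -> X_i. *)
Definition block_rel {R : realType} {V W : lmodType R[i]} (T11 : lrel V V)
    (T12 : lrel W V) (T21 : lrel V W) (T22 : lrel W W)
    : lrel (V * W)%type (V * W)%type :=
  [set p | exists a b c e,
    [/\ T11 (p.1.1, a), T12 (p.1.2, b), T21 (p.1.1, c), T22 (p.1.2, e) &
        p.2 = (a + b, c + e)]].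

(* Main.v *)
Require Import Defs.
From HB Require Import structures.
From mathcomp Require Import all_boot all_order all_algebra.
From mathcomp Require Import complex.
From mathcomp Require Import mathcomp_extra boolp classical_sets functions.
From mathcomp Require Import reals topology normedtype sequences derive.
From mathcomp Require Import ring lra zify.

Set Implicit Arguments.
Unset Strict Implicit.
Unset Printing Implicit Defensive.

Import Order.TTheory GRing.Theory Num.Theory numFieldNormedType.Exports.
Local Open Scope classical_set_scope.
Local Open Scope ring_scope.
Local Open Scope complex_scope.

(* In the scale, [L - z] is a bijection from H_k onto H_{k-2} for every integer
   [k] when [z] is in the resolvent set, so G_z, f_s and the space K can be
   handled algebraically.  No nontrivial combination of the phi_s lies in
   H_{-m}; applying [L] repeatedly to [k = sum_j (L - z_j)^{-1} phi(a_j)] and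
   reading off the moments [sum_j z_j^i a_j] then gives (by Vandermonde) that K
   meets H_m trivially and that K meets H_{m-2} in span f_s.  Hence every element
   of dom B_max is f + G_z(C c) + k, and B_max with the given maps Gamma is a
   boundary triple, with extension B_0 = B_max|_{ker Gamma_0}, gamma field
   G_z C - (l_1 - z)^{-1} k_min and Weyl function M_Gamma; the symmetry of l_1
   on K_1 is polarization of the condition defining K_max.  Solving
   (Gamma_0, Gamma_1) u in Theta for u = (B_0 - z)^{-1} h + gamma(z) c gives the
   block matrix.  Its upper left corner is the Krein-Naimark formula for tau,
   because Theta - M_Gamma = - C^* (tau + R) C. *)

(** The functionals <phi_s, .> are continued to H_m only linearly, so continuity of the maps Gamma
    is not at hand, and closedness of B_Theta is not read off from them. It comes from B_Theta being
    the adjoint of B_Theta', where Theta' is the adjoint of Theta. That duality rests on Green's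
    identity together with an explicit resolvent and gamma field at the regular points: projecting
    onto the d-dimensional range of the gamma field shows that the adjoint has no larger domain than
    the maximal operator. Completeness enters through one fact, that nonreal points belong to the
    resolvent set of the self-adjoint operator L in H_0; on K and K_1 finite dimension takes its
    place. The standing hypotheses give R(z)^* = R(conj z) at nonreal z only, while some z_j may be
    real. The form of l on K, and with it the meaning of K_max, needs the real points too; they are
    reached by comparison with z = i. *)

(** * Linear identities in modules *)

Section LmodReflection.
Context {K : comRingType} {V : lmodType K}.

(** Scalars stay unreified elements of K: an identity between vectors becomes one ring identity for
    the coefficient of each atom. *)
Inductive lexp :=
  LVar of nat | LZero | LAdd of lexp & lexp | LOpp of lexp | LScale of K & lexp.

Fixpoint leval (env : seq V) e : V :=
  match e with
  | LVar n => nth 0 env n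
  | LZero => 0
  | LAdd e1 e2 => leval env e1 + leval env e2
  | LOpp e1 => - leval env e1
  | LScale a e1 => a *: leval env e1
  end.

Fixpoint lcoef e (n : nat) : K :=
  match e with
  | LVar k => if eqn k n then 1 else 0
  | LZero => 0
  | LAdd e1 e2 => lcoef e1 n + lcoef e2 n
  | LOpp e1 => - lcoef e1 n
  | LScale a e1 => a * lcoef e1 n
  end.

(** A conjunction computed by recursion, so that simplifying and splitting it leaves one scalar goal
    per atom. *)
Fixpoint lcoef_eq e1 e2 (n : nat) : Prop :=
  if n is n'.+1 then lcoef e1 n' = lcoef e2 n' /\ lcoef_eq e1 e2 n' else True.

Lemma levalE env e :
  leval env e = \sum_(i < size env) lcoef e i *: nth 0 env i.
Proof.
elim: e => [n||e1 h1 e2 h2|e1 h1|a e1 h1] /=.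
- have [nlt|nge] := ltnP n (size env).
    rewrite (bigD1 (Ordinal nlt)) //= eqnE eqxx scale1r big1 ?addr0 // => i ne.
    rewrite -[X in X == _]/(nat_of_ord (Ordinal nlt)).
    by case: eqP => [/val_inj e|_]; [rewrite e eqxx in ne | rewrite scale0r].
  rewrite nth_default // big1 // => i _; rewrite eqnE; case: eqP => [e|_].
    by move: (ltn_ord i); rewrite -e ltnNge nge.
  by rewrite scale0r.
- by rewrite big1 // => i _; rewrite scale0r.
- by rewrite h1 h2 -big_split /=; apply: eq_bigr => i _; rewrite scalerDl.
- by rewrite h1 -sumrN; apply: eq_bigr => i _; rewrite scaleNr.
- by rewrite h1 scaler_sumr; apply: eq_bigr => i _; rewrite scalerA.
Qed.

Lemma leval_eq env e1 e2 :
  lcoef_eq e1 e2 (size env) -> leval env e1 = leval env e2.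
Proof.
move=> h; rewrite !levalE; apply: eq_bigr => i _; congr (_ *: _).
elim: (size env) i h => [[]//|n IH] i /= [h0 h1].
have [->//|ne] := eqVneq (i : nat) n.
have lt : (i < n)%N by move: (ltn_ord i); rewrite ltnS leq_eqVlt (negbTE ne).
exact: (IH (Ordinal lt)).
Qed.
End LmodReflection.

(* Atoms are compared up to conversion: the same linear map may occur with
   different structure instances. *)
Ltac lmod_index x env :=
  lazymatch env with
  | ?y :: ?t =>
    match constr:(Set) with
    | _ => let _ := match constr:(Set) with _ => unify x y end in constr:(O)
    | _ => let n := lmod_index x t in constr:(S n)
    end
  end.
Ltac lmod_mem x env :=
  lazymatch env with
  | nil => constr:(false)
  | ?y :: ?t =>
    match constr:(Set) with
    | _ => let _ := match constr:(Set) with _ => unify x y end in constr:(true)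
    | _ => lmod_mem x t
    end
  end.
Ltac lmod_vars t env :=
  lazymatch t with
  | @GRing.add _ ?a ?b => let e := lmod_vars a env in lmod_vars b e
  | @GRing.opp _ ?a => lmod_vars a env
  | @GRing.scale _ _ _ ?a => lmod_vars a env
  | @GRing.zero _ => env
  | _ => lazymatch lmod_mem t env with
         | true => env | false => constr:(t :: env) end
  end.
Ltac lmod_reify K t env :=
  lazymatch t with
  | @GRing.add _ ?a ?b =>
    let x := lmod_reify K a env in let y := lmod_reify K b env in
    constr:(@LAdd K x y)
  | @GRing.opp _ ?a => let x := lmod_reify K a env in constr:(@LOpp K x)
  | @GRing.scale _ _ ?k ?a =>
    let x := lmod_reify K a env in constr:(@LScale K k x)
  | @GRing.zero _ => constr:(@LZero K)
  | _ => let n := lmod_index t env in constr:(@LVar K n)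
  end.
(* Linear identities in a module: reduces [x = y] to the equality of the
   coefficients of the atoms. *)
Ltac lmod_with K :=
  lazymatch goal with
  | |- @eq ?V ?x ?y =>
    let env := lmod_vars x (@nil V) in let env := lmod_vars y env in
    let e1 := lmod_reify K x env in let e2 := lmod_reify K y env in
    apply: (@leval_eq K _ env e1 e2); simpl; repeat split
  end.

(** * Scalar products *)

Section Complex.
Context {R : realType}.
Local Notation C := R[i].

Lemma conj_conjc (z : C) : Num.conj z = conjc z. Proof. by []. Qed.

Lemma conjD (x y : C) : Num.conj (x + y) = Num.conj x + Num.conj y.
Proof. exact: rmorphD. Qed.
Lemma conjN (x : C) : Num.conj (- x) = - Num.conj x.
Proof. exact: rmorphN. Qed.
Lemma conjB (x y : C) : Num.conj (x - y) = Num.conj x - Num.conj y.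
Proof. exact: rmorphB. Qed.
Lemma conjM (x y : C) : Num.conj (x * y) = Num.conj x * Num.conj y.
Proof. exact: rmorphM. Qed.
Lemma conjV (x : C) : Num.conj x^-1 = (Num.conj x)^-1.
Proof. exact: fmorphV. Qed.
Lemma conj_sum (I : Type) (r : seq I) (P : pred I) (F : I -> C) :
  Num.conj (\sum_(i <- r | P i) F i) = \sum_(i <- r | P i) Num.conj (F i).
Proof. exact: rmorph_sum. Qed.

Lemma realcX (a : R) n : (a ^+ n)%:C = a%:C ^+ n. Proof. exact: rmorphXn. Qed.
Lemma realcM (a b : R) : (a * b)%:C = a%:C * b%:C. Proof. exact: rmorphM. Qed.
Lemma realcD (a b : R) : (a + b)%:C = a%:C + b%:C. Proof. exact: rmorphD. Qed.
Lemma realcMn (a : R) n : (a *+ n)%:C = a%:C *+ n. Proof. exact: rmorphMn. Qed.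

Lemma Im_conj (z : C) : complex.Im (Num.conj z) = - complex.Im z.
Proof. by case: z. Qed.

Lemma conj_Im0 (z : C) : complex.Im z = 0 -> Num.conj z = z.
Proof. by case: z => a b /= ->; rewrite conj_conjc /= oppr0. Qed.

Lemma Im0_conj (z : C) : Num.conj z = z -> complex.Im z = 0.
Proof. by case: z => a b [] /eqP; rewrite -subr_eq0 -opprD oppr_eq0 -mulr2n mulrn_eq0 /= => /eqP. Qed.

Lemma ImD (x y : C) : complex.Im (x + y) = complex.Im x + complex.Im y.
Proof. by case: x; case: y. Qed.
Lemma ImN (x : C) : complex.Im (- x) = - complex.Im x.
Proof. by case: x. Qed.
Lemma ImMr (x : C) (a : R) : complex.Im (x * a%:C) = complex.Im x * a.
Proof. by case: x => u v /=; rewrite mulr0 add0r. Qed.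

Lemma Im_le_norm (z : C) : `|complex.Im z|%:C <= `|z|.
Proof.
rewrite normc_def lecR -[X in X <= _]sqrtr_sqr ler_sqrt.
  by rewrite lerDr sqr_ge0.
by rewrite addr_ge0 // sqr_ge0.
Qed.

Lemma Re_le_norm (z : C) : (complex.Re z)%:C <= `|z|.
Proof. by apply: le_trans (normc_ge_Re z); rewrite lecR ler_norm. Qed.

Lemma norm_ReE (z : C) : `|z| = (complex.Re `|z|)%:C.
Proof. by rewrite normc_def. Qed.

Lemma eq0_le_eps (z : C) : (forall e : R, 0 < e -> `|z| <= e%:C) -> z = 0.
Proof.
move=> h; apply/eqP/negPn/negP => nz.
have : 0 < `|z| by rewrite normr_gt0.
have := h (complex.Re `|z| / 2); rewrite norm_ReE /= !ltcR lecR => h1 h2.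
have h3 : 0 < complex.Re `|z| / 2 by rewrite divr_gt0.
by have := h1 h3; lra.
Qed.
End Complex.

Ltac lmod := match goal with |- @eq ?V _ _ =>
  match goal with R : realType |- _ => lmod_with (R[i]); ring end end.

Section Subspace.
Context {R : realType} {V : lmodType R[i]} (S : set V) (hS : linsubspace S).

Lemma sub0 : S 0. Proof. exact: hS.1. Qed.
Lemma subZD a x y : S x -> S y -> S (a *: x + y). Proof. exact: hS.2. Qed.
Lemma subD x y : S x -> S y -> S (x + y).
Proof. by move=> hx hy; rewrite -[x]scale1r; apply: subZD. Qed.
Lemma subZ a x : S x -> S (a *: x).
Proof. by move=> hx; rewrite -[_ *: _]addr0; apply: subZD => //; apply: sub0. Qed.
Lemma subN x : S x -> S (- x). Proof. by rewrite -scaleN1r; apply: subZ. Qed.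
Lemma subB x y : S x -> S y -> S (x - y).
Proof. by move=> hx hy; apply: subD => //; apply: subN. Qed.
Lemma sub_sum (I : Type) (r : seq I) (P : pred I) (F : I -> V) :
  (forall i, P i -> S (F i)) -> S (\sum_(i <- r | P i) F i).
Proof. by move=> h; elim/big_ind: _ => //; [exact: sub0 | exact: subD]. Qed.
End Subspace.

(** The axioms of a scalar product apart from completeness; K, K_1, H_1 and C^d are used through
    these. *)
Record preh {R : realType} {V : lmodType R[i]} (E : hspace V) : Prop := {
  preh_sub : linsubspace E;
  preh_linr : forall (a : R[i]) x y z, E x -> E y -> E z ->
    hip E x (a *: y + z) = a * hip E x y + hip E x z;
  preh_sym : forall x y, E x -> E y -> hip E y x = Num.conj (hip E x y);
  preh_ge0 : forall x, E x -> 0 <= hip E x x;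
  preh_def : forall x, E x -> hip E x x = 0 -> x = 0 }.

Lemma hilbert_preh {R : realType} {V : lmodType R[i]} (E : hspace V) :
  is_hilbert E -> preh E.
Proof. by case=> *; split. Qed.

Section Preh.
Context {R : realType} {V : lmodType R[i]} (E : hspace V) (hE : preh E).
Local Notation C := R[i].
Implicit Types x y z : V.

Let sE := preh_sub hE.
Lemma ph0 : E 0. Proof. exact: sub0. Qed.
Lemma phD x y : E x -> E y -> E (x + y). Proof. exact: subD. Qed.
Lemma phZ a x : E x -> E (a *: x). Proof. exact: subZ. Qed.
Lemma phN x : E x -> E (- x). Proof. exact: subN. Qed.
Lemma phB x y : E x -> E y -> E (x - y). Proof. exact: subB. Qed.

Lemma hipDr x y z : E x -> E y -> E z -> hip E x (y + z) = hip E x y + hip E x z.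
Proof. by move=> hx hy hz; rewrite -[y]scale1r preh_linr // mul1r scale1r. Qed.
Lemma hip0r x : E x -> hip E x 0 = 0.
Proof.
move=> hx; have /eqP := hipDr hx ph0 ph0.
by rewrite addr0 -subr_eq0 opprD addNKr oppr_eq0 => /eqP.
Qed.
Lemma hipZr a x y : E x -> E y -> hip E x (a *: y) = a * hip E x y.
Proof.
by move=> hx hy; rewrite -[a *: y]addr0 preh_linr ?hip0r ?addr0 //; apply: ph0.
Qed.
Lemma hipNr x y : E x -> E y -> hip E x (- y) = - hip E x y.
Proof. by move=> hx hy; rewrite -scaleN1r hipZr // mulN1r. Qed.
Lemma hipBr x y z : E x -> E y -> E z -> hip E x (y - z) = hip E x y - hip E x z.
Proof. by move=> hx hy hz; rewrite hipDr ?hipNr //; apply: phN. Qed.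
Lemma hipDl x y z : E x -> E y -> E z -> hip E (x + y) z = hip E x z + hip E y z.
Proof.
move=> hx hy hz; rewrite preh_sym ?hipDr //; last exact: phD.
by rewrite conjD -!preh_sym.
Qed.
Lemma hip0l x : E x -> hip E 0 x = 0.
Proof. by move=> hx; rewrite preh_sym ?hip0r ?conjC0 //; apply: ph0. Qed.
Lemma hipZl a x y : E x -> E y -> hip E (a *: x) y = Num.conj a * hip E x y.
Proof.
move=> hx hy; rewrite preh_sym ?hipZr // ?conjM -?preh_sym //; exact: phZ.
Qed.
Lemma hipNl x y : E x -> E y -> hip E (- x) y = - hip E x y.
Proof. by move=> hx hy; rewrite -scaleN1r hipZl // conjN conjC1 mulN1r. Qed.
Lemma hipBl x y z : E x -> E y -> E z -> hip E (x - y) z = hip E x z - hip E y z.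
Proof. by move=> hx hy hz; rewrite hipDl ?hipNl //; apply: phN. Qed.

Lemma hip_sumr (I : Type) (r : seq I) (F : I -> V) x : E x ->
  (forall i, E (F i)) -> hip E x (\sum_(i <- r) F i) = \sum_(i <- r) hip E x (F i).
Proof.
move=> hx hF; elim: r => [|i r IH]; first by rewrite !big_nil hip0r.
by rewrite !big_cons hipDr ?IH //; apply: sub_sum.
Qed.
Lemma hip_suml (I : Type) (r : seq I) (F : I -> V) x : E x ->
  (forall i, E (F i)) -> hip E (\sum_(i <- r) F i) x = \sum_(i <- r) hip E (F i) x.
Proof.
move=> hx hF; elim: r => [|i r IH]; first by rewrite !big_nil hip0l.
by rewrite !big_cons hipDl ?IH //; apply: sub_sum.
Qed.

Lemma hnorm_ge0 x : 0 <= hnorm E x. Proof. exact: sqrtr_ge0. Qed.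

Lemma hip_real x : E x -> complex.Im (hip E x x) = 0.
Proof. by move=> hx; apply: ger0_Im; apply: preh_ge0. Qed.

Lemma hip_hnorm x : E x -> hip E x x = (hnorm E x ^+ 2)%:C.
Proof.
move=> hx; have := preh_ge0 hE hx; have := hip_real hx.
rewrite /hnorm; case: (hip E x x) => a b /= ->.
by rewrite ler0c => h; rewrite sqr_sqrtr.
Qed.

Lemma hnorm_eq0 x : E x -> hnorm E x = 0 -> x = 0.
Proof. by move=> hx h; apply: (preh_def hE hx); rewrite hip_hnorm // h expr0n. Qed.

Lemma hnorm0 : hnorm E 0 = 0.
Proof. by rewrite /hnorm hip0r ?sqrtr0 //; apply: ph0. Qed.

Lemma cauchy_schwarz x y : E x -> E y ->
  `|hip E x y| <= (hnorm E x * hnorm E y)%:C.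
Proof.
move=> hx hy.
have [y0|ny0] := eqVneq (hip E y y) 0.
  rewrite (preh_def hE hy y0) hip0r // normr0.
  by rewrite ler0c mulr_ge0 // hnorm_ge0.
have py : 0 < hip E y y by rewrite lt_def ny0 preh_ge0.
have nn : 0 <= (hnorm E x * hnorm E y)%:C
  by rewrite ler0c mulr_ge0 // hnorm_ge0.
rewrite -(ler_pXn2r (n := 2)) ?nnegrE ?normr_ge0 //.
have -> : (hnorm E x * hnorm E y)%:C ^+ 2 = hip E x x * hip E y y.
  by rewrite !hip_hnorm // -rmorphXn -rmorphM exprMn.
(* The projection of x on y is [a *: y]; that |x - a y|^2 is nonnegative is the inequality divided
   by |y|^2. *)
pose a := hip E y x / hip E y y.
have eay : E (a *: y) by apply: phZ.
have hxa := phB hx eay; have h := preh_ge0 hE hxa.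
have ca : Num.conj a = hip E x y / hip E y y.
  by rewrite /a conjM conjV -preh_sym // (geC0_conj (ltW py)).
rewrite -subr_ge0 -(pmulr_lge0 _ (x := (hip E y y)^-1)) ?invr_gt0 //.
apply: le_trans h _; rewrite le_eqVlt; apply/orP; left; apply/eqP.
rewrite hipBl // !hipBr // !hipZl // !hipZr // ca normCK -preh_sym //.
by rewrite /a; field.
Qed.

Lemma hnorm_triangle x y : E x -> E y -> hnorm E (x + y) <= hnorm E x + hnorm E y.
Proof.
move=> hx hy; have h2 := phD hx hy.
rewrite -(ler_pXn2r (n := 2)) ?nnegrE ?addr_ge0 ?hnorm_ge0 // -lecR.
have e : ((hnorm E x + hnorm E y) ^+ 2)%:C
    = hip E x x + hip E y y + (hnorm E x * hnorm E y)%:C *+ 2.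
  by rewrite !hip_hnorm // -rmorphMn -!rmorphD /=; congr _%:C; ring.
have e2 : Num.conj (hip E x y) = (complex.Re (hip E x y))%:C *+ 2 - hip E x y.
  by rewrite conj_conjc -[_ *+ 2]mulr_natl -addcJ; ring.
rewrite -hip_hnorm // hipDl // !hipDr // (preh_sym hE hx hy) e e2.
have := le_trans (Re_le_norm _) (cauchy_schwarz hx hy).
rewrite -subr_ge0 => h; rewrite -subr_ge0.
have -> : hip E x x + hip E y y + (hnorm E x * hnorm E y)%:C *+ 2 -
  (hip E x x + hip E x y +
    ((complex.Re (hip E x y))%:C *+ 2 - hip E x y + hip E y y))
  = ((hnorm E x * hnorm E y)%:C - (complex.Re (hip E x y))%:C) *+ 2 by ring.
by rewrite mulrn_wge0.
Qed.

Lemma hnormZ a x : E x -> (hnorm E (a *: x))%:C = `|a| * (hnorm E x)%:C.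
Proof.
move=> hx; have hz := phZ a hx.
have nn : forall y, 0 <= (hnorm E y)%:C by move=> y; rewrite ler0c hnorm_ge0.
apply/eqP; rewrite -(eqrXn2 (n := 2)) ?mulr_ge0 //.
rewrite exprMn normCK -!realcX -!hip_hnorm // hipZr // hipZl //.
by apply/eqP; ring.
Qed.

Lemma hnormN x : E x -> hnorm E (- x) = hnorm E x.
Proof.
by move=> hx; apply: complexI; rewrite -scaleN1r hnormZ // normrN1 mul1r.
Qed.

Lemma parallelogram x y : E x -> E y ->
  hnorm E (x + y) ^+ 2 + hnorm E (x - y) ^+ 2
  = (hnorm E x ^+ 2 + hnorm E y ^+ 2) *+ 2.
Proof.
move=> hx hy; apply: complexI.
rewrite realcMn !realcD -!hip_hnorm //; last 2 first.
- exact: phB.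
- exact: phD.
have hN := phN hy.
have h1 := phD hx hy; have h2 := phB hx hy.
by rewrite !hipDl // !hipDr // !hipNl // !hipNr //; ring.
Qed.

(** Since <x, y> is real, Im <x, y - w x> = - Im w |x|^2, and Cauchy-Schwarz bounds the left side.
    With y = T x, T symmetric, this is the lower bound for T - w. *)
Lemma norm_ge_Im x y w : E x -> E y -> complex.Im (hip E x y) = 0 ->
  `|complex.Im w| * hnorm E x <= hnorm E (y - w *: x).
Proof.
move=> hx hy re; have hwx := phZ w hx; have hyw := phB hy hwx.
have [->|n0] := eqVneq (hnorm E x) 0; first by rewrite mulr0 hnorm_ge0.
have p0 : 0 < hnorm E x by rewrite lt_def n0 hnorm_ge0.
rewrite -(ler_pM2l p0) -lecR.
apply: le_trans (cauchy_schwarz hx hyw).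
apply: le_trans (Im_le_norm _); rewrite lecR.
rewrite hipBr // hipZr // ImD ImN re add0r hip_hnorm // ImMr.
by rewrite normrN normrM (ger0_norm (sqr_ge0 _)) expr2 mulrCA.
Qed.

Lemma hcvgP (u : nat -> V) x : hcvg E u x <->
  (forall e : R, 0 < e -> exists N, forall n, (N <= n)%N -> hnorm E (u n - x) < e).
Proof.
split=> [h e e0|h].
  move/cvgrPdist_lt : h => /(_ e e0)[N _ hN]; exists N => n hn.
  by have := hN n hn; rewrite /= sub0r normrN ger0_norm // hnorm_ge0.
apply/cvgrPdist_lt => e e0; have [N hN] := h e e0.
by exists N => // n hn; rewrite /= sub0r normrN ger0_norm ?hnorm_ge0 // hN.
Qed.
End Preh.

Ltac emem := solve [repeat first
  [ assumption | eapply ph0; eassumption | eapply phD; [eassumption| |]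
  | eapply phN; [eassumption|] | eapply phZ; [eassumption|] ]].

(** * Limits, closedness and self-adjoint operators *)

Lemma resolventP {R : realType} {V : lmodType R[i]} (T : lrel V V) (z : R[i]) h u :
  resolvent T z (h, u) <-> T (u, h + z *: u).
Proof.
split=> [[y [w [/= Ty]]]|Tu]; first by rewrite /graph /= => -> ->; rewrite subrK.
by exists (h + z *: u), (z *: u); split=> //=; lmod.
Qed.

Lemma natSinv_lt {R : realType} (e : R) :
  0 < e -> exists N, forall n, (N <= n)%N -> n.+1%:R^-1 < e.
Proof.
move=> e0; exists (Num.bound e^-1) => n hn.
rewrite invf_plt ?posrE ?ltr0n //.
apply: lt_le_trans (archi_boundP _) _; first by rewrite invr_ge0 ltW.
by rewrite ler_nat; apply: leq_trans hn _.
Qed.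

Section Limits.
Context {R : realType} {V : lmodType R[i]} (E : hspace V) (hE : preh E).

Lemma hip_cvg (u : nat -> V) x y : (forall n, E (u n)) -> E x -> E y ->
  hcvg E u x -> forall e : R, 0 < e ->
  exists N, forall n, (N <= n)%N -> `|hip E y (u n) - hip E y x| <= e%:C.
Proof.
move=> hu hx hy /hcvgP h e e0.
have p0 : 0 < hnorm E y + 1 by rewrite ltr_wpDl ?hnorm_ge0.
have [N hN] := h (e / (hnorm E y + 1)) (divr_gt0 e0 p0).
exists N => n /hN hn; rewrite -hipBr //.
apply: le_trans (cauchy_schwarz hE hy (phB hE (hu n) hx)) _; rewrite lecR.
have -> : e = (hnorm E y + 1) * (e / (hnorm E y + 1)).
  by rewrite mulrCA mulfV ?mulr1 ?gt_eqF.
by apply: ler_pM; rewrite ?hnorm_ge0 ?lerDl // ltW.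
Qed.

(** The conditions defining an adjoint are linear and continuous in the pair, so they pass to
    limits. *)
Lemma radj_is_closed (T : lrel V V) :
  (forall p, T p -> E p.1 /\ E p.2) -> is_closed E E (radj E E T).
Proof.
move=> hT; split; first split.
- split; first by split=> /=; [exact: ph0|exact: ph0|] => x y /hT [/= hx hy];
    rewrite !hip0l.
  move=> a [x1 y1] [x2 y2] [/= h1 h2 h3] [/= h4 h5 h6]; split=> /=.
  + by apply: subZD => //; exact: preh_sub.
  + by apply: subZD => //; exact: preh_sub.
  + move=> x y Txy; have [/= hx hy] := hT _ Txy.
    rewrite !hipDl ?hipZl //; try emem.
    by rewrite (h3 _ _ Txy) (h6 _ _ Txy).
- by move=> p [].
move=> u x y hu hx hy c1 c2; split=> //= s t Tst; have [/= hs ht] := hT _ Tst.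
rewrite (preh_sym hE ht hx) (preh_sym hE hs hy); congr Num.conj.
apply/eqP; rewrite -subr_eq0; apply/eqP/eq0_le_eps => e e0.
have e2 : 0 < e / 2 by rewrite divr_gt0.
have hu1 n : E (u n).1 by case: (hu n).
have hu2 n : E (u n).2 by case: (hu n).
have [N1 h1] := hip_cvg hu1 hx ht c1 e2.
have [N2 h2] := hip_cvg hu2 hy hs c2 e2.
have := h2 _ (leq_maxr N1 N2); have := h1 _ (leq_maxl N1 N2).
set n := maxn _ _; case: (hu n) => _ _ /(_ s t Tst) eq a1 a2.
have {}eq : hip E t (u n).1 = hip E s (u n).2.
  by rewrite (preh_sym hE (hu1 n) ht) eq -(preh_sym hE (hu2 n) hs).
have -> : hip E t x - hip E s y
  = (hip E s (u n).2 - hip E s y) - (hip E t (u n).1 - hip E t x).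
  by rewrite eq; ring.
apply: le_trans (ler_normB _ _) _.
by rewrite [e in X in _ <= X](splitr e) realcD lerD.
Qed.

(* A minimizing sequence for the distance from y to S. *)
Lemma minimizing_sequence (S : set V) y : linsubspace S -> S `<=` E -> E y ->
  exists u : nat -> V, [/\ forall n, S (u n), hcauchy E u &
    forall p, E p -> hcvg E u p -> forall w, S w -> hip E w (y - p) = 0].
Proof.
move=> sS SE hy.
pose D := [set hnorm E (y - s) ^+ 2 | s in S].
have hD : has_inf D.
  split; first by exists (hnorm E (y - 0) ^+ 2), 0 => //; apply: sub0.
  by exists 0 => _ [s _ <-]; rewrite sqr_ge0.
have lb s : S s -> inf D <= hnorm E (y - s) ^+ 2.
  by move=> hs; apply: ge_inf; [case: hD|exists s].
have app n : exists s, S s /\ hnorm E (y - s) ^+ 2 < inf D + n.+1%:R^-1.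
  have e0 : 0 < n.+1%:R^-1 :> R by rewrite invr_gt0 ltr0n.
  by have [_ [s hs <-] lt] := inf_adherent e0 hD; exists s.
have [u hu] := choice app; exists u.
have Su n : S (u n) by case: (hu n).
have Eu n : E (y - u n) by apply: phB => //; apply: SE.
split=> //.
- move=> e e0.
  have e4 : 0 < e ^+ 2 / 4 by rewrite divr_gt0 // exprn_gt0.
  have [N hN] : exists N, forall n, (N <= n)%N -> n.+1%:R^-1 < e ^+ 2 / 4.
    exact: natSinv_lt.
  exists N => n k hn hk.
  have Euv : E (u n - u k) by apply: phB => //; apply: SE.
  rewrite -(ltr_pXn2r (n := 2)) ?nnegrE ?hnorm_ge0 ?(ltW e0) //.
  (* The midpoint is in S, so its squared distance is at least the infimum. The parallelogram law
     then gives |u_n - u_k|^2 < 2/(n+1) + 2/(k+1), hence the bound e^2/4 on each fraction. *)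
  pose h := 2^-1 *: (u n + u k).
  have Sh : S h by apply: subZ => //; apply: subD.
  have := parallelogram hE (Eu n) (Eu k).
  have -> : y - u n - (y - u k) = - (u n - u k) by lmod.
  have -> : y - u n + (y - u k) = 2 *: (y - h) by rewrite /h; lmod_with (R[i]); field.
  rewrite hnormN //.
  have Eyh : E (y - h) by apply: phB => //; apply: SE.
  have -> : hnorm E (2 *: (y - h)) = 2 * hnorm E (y - h).
    by apply: complexI; rewrite hnormZ // realcM ger0_norm // (rmorph_nat (real_complex R) 2).
  rewrite exprMn (_ : 2 ^+ 2 = 4); last by ring.
  rewrite -mulr_natl.
  have b0 := lb _ Sh; have [_ b1] := hu n; have [_ b2] := hu k.
  move: (hN n hn) (hN k hk) b0 b1 b2.
  set A := hnorm E _ ^+ 2.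
  set F := hnorm E _ ^+ 2; set G := hnorm E _ ^+ 2.
  move: (hnorm E (u n - u k) ^+ 2) (e ^+ 2) (n.+1%:R^-1) (k.+1%:R^-1) (inf D) => B e' i1 i2 I.
  move=> b3 b4 b0 b1 b2 b5. clear -b0 b1 b2 b3 b4 b5.
 lra.
- move=> p hp cv w hw; apply: eq0_le_eps => e e0; have Ew := SE _ hw.
  have [w0|nw0] := eqVneq (hnorm E w) 0.
    by rewrite (hnorm_eq0 hE Ew w0) hip0l ?normr0 ?ler0c ?ltW //; apply: phB.
  have pw : 0 < hnorm E w by rewrite lt_def nw0 hnorm_ge0.
  have e2 : 0 < e / 2 by rewrite divr_gt0.
  have [N1 h1] := hip_cvg (fun n => SE _ (Su n)) hp Ew cv e2.
  have e3 : 0 < (e / 2 / hnorm E w) ^+ 2 by rewrite exprn_gt0 // divr_gt0.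
  have [N2 hN2] : exists N, forall n, (N <= n)%N -> n.+1%:R^-1 < (e / 2 / hnorm E w) ^+ 2.
    exact: natSinv_lt.
  have := h1 _ (leq_maxl N1 N2); have := hN2 _ (leq_maxr N1 N2).
  set n := maxn _ _ => b1 b2.
  have Eun := SE _ (Su n).
  have -> : hip E w (y - p) = hip E w (y - u n) + (hip E w (u n) - hip E w p).
    by rewrite !hipBr //; ring.
  apply: le_trans (ler_normD _ _) _.
  rewrite [X in _ <= X%:C](splitr e) realcD lerD //.
  set v := y - u n in b1 b2 *; have Ev : E v := Eu n.
  (* The best move from u_n along w lowers the squared distance by |<w, v>|^2 / |w|^2. As u_n is
     within 1/(n+1) of the infimum, the gain is less than 1/(n+1). *)
  pose a := hip E w v / hip E w w.
  have Sa : S (u n + a *: w) by apply: subD => //; apply: subZ.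
  have := lb _ Sa; rewrite opprD addrA -/v => lbv.
  have Eaw : E (a *: w) := phZ hE a Ew.
  have [_ ub] := hu n; rewrite -/v in ub; clearbody v.
  have ww : hip E w w != 0 by rewrite hip_hnorm // eq_complex /= eqxx andbT expf_neq0.
  have key : ((hnorm E (v - a *: w)) ^+ 2)%:C
      = ((hnorm E v) ^+ 2)%:C - `|hip E w v| ^+ 2 / ((hnorm E w) ^+ 2)%:C.
    rewrite -!hip_hnorm //; last exact: phB.
    rewrite hipBl //; last exact: phB.
    rewrite !hipBr // !hipZl // !hipZr // normCK (preh_sym hE Ew Ev) /a conjM conjV.
    by rewrite -(preh_sym hE Ew Ew); field.
  have nE := norm_ReE (hip E w v).
  rewrite nE lecR.
  have nn : 0 <= complex.Re `|hip E w v| by rewrite -ler0c -nE normr_ge0.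
  have {}key : hnorm E (v - a *: w) ^+ 2
      = hnorm E v ^+ 2 - complex.Re `|hip E w v| ^+ 2 / hnorm E w ^+ 2.
    by apply: complexI; rewrite key [in LHS]nE rmorphB fmorph_div (rmorphXn _ _ (complex.Re _)).
  rewrite -(ler_pXn2r (n := 2)) ?nnegrE ?(ltW e2) //.
  have lt : complex.Re `|hip E w v| ^+ 2 / hnorm E w ^+ 2 <= (e / 2 / hnorm E w) ^+ 2.
    move: key lbv ub b1; move: (inf D) n.+1%:R^-1 => I i1.
    move: (_ / hnorm E w ^+ 2) (hnorm E _ ^+ 2) (hnorm E _ ^+ 2) ((_ / _) ^+ 2).
    move=> q A B F.
    by move=> c1 c2 c3 c4; lra.
  move: lt; rewrite exprMn exprVn ler_pM2r // invr_gt0 exprn_gt0 //.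
Qed.
End Limits.

(** The bound |Im z| |u| <= |(T - z) u| gives injectivity and a bounded inverse. It also makes the
    range closed, and a vector orthogonal to the range is an eigenvector of T for conj z, hence zero
    by the same bound. *)
Lemma selfadjoint_nonreal_rho {R : realType} {V : lmodType R[i]} (E : hspace V)
  (T : lrel V V) (z : R[i]) : is_hilbert E -> is_selfadjoint E T ->
  complex.Im z != 0 -> rho E T z.
Proof.
move=> hilb [[sT TE] eT] nz; have hE := hilbert_preh hilb.
have real x y : T (x, y) -> complex.Im (hip E x y) = 0.
  move=> Txy; have [/= hx hy] := TE _ Txy; apply: Im0_conj.
  by have := Txy; rewrite {1}eT => -[_ _ /(_ x y Txy) /= h]; rewrite -preh_sym.
have bd h u : T (u, h + z *: u) -> `|complex.Im z| * hnorm E u <= hnorm E h.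
  move=> Tu; have [/= hu hv] := TE _ Tu.
  have := norm_ge_Im hE z hu hv (real _ _ Tu).
  by have -> : h + z *: u - z *: u = h by lmod.
have pz : 0 < `|complex.Im z| by rewrite normr_gt0.
have TB : forall p q, T p -> T q -> T (p - q) by move=> p q; apply: subB.
have Eh h u : T (u, h + z *: u) -> E h.
  move=> Tu; have [/= hu hv] := TE _ Tu.
  by have -> : h = h + z *: u - z *: u by [lmod]; apply: phB => //; apply: phZ.
have inj h u v : T (u, h + z *: u) -> T (v, h + z *: v) -> u = v.
  move=> Tu Tv; have := TB _ _ Tu Tv.
  have [/= hu _] := TE _ Tu; have [/= hv _] := TE _ Tv.
  have -> : (u, h + z *: u) - (v, h + z *: v) = (u - v, 0 + z *: (u - v)).
    by congr pair; rewrite /=; lmod.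
  move/bd; rewrite hnorm0 // => le0; apply/eqP; rewrite -subr_eq0; apply/eqP.
  apply: (hnorm_eq0 hE (phB hE hu hv)); apply/eqP.
  by rewrite eq_le hnorm_ge0 andbT -(ler_pM2l pz) mulr0.
split.
- by move=> h u v /resolventP Tu /resolventP Tv; apply: inj Tu Tv.
- apply/seteqP; split=> [h [u /resolventP]|y hy]; first exact: Eh.
  pose S := [set h | exists u, T (u, h + z *: u)].
  have sS : linsubspace S.
    split; first by exists 0; have -> : 0 + z *: 0 = 0 :> V by [lmod]; exact: (sub0 sT).
    move=> a h k [u Tu] [v Tv]; exists (a *: u + v).
    have -> : (a *: u + v, a *: h + k + z *: (a *: u + v))
       = a *: (u, h + z *: u) + (v, k + z *: v) by congr pair; rewrite /=; lmod.
    exact: (subZD sT).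
  have SE : S `<=` E by move=> h [u /Eh].
  have [s [Ss cs ort]] := minimizing_sequence hE sS SE hy.
  have [p hp sp] := hilbert_complete hilb (fun n => SE _ (Ss n)) cs.
  have [u hu] := choice Ss.
  have Eu n : E (u n) by have [] := TE _ (hu n).
  (* The lower bound carries the Cauchy property from the images s_n to their preimages u_n, so the
     limit p is again in the range because T, being an adjoint, is closed. *)
  have cu : hcauchy E u.
    move=> e e0; have [N hN] := cs (`|complex.Im z| * e) (mulr_gt0 pz e0).
    exists N => n k hn hk; rewrite -(ltr_pM2l pz).
    apply: le_lt_trans (hN n k hn hk); apply: bd.
    have := TB _ _ (hu n) (hu k); congr (T _); congr pair; rewrite /=; lmod.
  have [x hx ux] := hilbert_complete hilb Eu cu.
  have clT := radj_is_closed hE TE; rewrite -eT in clT.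
  have Tx : T (x, p + z *: x).
    apply: (clT.2 (fun n => (u n, s n + z *: u n))) => //.
    - by apply: phD => //; apply: phZ.
    - apply/hcvgP => e e0 /=.
      have e2 : 0 < e / 2 by rewrite divr_gt0.
      have [N1 h1] := (hcvgP E s p).1 sp _ e2.
      have p1 : 0 < complex.Re `|z| + 1.
        by rewrite ltr_wpDl // -ler0c -norm_ReE normr_ge0.
      have [N2 h2] := (hcvgP E u x).1 ux _ (divr_gt0 e2 p1).
      exists (maxn N1 N2) => n; rewrite geq_max => /andP[/h1 b1 /h2 b2].
      have Es : E (s n - p) by apply: phB => //; apply: SE.
      have Eux : E (u n - x) by apply: phB.
      have -> : s n + z *: u n - (p + z *: x) = (s n - p) + z *: (u n - x) by lmod.
      apply: le_lt_trans (hnorm_triangle hE Es (phZ hE _ Eux)) _.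
      rewrite (splitr e) ltr_leD //.
      rewrite -lecR hnormZ // norm_ReE -realcM lecR.
      have -> : e / 2 = (complex.Re `|z| + 1) * (e / 2 / (complex.Re `|z| + 1)).
        by rewrite mulrCA mulfV ?mulr1 // gt_eqF.
      apply: ler_pM; rewrite ?hnorm_ge0 ?lerDl ?(ltW b2) //.
      by rewrite -ler0c -norm_ReE normr_ge0.
  exists x; apply/resolventP.
  suff -> : y = p by [].
  apply/eqP; rewrite -subr_eq0; apply/eqP.
  have Eq : E (y - p) by apply: phB.
  have {}ort := ort p hp sp.
  (* Orthogonality of y - p to the range of T - z says that this pair belongs to the adjoint of T,
     which is T. *)
  have Tq : T (y - p, 0 + Num.conj z *: (y - p)).
    rewrite eT; split=> //=; first by rewrite add0r; apply: phZ.
    move=> v w Tvw; have [/= hv hw] := TE _ Tvw.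
    have : S (w - z *: v) by exists v; rewrite subrK.
    move/ort; have hzv := phZ hE z hv => ort0.
    have : hip E (y - p) (w - z *: v) = 0.
      by rewrite (preh_sym hE (phB hE hw hzv) Eq) ort0 conjC0.
    rewrite hipBr // hipZr // add0r hipZl // conjCK.
    by move/eqP; rewrite subr_eq0 => /eqP.
  apply: (hnorm_eq0 hE) => //; apply/eqP.
  have := norm_ge_Im hE (Num.conj z) Eq (TE _ Tq).2 (real _ _ Tq).
  have -> : 0 + Num.conj z *: (y - p) - Num.conj z *: (y - p) = 0 by lmod.
  rewrite hnorm0 // Im_conj normrN => le0.
  by rewrite eq_le hnorm_ge0 andbT -(ler_pM2l pz) mulr0.
- by move=> x y /resolventP /TE [].
- exists (`|complex.Im z|^-1) => h u /resolventP /bd le.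
  by rewrite ler_pdivlMl.
Qed.

(** * Finite-dimensional subspaces *)

Section FiniteSpan.
Context {R : realType} {V : lmodType R[i]}.
Local Notation C := R[i].

(** Recursion on the list lets the projection theorem below proceed by removing one spanning vector
    at a time. *)
Fixpoint in_span (l : seq V) (x : V) : Prop :=
  if l is a :: l' then exists c : C, in_span l' (x - c *: a) else x = 0.

Lemma in_span_lincomb d (e : 'I_d -> V) (c : 'cV[C]_d) :
  in_span [seq e i | i <- enum 'I_d] (lincomb e c).
Proof.
have -> : lincomb e c = \sum_(s <- enum 'I_d) c s 0 *: e s by rewrite big_enum.
elim: (enum _) => [|i l IH] /=; first by rewrite big_nil.
by exists (c i 0); rewrite big_cons addrC addKr.
Qed.

Lemma in_spanZD l a x y : in_span l x -> in_span l y -> in_span l (a *: x + y).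
Proof.
elim: l x y => [|b l IH] x y /=; first by move=> -> ->; rewrite scaler0 addr0.
move=> [c hc] [c' hc']; exists (a * c + c').
have -> : a *: x + y - (a * c + c') *: b = a *: (x - c *: b) + (y - c' *: b) by lmod.
exact: IH.
Qed.

Lemma in_span0 l : in_span l 0.
Proof. by elim: l => //= b l h; exists 0; rewrite scale0r subr0. Qed.

Lemma in_span_cat (l1 l2 : seq V) a b :
  in_span l1 a -> in_span l2 b -> in_span (l1 ++ l2) (a + b).
Proof.
elim: l1 a => [|u l1 IH] a /=; first by move=> ->; rewrite add0r.
by move=> [k hk] hb; exists k; rewrite addrAC; apply: IH.
Qed.

Context (E : hspace V) (hE : preh E).

(** Gram-Schmidt by induction on the spanning list. The part S' of S in the span of the tail has a
    projection; if S is larger, one vector v' of S orthogonal to S' completes it, and the projection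
    on v' is added. *)
Lemma span_projection (l : seq V) (S : set V) : linsubspace S -> S `<=` E ->
  (forall x, S x -> in_span l x) ->
  forall x, E x -> exists p, S p /\ forall w, S w -> hip E w (x - p) = 0.
Proof.
elim: l S => [|a l IH] S sS SE hl x hx.
  exists 0; split; first exact: sub0.
  by move=> w /[dup] /hl /= -> /SE h0; rewrite hip0l //; emem.
pose S' := [set y | S y /\ in_span l y].
have sS' : linsubspace S'.
  split; first by split; [exact: sub0|exact: in_span0].
  by move=> b y z [h1 h2] [h3 h4]; split; [exact: subZD | exact: in_spanZD].
have S'E : S' `<=` E by move=> y [/SE].
have proj := IH S' sS' S'E (fun y => @proj2 _ _).
have [[v [Sv nv]]|none] := pselect (exists v, S v /\ ~ in_span l v); last first.
  have [p [[Sp _] hp]] := proj x hx; exists p; split=> // w Sw; apply: hp.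
  by split=> //; apply: contrapT => h; apply: none; exists w.
have [q [[Sq Lq] hq]] := proj v (SE _ Sv).
pose v' := v - q; have Sv' : S v' by apply: subB.
have Ev' := SE _ Sv'.
have o1 y : S' y -> hip E y v' = 0 by apply: hq.
have nv' : hip E v' v' != 0.
  apply/eqP => /(preh_def hE Ev') h0; apply: nv.
  by have -> : v = q by apply/eqP; rewrite -subr_eq0 -/v' h0.
(* Modulo the span of l, both w and v are multiples of a. The multiple for v is nonzero because v is
   outside that span, so the quotient removes a from w. *)
have dec w : S w -> exists b : C, S' (w - b *: v').
  move=> Sw; have [c1 h1] := hl _ Sw; have [c2 h2] := hl _ Sv.
  have c20 : c2 != 0.
    by apply/eqP => h; apply: nv; move: h2; rewrite h scale0r subr0.
  exists (c1 / c2); split; first by apply: subB => //; apply: subZ.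
  have -> : w - c1 / c2 *: v'
    = - (c1 / c2) *: (v - c2 *: a) + (1 *: (w - c1 *: a) + ((c1 / c2) *: q + 0)).
    by rewrite /v'; lmod_with (R[i]); field.
  by do 3?apply: in_spanZD => //; exact: in_span0.
clearbody v'; have [p [[Sp Lp] hp]] := proj x hx; have Ep := SE _ Sp; have Eq := SE _ Sq.
pose t := hip E v' x / hip E v' v'.
exists (p + t *: v'); split; first by apply: subD => //; apply: subZ.
move=> w Sw; have [b S'w] := dec w Sw; have Ew' := S'E _ S'w.
have -> : w = (w - b *: v') + b *: v' by lmod.
have o2 y : S' y -> hip E v' y = 0.
  by move=> hy; rewrite (preh_sym hE (S'E _ hy) Ev') o1 // conjC0.
have eq : hip E (w - b *: v') (x - (p + t *: v')) = 0.
  have -> : x - (p + t *: v') = (x - p) - t *: v' by lmod.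
  by rewrite hipBr //; [rewrite hp // hipZr // o1 // mulr0 subr0|emem|emem].
rewrite hipDl //; [|emem|emem].
rewrite eq add0r hipZl //; last by emem.
have eqv : hip E v' (x - (p + t *: v')) = 0.
  rewrite hipBr //; last by emem.
  rewrite hipDr //; last by emem.
  by rewrite hipZr // (o2 p) // /t add0r divfK // subrr.
by rewrite eqv mulr0.
Qed.
End FiniteSpan.

Section CoordinateSpace.
Context {R : realType} {d : nat}.
Local Notation C := R[i].
Implicit Types x y : 'cV[C]_d.

Lemma cdotDr x y z : cdot x (y + z) = cdot x y + cdot x z.
Proof. by rewrite -big_split; apply: eq_bigr => i _; rewrite mxE mulrDr. Qed.
Lemma cdotZr (a : C) x y : cdot x (a *: y) = a * cdot x y.
Proof. by rewrite /cdot mulr_sumr; apply: eq_bigr => i _; rewrite mxE mulrCA. Qed.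
Lemma cdot_conj x y : Num.conj (cdot x y) = cdot y x.
Proof.
by rewrite /cdot conj_sum; apply: eq_bigr => i _; rewrite conjM conjCK mulrC.
Qed.

Lemma Cspace_preh : preh (Cspace R d).
Proof.
split=> //=.
- by move=> a x y z _ _ _; rewrite cdotDr cdotZr.
- by move=> x y _ _; rewrite cdot_conj.
- by move=> x _; apply: sumr_ge0 => i _; rewrite mulrC -normCK exprn_ge0.
- move=> x _ /eqP; rewrite psumr_eq0; last first.
    by move=> i _; rewrite mulrC -normCK exprn_ge0.
  move/allP => h; apply/matrixP => i j; rewrite ord1 mxE.
  have := h i (mem_index_enum i); rewrite /= mulf_eq0 conjC_eq0 orbb.
  by move/eqP.
Qed.

Lemma cdotDl x y z : cdot (x + y) z = cdot x z + cdot y z.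
Proof. exact: (hipDl Cspace_preh). Qed.
Lemma cdotNl x y : cdot (- x) y = - cdot x y.
Proof. exact: (hipNl Cspace_preh). Qed.
Lemma cdotNr x y : cdot x (- y) = - cdot x y.
Proof. exact: (hipNr Cspace_preh). Qed.
Lemma cdotBl x y z : cdot (x - y) z = cdot x z - cdot y z.
Proof. exact: (hipBl Cspace_preh). Qed.
Lemma cdotBr x y z : cdot x (y - z) = cdot x y - cdot x z.
Proof. exact: (hipBr Cspace_preh). Qed.
Lemma cdot0l x : cdot 0 x = 0. Proof. exact: (hip0l Cspace_preh). Qed.
Lemma cdot0r x : cdot x 0 = 0. Proof. exact: (hip0r Cspace_preh). Qed.
Lemma cdot_eq0 x : cdot x x = 0 -> x = 0.
Proof. exact: (preh_def Cspace_preh). Qed.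
Lemma cdot_inj x y : (forall c, cdot c x = cdot c y) -> x = y.
Proof.
move=> h; apply/eqP; rewrite -subr_eq0; apply/eqP/cdot_eq0.
by rewrite cdotBr !h subrr.
Qed.
Lemma lincombE_id x : x = lincomb (fun s => delta_mx s 0) x.
Proof.
apply/matrixP => i j; rewrite ord1 /lincomb summxE (bigD1 i) //= !mxE !eqxx mulr1.
rewrite big1 ?addr0 // => k ne.
by rewrite !mxE eq_sym (negbTE ne) mulr0.
Qed.

Lemma Cspace_projection (S : set 'cV[C]_d) : linsubspace S ->
  forall x, exists p, S p /\ forall w, S w -> cdot w (x - p) = 0.
Proof.
move=> sS x; apply: (span_projection Cspace_preh (l := [seq delta_mx s 0 | s <- enum 'I_d])) => //.
by move=> y _; rewrite (lincombE_id y); apply: in_span_lincomb.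
Qed.

(** The form in which surjectivity onto C^d is proved below: only zero is orthogonal to the
    range. *)
Lemma subspace_full (S : set 'cV[C]_d) : linsubspace S ->
  (forall y, (forall s, S s -> cdot s y = 0) -> y = 0) -> forall x, S x.
Proof.
move=> sS h x; have [p [Sp hp]] := Cspace_projection sS x.
by have /eqP := h _ hp; rewrite subr_eq0 => /eqP ->.
Qed.
End CoordinateSpace.

Lemma cdot_adjl {R : realType} {p q : nat} (A : 'M[R[i]]_(p, q)) x y :
  cdot (adjmx A *m x) y = cdot x (A *m y).
Proof.
rewrite /cdot.
under eq_bigr do rewrite mxE conj_sum mulr_suml.
rewrite exchange_big; apply: eq_bigr => i _; rewrite mxE mulr_sumr.
by apply: eq_bigr => j _; rewrite conjM !mxE conjCK mulrA mulrC; ring.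
Qed.
Lemma cdot_adjr {R : realType} {p q : nat} (A : 'M[R[i]]_(p, q)) x y :
  cdot y (adjmx A *m x) = cdot (A *m y) x.
Proof. by rewrite -cdot_conj cdot_adjl cdot_conj. Qed.
Lemma adjmxM {R : realType} {p q r : nat} (A : 'M[R[i]]_(p, q)) (B : 'M_(q, r)) :
  adjmx (A *m B) = adjmx B *m adjmx A.
Proof.
apply/matrixP => i j; rewrite !mxE conj_sum; apply: eq_bigr => k _.
by rewrite !mxE conjM mulrC.
Qed.

Lemma adjmx_mul_inv {R : realType} {d : nat} (A : 'M[R[i]]_d) : A \in unitmx ->
  (adjmx A *m adjmx (invmx A) = 1%:M) * (adjmx (invmx A) *m adjmx A = 1%:M).
Proof.
have e : adjmx (1%:M : 'M[R[i]]_d) = 1%:M.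
  apply/matrixP => i j; rewrite !mxE eq_sym.
  by case: eqP => _; [apply: conjC1 | apply: conjC0].
by move=> h; split; rewrite -adjmxM ?mulVmx ?mulmxV.
Qed.

Lemma lrel_matrix {R : realType} {d : nat} (F : lrel 'cV[R[i]]_d 'cV[R[i]]_d) :
  linsubspace F -> (forall x, exists y, F (x, y)) ->
  (forall y, F (0, y) -> y = 0) -> exists N : 'M[R[i]]_d, F = graph (mulmx N).
Proof.
move=> sF tot sv; have [f hf] := choice tot.
have uniq x y z : F (x, y) -> F (x, z) -> y = z.
  move=> h1 h2; apply/eqP; rewrite -subr_eq0; apply/eqP/sv.
  have := subB sF h1 h2; congr (F _).
  by congr pair; rewrite subrr.
pose N : 'M[R[i]]_d := \matrix_(i, j) f (delta_mx j 0) i 0.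
have FN x : F (x, N *m x).
  have -> : (x, N *m x) = \sum_j x j 0 *: (delta_mx j 0, f (delta_mx j 0)).
    rewrite [RHS]surjective_pairing; congr pair.
    - rewrite [LHS]lincombE_id /lincomb.
      by elim/big_rec2: _ => // j y1 y2 _ ->.
    - transitivity (\sum_j x j 0 *: f (delta_mx j 0)); last first.
        by elim/big_rec2: _ => // j y1 y2 _ ->.
      apply/matrixP => i k; rewrite !mxE summxE; apply: eq_bigr => j _.
      by rewrite !mxE ord1 mulrC.
  by apply: sub_sum => // j _; apply: subZ.
exists N; apply/seteqP; split=> [[x y] Fxy|[x y]]; last by rewrite /graph /= => ->; exact: FN.
exact: uniq Fxy (FN x).
Qed.

(** * Boundary triples *)

(* z is regular when the extension T|_{ker Gamma_0} has the resolvent r0 z. *)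
Record boundary_triple {R : realType} {V : lmodType R[i]} {d : nat}
    (E : hspace V) (T : lrel V V) (G : V -> 'cV[R[i]]_d * 'cV[R[i]]_d)
    (reg : set R[i]) (r0 : R[i] -> V -> V) (gam : R[i] -> 'cV[R[i]]_d -> V)
    (M : R[i] -> 'M[R[i]]_d) : Prop := {
  bt_preh : preh E;
  bt_sub : linsubspace T;
  bt_mem : forall p, T p -> E p.1 /\ E p.2;
  bt_lin : forall a u v, rdom T u -> rdom T v ->
    G (a *: u + v) = a *: G u + G v;
  bt_green : forall u u' v v', T (u, u') -> T (v, v') ->
    hip E u v' - hip E u' v = cdot (G u).1 (G v).2 - cdot (G u).2 (G v).1;
  bt_conj : forall z, reg z -> reg (Num.conj z);
  bt_nonreal : forall z, complex.Im z != 0 -> reg z;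
  bt_r0 : forall z h, reg z -> E h ->
    T (r0 z h, h + z *: r0 z h) /\ (G (r0 z h)).1 = 0;
  bt_ker : forall z u, reg z -> T (u, z *: u) -> (G u).1 = 0 -> u = 0;
  bt_gam : forall z c, reg z ->
    T (gam z c, z *: gam z c) /\ (G (gam z c)).1 = c;
  bt_M : forall z c, reg z -> (G (gam z c)).2 = M z *m c }.

Section BoundaryTriple.
Context {R : realType} {V : lmodType R[i]} {d : nat} (E : hspace V)
  (T : lrel V V) (G : V -> 'cV[R[i]]_d * 'cV[R[i]]_d) (reg : set R[i])
  (r0 : R[i] -> V -> V) (gam : R[i] -> 'cV[R[i]]_d -> V)
  (M : R[i] -> 'M[R[i]]_d) (bt : boundary_triple E T G reg r0 gam M).
Local Notation C := R[i].
Local Notation CV := 'cV[C]_d.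
Implicit Types (Th : lrel CV CV) (z : C) (c : CV).

Let hE := bt_preh bt.
Let sT := bt_sub bt.

Definition brestr Th : lrel V V := rrestr T [set u | Th (G u)].

Lemma bt_E1 u u' : T (u, u') -> E u. Proof. by move/(bt_mem bt) => []. Qed.
Lemma bt_E2 u u' : T (u, u') -> E u'. Proof. by move/(bt_mem bt) => []. Qed.
Lemma bt_Egam z c : reg z -> E (gam z c).
Proof. by move=> hz; have [/bt_E1] := bt_gam bt c hz. Qed.
Lemma bt_dom u u' : T (u, u') -> rdom T u. Proof. by exists u'. Qed.

Lemma bt_TZD a u u' v v' : T (u, u') -> T (v, v') ->
  T (a *: u + v, a *: u' + v').
Proof. by move=> h1 h2; exact: (subZD sT a h1 h2). Qed.
Lemma bt_TD u u' v v' : T (u, u') -> T (v, v') -> T (u + v, u' + v').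
Proof. by move=> h1 h2; exact: (subD sT h1 h2). Qed.
Lemma bt_TB u u' v v' : T (u, u') -> T (v, v') -> T (u - v, u' - v').
Proof. by move=> h1 h2; exact: (subB sT h1 h2). Qed.

Lemma bt_GD u u' v v' : T (u, u') -> T (v, v') -> G (u + v) = G u + G v.
Proof.
move=> h1 h2; rewrite -[u]scale1r (bt_lin bt); [|exact: bt_dom h1|exact: bt_dom h2].
by rewrite !scale1r.
Qed.
Lemma bt_GB u u' v v' : T (u, u') -> T (v, v') -> G (u - v) = G u - G v.
Proof.
move=> h1 h2; rewrite addrC -scaleN1r (bt_lin bt); [|exact: bt_dom h2|exact: bt_dom h1].
by rewrite scaleN1r addrC.
Qed.

(** Both sides have the same image under T - z and the same Gamma_0, and [bt_ker] allows one such
    vector only. The linearity of [gam] and [r0] below has the same source. *)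
Lemma bt_decomp z u u' : reg z -> T (u, u') ->
  u = r0 z (u' - z *: u) + gam z (G u).1.
Proof.
move=> hz Tu; have Eu := bt_E1 Tu; have Eu' := bt_E2 Tu.
have Eh : E (u' - z *: u) by emem.
have [Tr Gr] := bt_r0 bt hz Eh; have [Tg Gg] := bt_gam bt (G u).1 hz.
apply/eqP; rewrite -subr_eq0; apply/eqP/(bt_ker bt hz).
- have := bt_TB Tu (bt_TD Tr Tg); congr (T (_, _)); lmod.
- by rewrite (bt_GB Tu (bt_TD Tr Tg)) (bt_GD Tr Tg) /= Gr Gg add0r subrr.
Qed.

Lemma bt_gamZD z a b c : reg z -> gam z (a *: b + c) = a *: gam z b + gam z c.
Proof.
move=> hz; have [T1 G1] := bt_gam bt (a *: b + c) hz.
have [T2 G2] := bt_gam bt b hz; have [T3 G3] := bt_gam bt c hz.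
apply/eqP; rewrite -subr_eq0; apply/eqP/(bt_ker bt hz).
- have := bt_TB T1 (bt_TZD a T2 T3); congr (T (_, _)); lmod.
- rewrite (bt_GB T1 (bt_TZD a T2 T3)) (bt_lin bt); [|exact: bt_dom T2|exact: bt_dom T3].
  by rewrite /= G1 G2 G3 subrr.
Qed.

Lemma bt_gam0 z : reg z -> gam z 0 = 0.
Proof.
by move=> hz; have := bt_gamZD (-1) 0 0 hz; rewrite scaler0 addr0 scaleN1r addNr.
Qed.

Lemma bt_r0ZD z a h k : reg z -> E h -> E k ->
  r0 z (a *: h + k) = a *: r0 z h + r0 z k.
Proof.
move=> hz Eh Ek; have Ehk : E (a *: h + k) by emem.
have [T1 G1] := bt_r0 bt hz Ehk.
have [T2 G2] := bt_r0 bt hz Eh; have [T3 G3] := bt_r0 bt hz Ek.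
apply/eqP; rewrite -subr_eq0; apply/eqP/(bt_ker bt hz).
- have := bt_TB T1 (bt_TZD a T2 T3); congr (T (_, _)); lmod.
- rewrite (bt_GB T1 (bt_TZD a T2 T3)) (bt_lin bt); [|exact: bt_dom T2|exact: bt_dom T3].
  by rewrite /= G1 G2 G3 scaler0 addr0 subr0.
Qed.

Lemma bt_gam_inj z c : reg z -> gam z c = 0 -> c = 0.
Proof.
move=> hz h; have [_ <-] := bt_gam bt c hz; rewrite h.
have T0 : T (0, 0) := sub0 sT.
have := bt_GB T0 T0; rewrite subr0 => ->; by rewrite subrr.
Qed.

(** Green's identity for gamma(conj z) c and (A_0 - z)^{-1} h, where Gamma_0 of the second vanishes:
    the adjoint of gamma(conj z) is Gamma_1 (A_0 - z)^{-1}. *)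
Lemma bt_gam_adj z c h : reg z -> E h ->
  hip E (gam (Num.conj z) c) h = cdot c (G (r0 z h)).2.
Proof.
move=> hz Eh; have hz' := bt_conj bt hz.
have [Tg Gg] := bt_gam bt c hz'; have [Tr Gr] := bt_r0 bt hz Eh.
have Eg := bt_E1 Tg; have Er := bt_E1 Tr.
have := bt_green bt Tg Tr; rewrite Gg Gr cdot0r subr0 => <-.
rewrite hipDr //; last by emem.
by rewrite hipZr // hipZl // conjCK addrK.
Qed.

(** If y is orthogonal to the range, [bt_gam_adj] makes gamma(conj z) y orthogonal to E, in
    particular to itself, and gamma is injective. *)
Lemma bt_G1_surj z x : reg z -> exists2 h, E h & (G (r0 z h)).2 = x.
Proof.
move=> hz; pose S := [set y | exists2 h, E h & (G (r0 z h)).2 = y].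
have sS : linsubspace S.
  split.
  - exists 0; first by apply: ph0.
    apply: cdot_inj => c; have E0 := ph0 hE.
    by rewrite -bt_gam_adj // cdot0r hip0r //; apply: bt_Egam; apply: (bt_conj bt).
  - move=> a _ _ [h Eh <-] [k Ek <-]; exists (a *: h + k); first by emem.
    have [T2 _] := bt_r0 bt hz Eh; have [T3 _] := bt_r0 bt hz Ek.
    by rewrite bt_r0ZD // (bt_lin bt) //; [exact: bt_dom T2|exact: bt_dom T3].
apply: (subspace_full sS) => y hy; have hz' := bt_conj bt hz.
apply: (bt_gam_inj hz'); have Eg := bt_Egam y hz'; apply: (preh_def hE Eg).
rewrite bt_gam_adj // -cdot_conj hy ?conjC0 //.
by exists (gam (Num.conj z) y).
Qed.

(** The gamma field prescribes Gamma_0; a resolvent vector then corrects Gamma_1 without changing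
    Gamma_0. *)
Lemma bt_G_surj z x y : reg z -> exists u u', T (u, u') /\ G u = (x, y).
Proof.
move=> hz; have [h Eh e] := bt_G1_surj (y - M z *m x) hz.
have [Tr Gr] := bt_r0 bt hz Eh; have [Tg Gg] := bt_gam bt x hz.
exists (gam z x + r0 z h); eexists; split; first exact: bt_TD Tg Tr.
rewrite (bt_GD Tg Tr) [LHS]surjective_pairing /= Gg Gr e (bt_M bt) //.
by rewrite addr0 addrC subrK.
Qed.

(** For (u, v) in the adjoint, the point is that u lies in dom T. After subtracting r = r0 z (v - z
    u) the rest must be a defect vector: its component orthogonal to the finite-dimensional range of
    gamma(z) is shown to vanish. Green's identity and surjectivity of (Gamma_0, Gamma_1) then read
    off the boundary condition. *)
Lemma brestr_adjoint Th : linsubspace Th ->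
  radj E E (brestr Th) = brestr (radj (Cspace R d) (Cspace R d) Th).
Proof.
move=> sTh.
have [z nz] : exists z : C, complex.Im z != 0 by exists 'i; apply: oner_neq0.
have hz := bt_nonreal bt nz; have hz' := bt_conj bt hz.
apply/seteqP; split=> [[u v]|[u v] [/= Tu [_ _ hG]]]; last first.
  split=> /=; [exact: bt_E1 Tu|exact: bt_E2 Tu|] => x y [/= Tx Gx].
  have := bt_green bt Tu Tx.
  move: (hG (G x).1 (G x).2); rewrite -surjective_pairing => /(_ Gx) /= ->.
  by rewrite subrr => /eqP; rewrite subr_eq0 => /eqP.
move=> [/= Eu Ev hu].
have Eh : E (v - z *: u) by emem.
have [Tr Gr] := bt_r0 bt hz Eh; have Er := bt_E1 Tr.
set r := r0 z _ in Tr Gr Er.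
have Ex : E (u - r) by emem.
pose S := range (gam z).
have sS : linsubspace S.
  split; first by exists 0 => //; rewrite bt_gam0.
  by move=> a _ _ [b _ <-] [c _ <-]; exists (a *: b + c) => //; rewrite bt_gamZD.
have SE : S `<=` E by move=> _ [c _ <-]; apply: bt_Egam.
have spanS x : S x -> in_span [seq gam z (delta_mx s 0) | s <- enum 'I_d] x.
  move=> [c _ <-].
  have -> : gam z c = lincomb (fun s => gam z (delta_mx s 0)) c.
    rewrite {1}(lincombE_id c) /lincomb.
    elim: (index_enum _) => [|s l IH].
      by rewrite !big_nil bt_gam0.
    by rewrite !big_cons bt_gamZD // IH.
  exact: in_span_lincomb.
have [p [Sp hp]] := span_projection hE sS SE spanS Ex.
have Ep := SE _ Sp.
have Epx : E (u - r - p) by emem.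
have px : u - r - p = 0.
  apply: (preh_def hE) => //.
  set h := u - r - p in Epx hp *.
  have [Tw Gw] := bt_r0 bt hz' Epx; have Ew := bt_E1 Tw.
  have G1w : (G (r0 (Num.conj z) h)).2 = 0.
    apply: cdot_inj => c; rewrite -bt_gam_adj // conjCK cdot0r.
    by apply: hp; exists c.
  (* As h is orthogonal to the range of gamma(z), both boundary values of (A_0 - conj z)^{-1} h
     vanish, and Th contains (0, 0). Testing (u, v) with this element gives <u - r, h> = 0. *)
  have Thw : brestr Th (r0 (Num.conj z) h, h + Num.conj z *: r0 (Num.conj z) h).
    split=> //=; rewrite [G _]surjective_pairing Gw G1w; exact: (sub0 sTh).
  have h1 := hu _ _ Thw; set w := r0 _ h in Tw Gw Ew G1w Thw h1.
  have E3 : E (h + Num.conj z *: w) by emem.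
  have h2 := bt_green bt Tr Tw; rewrite Gr Gw cdot0l cdot0r subrr in h2.
  have h0 : hip E (u - r) h = 0.
    set g := h + _ in Tw Thw h1 h2 E3.
    have -> : h = g - Num.conj z *: w by rewrite addrK.
    have Ezw : E (Num.conj z *: w) by emem.
    have e2 : hip E r g = hip E v w - Num.conj z * hip E (u - r) w.
      have ev : v - z *: u + z *: r = v - z *: (u - r) by lmod.
      move/eqP: h2; rewrite subr_eq0 ev => /eqP ->.
      by rewrite [LHS]hipBl ?hipZl //; emem.
    rewrite [LHS]hipBr // hipBl // h1 e2 hipZr //; ring.
  rewrite {1}/h hipBl // h0 (preh_sym hE Epx Ep) (preh_sym hE Ep Epx) hp // conjC0.
  by rewrite conjC0 subr0.
have [c _ ec] := Sp.
have [Tg Gg] := bt_gam bt c hz.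
have Tu : T (u, v).
  have := bt_TD Tr Tg; congr (T (_, _)).
  - by apply/eqP; rewrite ec eq_sym -subr_eq0 -px; apply/eqP; lmod.
  - rewrite ec; have -> : p = u - r by apply/esym/eqP; rewrite -subr_eq0 px.
    by lmod.
split=> //=; split=> //= x y Thxy.
(* Every pair of Th is the boundary value of some test element, so the condition on (u, v) reaches
   all of Th. *)
have [w [w' [Tw Gw]]] := bt_G_surj x y hz.
have := bt_green bt Tu Tw; rewrite (hu w w') ?Gw /=; last by split=> //=; rewrite Gw.
by rewrite subrr => /esym/eqP; rewrite subr_eq0 => /eqP.
Qed.

(** By [bt_decomp], c is Gamma_0 u, and Gamma_1 u is Gamma_1 r0(z) h + M(z) c, so the boundary
    condition becomes an equation for c. *)
Lemma brestr_resolvent Th z h u : reg z ->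
  resolvent (brestr Th) z (h, u) <-> E h /\ exists c,
    u = r0 z h + gam z c /\ Th (c, (G (r0 z h)).2 + M z *m c).
Proof.
move=> hz; split=> [/resolventP [/= Tu Thu]|[Eh [c [-> Thc]]]].
  have Eu := bt_E1 Tu; have E2 := bt_E2 Tu.
  have eh : h = h + z *: u - z *: u by lmod.
  have Eh : E h by rewrite eh; emem.
  split=> //; exists (G u).1.
  have eu := bt_decomp hz Tu; rewrite -eh in eu; split=> //.
  have [Tr Gr] := bt_r0 bt hz Eh; have [Tg Gg] := bt_gam bt (G u).1 hz.
  move: Thu; rewrite {1}eu (bt_GD Tr Tg) [G _ + G _]surjective_pairing /=.
  by rewrite Gr Gg (bt_M bt) // add0r.
have [Tr Gr] := bt_r0 bt hz Eh; have [Tg Gg] := bt_gam bt c hz.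
apply/resolventP; split=> /=.
  have := bt_TD Tr Tg; congr (T (_, _)); lmod.
rewrite (bt_GD Tr Tg) [G _ + G _]surjective_pairing /=.
by rewrite Gr Gg (bt_M bt) // add0r.
Qed.

(** This makes (Th - M(z))^{-1} an everywhere defined operator. Solvability for every right side
    Gamma_1 r0(z) h covers C^d by [bt_G1_surj], and a nonzero kernel vector c would give the
    eigenvector gamma(z) c. *)
Lemma brestr_rho_unique Th z : linsubspace Th -> reg z -> rho E (brestr Th) z ->
  (forall x, exists c, Th (c, x + M z *m c)) /\
  (forall c, Th (c, M z *m c) -> c = 0).
Proof.
move=> sTh hz [sv dom _ _]; split=> [x|c Thc].
  have [h Eh <-] := bt_G1_surj x hz.
  have : rdom (resolvent (brestr Th) z) h by rewrite dom.
  by move=> [u /(brestr_resolvent _ _ _ hz) [_ [c [_ hc]]]]; exists c.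
have [Tg Gg] := bt_gam bt c hz.
have r1 : resolvent (brestr Th) z (0, gam z c).
  apply/resolventP; split=> /=; rewrite ?add0r //.
  by rewrite [G _]surjective_pairing Gg (bt_M bt).
have r2 : resolvent (brestr Th) z (0, 0).
  apply/resolventP; have T0 : T (0, 0) := sub0 sT.
  split=> /=; rewrite ?scaler0 ?addr0 //.
  have := bt_GB T0 T0; rewrite subr0 => ->; rewrite subrr; exact: (sub0 sTh).
exact: (bt_gam_inj hz (sv _ _ _ r1 r2)).
Qed.
End BoundaryTriple.

(** If y is orthogonal to the range of Th - M, then (y, M^* y) belongs to the adjoint of Th, that is
    to Th. So <y, M^* y> is real, and the hypothesis on M gives y = 0. *)
Lemma selfadjoint_sub_invertible {R : realType} {d : nat}
  (Th : lrel 'cV[R[i]]_d 'cV[R[i]]_d) (M : 'M[R[i]]_d) :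
  is_selfadjoint (Cspace R d) Th ->
  (forall c, complex.Im (cdot c (M *m c)) = 0 -> c = 0) ->
  (forall x, exists c, Th (c, x + M *m c)) /\
  (forall c, Th (c, M *m c) -> c = 0).
Proof.
move=> [[sTh _] eTh] pos.
have real c t : Th (c, t) -> complex.Im (cdot c t) = 0.
  move=> h; apply: Im0_conj; have := h; rewrite {1}eTh => -[_ _ /(_ c t h) /= e].
  by rewrite cdot_conj.
split; last by move=> c /real /pos.
pose S := [set x | exists c, Th (c, x + M *m c)].
have sS : linsubspace S.
  split; first by exists 0; rewrite mulmx0 addr0; exact: (sub0 sTh).
  move=> a x y [c hc] [b hb]; exists (a *: c + b).
  have := subZD sTh a hc hb; congr Th; congr pair => /=.
  by rewrite mulmxDr -scalemxAr scalerDr addrACA.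
apply: (subspace_full sS) => y hy.
have Thy : Th (y, adjmx M *m y).
  rewrite eTh; split=> //= c t h.
  have /hy : S (t - M *m c) by exists c; rewrite subrK.
  rewrite -cdot_conj => e; have {e} : cdot y (t - M *m c) = 0.
    by apply: (can_inj (@conjCK _)); rewrite e conjC0.
  by rewrite cdotBr -cdot_adjl => /eqP; rewrite subr_eq0 => /eqP.
apply: pos; have := real _ _ Thy; rewrite cdot_adjr -cdot_conj Im_conj.
by move/eqP; rewrite oppr_eq0 => /eqP.
Qed.

Section BoundaryTripleSelfAdjoint.
Context {R : realType} {V : lmodType R[i]} {d : nat} (E : hspace V)
  (T : lrel V V) (G : V -> 'cV[R[i]]_d * 'cV[R[i]]_d) (reg : set R[i])
  (r0 : R[i] -> V -> V) (gam : R[i] -> 'cV[R[i]]_d -> V)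
  (M : R[i] -> 'M[R[i]]_d) (bt : boundary_triple E T G reg r0 gam M).
Implicit Types (Th : lrel 'cV[R[i]]_d 'cV[R[i]]_d) (z : R[i]).
Let hE := bt_preh bt.

Lemma brestr_selfadjoint Th : is_selfadjoint (Cspace R d) Th ->
  is_selfadjoint E (brestr T G Th).
Proof.
move=> [[sTh _] eTh].
have e : brestr T G Th = radj E E (brestr T G Th).
  by rewrite (brestr_adjoint bt) // -eTh.
split=> //; rewrite e; apply: (radj_is_closed hE _).1 => p [/(bt_mem bt)] //.
Qed.

(** In C^d a linear relation is its own second adjoint, so by [brestr_adjoint] the restriction is an
    adjoint, and adjoints are closed. *)
Lemma brestr_closed Th : is_closed (Cspace R d) (Cspace R d) Th ->
  is_closed E E (brestr T G Th).
Proof.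
move=> [[sTh _] _].
set Th' := radj (Cspace R d) (Cspace R d) Th.
have clTh' := radj_is_closed (@Cspace_preh R d) (T := Th) (fun _ _ => conj I I).
suff -> : Th = radj (Cspace R d) (Cspace R d) Th'.
  rewrite -(brestr_adjoint bt) //; last exact: clTh'.1.1.
  by apply: radj_is_closed => // p [/(bt_mem bt)].
apply/seteqP; split=> [[x y] h|[x y] [_ _ h]].
  split=> // a b [_ _ /(_ x y h)] /= e.
  by rewrite -[LHS]cdot_conj -[RHS]cdot_conj e.
pose F := hextsum (Cspace R d) (Cspace R d).
have hF : preh F.
  split=> //=.
  - by move=> a u v w _ _ _; rewrite !cdotDr !cdotZr; ring.
  - by move=> u v _ _; rewrite conjD !cdot_conj.
  - by move=> u _; rewrite addr_ge0 // (preh_ge0 (@Cspace_preh R d)).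
  - move=> [u v] _ /= /eqP.
    rewrite paddr_eq0 ?(preh_ge0 (@Cspace_preh R d)) // => /andP[/eqP e1 /eqP e2].
    by rewrite (cdot_eq0 e1) (cdot_eq0 e2).
pose l := [seq (delta_mx s 0, 0) | s <- enum 'I_d] ++
          [seq (0, delta_mx s 0) | s <- enum 'I_d] : seq ('cV[R[i]]_d * 'cV[R[i]]_d).
have span w : in_span l w.
  have -> : w = lincomb (fun s => (delta_mx s 0, 0)) w.1
              + lincomb (fun s => (0, delta_mx s 0)) w.2.
    have e1 : lincomb (fun s => (delta_mx s 0, 0)) w.1 = (w.1, 0 : 'cV[R[i]]_d).
      rewrite {2}(lincombE_id w.1) /lincomb; elim/big_rec2: _ => // i a b _ ->.
      by rewrite [LHS]surjective_pairing /= scaler0 addr0.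
    have e2 : lincomb (fun s => (0, delta_mx s 0)) w.2 = (0 : 'cV[R[i]]_d, w.2).
      rewrite {2}(lincombE_id w.2) /lincomb; elim/big_rec2: _ => // i a b _ ->.
      by rewrite [LHS]surjective_pairing /= scaler0 addr0.
    by rewrite e1 e2 [LHS]surjective_pairing [RHS]surjective_pairing /= addr0 add0r.
  by apply: in_span_cat; apply: in_span_lincomb.
have [[p q] [Thpq hp]] := span_projection hF sTh (fun _ _ => conj I I)
  (fun w _ => span w) (x := (x, y)) (conj I I).
(* A pair (a, b) orthogonal to the graph of Th gives the element (b, -a) of its adjoint. Testing (x,
   y) and (p, q) with it yields |y - q|^2 + |x - p|^2 = 0. *)
have Th'' : Th' (y - q, - (x - p)).
  split=> //= s t Thst; have := hp _ Thst => /= e.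
  rewrite cdotNl -[LHS]cdot_conj -[cdot (x - p) s]cdot_conj.
  apply/eqP; rewrite eq_sym eqr_oppLR -subr_eq0 opprK -conjD.
  by rewrite e conjC0.
have := h _ _ Th''; have [_ _ /(_ _ _ Thpq) /= e] := Th''.
rewrite cdotNr => e'.
have e2 : cdot (y - q) (y - q) + cdot (x - p) (x - p) = 0.
  have a1 : cdot (y - q) y = - cdot (x - p) x.
    by rewrite -cdot_conj -e' conjN cdot_conj.
  by rewrite cdotBr [cdot (x - p) (x - p)]cdotBr a1 e cdotNl; ring.
move/eqP: e2; rewrite paddr_eq0 ?(preh_ge0 (@Cspace_preh R d)) //.
move=> /andP[/eqP/cdot_eq0/eqP]; rewrite subr_eq0 => /eqP ->.
by move/eqP/cdot_eq0/eqP; rewrite subr_eq0 => /eqP ->.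
Qed.

End BoundaryTripleSelfAdjoint.

(** * The scale of spaces *)

Lemma rsa_real {R : realType} {V : lmodType R[i]} (E : hspace V) (hE : preh E)
  (T : lrel V V) x y : is_selfadjoint E T -> T (x, y) -> hip E x y = hip E y x.
Proof. by move=> [_ eT] Txy; have := Txy; rewrite {1}eT => -[_ _ /(_ _ _ Txy)]. Qed.

Section Scale.
Context {R : realType} {X : lmodType R[i]} (S : scale X) (hS : is_scale S).
Local Notation C := R[i].
Local Notation H0 := (sH0 S).
Local Notation L := (sL S).
Local Notation Om := (sOm S).
Implicit Types (x y p f : X) (n k : nat).

Let hH : is_hilbert H0 := scale_hilbert hS.
Lemma H0_preh : preh H0. Proof. exact: hilbert_preh. Qed.
Let pH := H0_preh.

Lemma Om_graph n x : Hpos S n x -> rrestr (graph (Om n)) (Hpos S n) (x, Om n x).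
Proof. by []. Qed.

Lemma Hpos_H0 n x : Hpos S n x -> H0 x.
Proof.
move=> hx; have [_ _ [[_ h] _]] := scale_Om_selfadjoint hS n.
by have [] := h (x, Om n x) (conj erefl hx).
Qed.

Lemma Hpos_sub n : linsubspace (Hpos S n).
Proof.
have [_ _ [[sT _] _]] := scale_Om_selfadjoint hS n; split.
  by have [_] := sub0 sT.
move=> a x y hx hy.
by have [_ /=] := subZD sT a (Om_graph hx) (Om_graph hy).
Qed.

Lemma Hpos0 : Hpos S 0 = H0 :> set X.
Proof.
apply/seteqP; split=> [x /= [y [_ //]]|x hx]; by exists x.
Qed.

Lemma Hpos_decr n x : Hpos S n.+1 x -> Hpos S n x.
Proof. by move=> [y [z h _]]; exists z. Qed.

Lemma Om_H0 n x : Hpos S n x -> H0 (Om n x).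
Proof. by move=> hx; have [h _ _] := scale_Om_unitary hS n; apply: h. Qed.

Lemma Om_surj n y : H0 y -> exists2 x, Hpos S n x & Om n x = y.
Proof. by move=> hy; have [_ _ /(_ _ hy) [x hx <-]] := scale_Om_unitary hS n; exists x. Qed.

Lemma Om_inj n x : Hpos S n x -> Om n x = 0 -> x = 0.
Proof.
move=> hx e; have [_ h _] := scale_Om_unitary hS n.
apply: h; rewrite ?inE ?linear0 //; exact: sub0 (Hpos_sub n).
Qed.

Lemma Om_neg n x : H0 x -> sneg S n (Om n x).
Proof. by move=> hx; have [h _ _] := scale_Omt_unitary hS n; apply: h. Qed.

Lemma Om_neg_surj n y : sneg S n y -> exists2 x, H0 x & Om n x = y.
Proof. by move=> hy; have [_ _ /(_ _ hy) [x hx <-]] := scale_Omt_unitary hS n; exists x. Qed.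

Lemma Om_neg_inj n x y : H0 x -> H0 y -> Om n x = Om n y -> x = y.
Proof.
by move=> hx hy e; have [_ h _] := scale_Omt_unitary hS n; apply: h; rewrite ?inE.
Qed.

Lemma sneg0 : sneg S 0 = H0 :> set X.
Proof.
apply/seteqP; split=> x.
- by move=> /Om_neg_surj [y hy <-]; rewrite (scale_Om0 hS).
- by move=> hx; rewrite -(scale_Om0 hS x); apply: Om_neg.
Qed.

Lemma inv_Om n x : H0 x -> inv_on H0 (Om n) (Om n x) = x.
Proof.
move=> hx; rewrite /inv_on; case: xgetP => [y -> [hy e]|/(_ x) []//].
exact: Om_neg_inj e.
Qed.

Lemma hip_Hneg n u v : H0 u -> H0 v -> hip (Hneg S n) (Om n u) (Om n v) = hip H0 u v.
Proof. by move=> hu hv; rewrite /= !inv_Om. Qed.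

Lemma Hpos_preh n : preh (Hpos S n).
Proof.
split=> [|a x y z hx hy hz|x y hx hy|x hx|x hx]; first exact: Hpos_sub.
- by rewrite /= linearP (preh_linr pH) //; apply: Om_H0.
- by rewrite /= (preh_sym pH) //; apply: Om_H0.
- by apply: (preh_ge0 pH); apply: Om_H0.
- by move/(preh_def pH (Om_H0 hx))/(Om_inj hx).
Qed.

Lemma Hneg_preh n : preh (Hneg S n).
Proof.
have surj := @Om_neg_surj n.
split=> [|a x y z|x y|x|x].
- exact: scale_neg_sub.
- move=> /surj [u hu <-] /surj [v hv <-] /surj [w hw <-].
  by rewrite -linearP !hip_Hneg ?(preh_linr pH) //; emem.
- move=> /surj [u hu <-] /surj [v hv <-].
  by rewrite !hip_Hneg // (preh_sym pH).
- by move=> /surj [u hu <-]; rewrite hip_Hneg // (preh_ge0 pH).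
- move=> /surj [u hu <-]; rewrite hip_Hneg // => /(preh_def pH hu) ->.
  exact: linear0.
Qed.

Lemma sL0E x y : sL0 S (x, y) <-> Hpos S 2 x /\ y = L x.
Proof.
have := scale_dom hS 1; rewrite -[1.*2]/2%N => <-.
have [sv _ [[_ m] _]] := scale_selfadjoint hS.
split=> [h|[[w [v [/= e hx] h]] ->]].
- split; last by rewrite (scale_L_ext hS h).
  by exists y; exists x => //=; split=> //; have [] := m _ h.
- by move: e; rewrite /graph /= => e; rewrite e in h; rewrite (scale_L_ext hS h).
Qed.

Lemma L_H0 x : Hpos S 2 x -> H0 (L x).
Proof.
move=> hx; have [_ _ [[_ m] _]] := scale_selfadjoint hS.
by have [] := m (x, L x) ((sL0E _ _).2 (conj hx erefl)).
Qed.

Lemma L_symmetric x y : Hpos S 2 x -> Hpos S 2 y -> hip H0 x (L y) = hip H0 (L x) y.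
Proof.
move=> hx hy; have [_ _ [_ e]] := scale_selfadjoint hS.
have Tx := (sL0E _ _).2 (conj hx erefl); rewrite e in Tx.
by have [_ _ h] := Tx; apply: h; apply/sL0E.
Qed.

Lemma H2_dense : hdense H0 (Hpos S 2).
Proof.
have [_ d _] := scale_selfadjoint hS => x e hx e0.
have [y [[w /sL0E [hy _]] Hy lt]] := d x e hx e0; by exists y.
Qed.

Lemma rhoL_nonreal (z : C) : complex.Im z != 0 -> rhoL S z.
Proof.
have [_ _ sa] := scale_selfadjoint hS; exact: selfadjoint_nonreal_rho.
Qed.

Lemma rhoL_conj (z : C) : rhoL S z -> rhoL S (Num.conj z).
Proof.
have [re|nz] := eqVneq (complex.Im z) 0; first by rewrite (conj_Im0 re).
by move=> _; apply: rhoL_nonreal; rewrite Im_conj oppr_eq0.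
Qed.

(** * The maps L - z between the spaces of the scale *)

Lemma shift_surj0 (z : C) y : rhoL S z -> H0 y ->
  exists2 x, Hpos S 2 x & L x - z *: x = y.
Proof.
move=> [_ dom _ _] hy; have : rdom (resolvent (sL0 S) z) y by rewrite dom.
move=> [x /resolventP /sL0E [hx e]]; exists x => //.
by rewrite -e addrK.
Qed.

Lemma Hpos_le n k x : (n <= k)%N -> Hpos S k x -> Hpos S n x.
Proof.
move=> /subnK <-; elim: (k - n)%N => [|j IH] //.
by rewrite addSn => /Hpos_decr /IH.
Qed.

Lemma Om_H2 n x : Hpos S n.+2 x -> Hpos S 2 (Om n x).
Proof. by move=> hx; rewrite -(scale_Om2 hS n); exists x. Qed.
Lemma Om_H2_surj n y : Hpos S 2 y -> exists2 x, Hpos S n.+2 x & Om n x = y.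
Proof. by rewrite -(scale_Om2 hS n) => -[x hx <-]; exists x. Qed.

(** Omega_n commutes with L and takes H_{n+2} to H_2, so Omega_n L x is in H_0. It is then Omega_n y
    with y in H_n, and injectivity of Omega_n on H_0 gives L x = y. *)
Lemma L_Hpos n x : Hpos S n.+2 x -> Hpos S n (L x).
Proof.
move=> hx; have h2 := Om_H2 hx; have := L_H0 h2; rewrite (scale_Om_L hS).
move=> h; have [y hy e] := Om_surj n h.
suff -> : L x = y by [].
apply: (@Om_neg_inj n) => //; first by apply: L_H0; apply: Hpos_le hx.
exact: Hpos_H0 hy.
Qed.

Lemma Hshift n (z : C) x : Hpos S n.+2 x -> Hpos S n (L x - z *: x).
Proof.
move=> hx; apply: (subB (Hpos_sub n)); first exact: L_Hpos.
by apply: (subZ (Hpos_sub n)); apply: Hpos_le hx; rewrite -addn2 leq_addr.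
Qed.

Lemma shift_surj_pos n (z : C) y : rhoL S z -> Hpos S n y ->
  exists2 x, Hpos S n.+2 x & L x - z *: x = y.
Proof.
move=> hz hy; have [v hv e] := shift_surj0 hz (Om_H0 hy).
have [x hx ex] := Om_H2_surj n hv; exists x => //.
have hs := Hshift z hx.
apply: (@Om_neg_inj n); [exact: Hpos_H0 hs|exact: Hpos_H0 hy|].
by rewrite linearB linearZ /= -(scale_Om_L hS) ex.
Qed.

Lemma shift_surj_neg n (z : C) y : rhoL S z -> sneg S n.+2 y ->
  exists2 x, sneg S n x & L x - z *: x = y.
Proof.
move=> hz /Om_neg_surj [u hu <-]; have [v hv <-] := shift_surj0 hz hu.
have [x hx ex] := Om_H2_surj n hv.
(* This vector is Omega_{n+2} v, which a priori is only in H_{-n-2}. Writing v = Omega_n x with x in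
   H_{n+2} and commuting the two operators places it in H_{-n}. *)
exists (Om n (Om n.+2 x)); first by apply: Om_neg; apply: Om_H0.
rewrite (scale_Om_comm hS) ex [in RHS]linearB [in RHS]linearZ /=.
by rewrite (scale_Om_L hS).
Qed.

(** The odd level at which L - z crosses from H_1 to H_{-1}; here Omega_1(H_2) = H_1 is used. *)
Lemma shift_surj_neg1 (z : C) y : rhoL S z -> sneg S 1 y ->
  exists2 x, Hpos S 1 x & L x - z *: x = y.
Proof.
move=> hz /Om_neg_surj [u hu <-]; have [v hv <-] := shift_surj0 hz hu.
exists (Om 1 v); first by rewrite -(scale_Om1 hS); exists v.
by rewrite [in RHS]linearB [in RHS]linearZ /= (scale_Om_L hS).
Qed.

(** One integer index for both halves of the scale, so that regularity is counted by arithmetic: L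
    lowers k by 2 and the resolvent raises it by 2. *)
Definition hlev (k : int) : set X := Hscale S k.

Lemma hlevN n : hlev (- n%:Z) = sneg S n.
Proof. by case: n => [|n] //; rewrite oppr0 sneg0 -Hpos0. Qed.

Lemma hlev_preh (k : int) : preh (Hscale S k).
Proof. by case: k => n; [exact: Hpos_preh | exact: Hneg_preh]. Qed.

Lemma hlev_sub (k : int) : linsubspace (hlev k). Proof. exact: preh_sub (hlev_preh k). Qed.

Lemma hlev_decr (k : int) x : hlev k x -> hlev (k - 1) x.
Proof.
case: k => [[|n]|n].
- rewrite [X in hlev X]/= sub0r => h.
  have : sneg S 0 x by rewrite sneg0 -Hpos0.
  by move/(scale_neg_incl hS); rewrite -(hlevN 1).
- have -> : Posz n.+1 - 1 = Posz n by lia.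
  exact: Hpos_decr.
- move=> h; have -> : Negz n - 1 = Negz n.+1 by rewrite !NegzE; lia.
  exact: (scale_neg_incl hS).
Qed.

Lemma hlev_le (j k : int) x : (j <= k)%R -> hlev k x -> hlev j x.
Proof.
move=> le hx.
have [n ->] : exists n : nat, j = k - n%:Z by exists `|k - j|%N; lia.
elim: n => [|n IH]; first by rewrite subr0.
have -> : k - n.+1%:Z = k - n%:Z - 1 by lia.
exact: hlev_decr.
Qed.

Lemma hlev_L (k : int) x : hlev k x -> hlev (k - 2) (L x).
Proof.
case: k => [[|[|n]]|n] hx.
- have [h _] := scale_L_bounded hS 2; exact: h.
- have [h _] := scale_L_bounded hS 1; exact: h.
- have -> : Posz n.+2 - 2 = Posz n by lia.
  exact: L_Hpos.
- have [h _] := scale_L_bounded hS n.+3.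
  have -> : Negz n - 2 = - n.+3%:Z by lia.
  apply: h; have -> : 2 - n.+3%:Z = Negz n by lia.
  exact: hx.
Qed.

Lemma shift_surj_lev (k : int) (z : C) y : rhoL S z -> hlev k y ->
  exists2 x, hlev (k + 2) x & L x - z *: x = y.
Proof.
move=> hz; case: k => [n|[|n]] hy.
- by have [x hx e] := shift_surj_pos hz hy; exists x => //; rewrite -PoszD addn2.
- by have [x hx e] := shift_surj_neg1 hz hy; exists x.
- have [x hx e] := shift_surj_neg hz hy; exists x => //.
  have -> : Negz n.+1 + 2 = - n%:Z by lia.
  by rewrite hlevN.
Qed.

(** * The duality pairing and the resolvent on the whole scale *)

Lemma pair_linr n p (a : C) f g : sneg S n p -> Hpos S n f -> Hpos S n g ->
  spair S p (a *: f + g) = a * spair S p f + spair S p g.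
Proof. by move=> hp hf hg; have [h _] := scale_pair_functional hS hp; apply: h. Qed.

Lemma pair_Br n p f g : sneg S n p -> Hpos S n f -> Hpos S n g ->
  spair S p (f - g) = spair S p f - spair S p g.
Proof.
by move=> hp hf hg; rewrite addrC -scaleN1r (pair_linr _ hp hg hf) mulN1r addrC.
Qed.

Lemma pair_Zr n p (a : C) f : sneg S n p -> Hpos S n f ->
  spair S p (a *: f) = a * spair S p f.
Proof.
move=> hp hf; have h0 := sub0 (Hpos_sub n).
have e := pair_linr a hp hf h0.
have e0 := pair_linr 1 hp h0 h0.
move: e; rewrite addr0 => ->; move/eqP: e0.
by rewrite scaler0 add0r mul1r -subr_eq0 opprD addNKr oppr_eq0 => /eqP ->; rewrite addr0.
Qed.

Lemma pair_Bl n p q f : sneg S n p -> sneg S n q -> Hpos S n f ->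
  spair S (p - q) f = spair S p f - spair S q f.
Proof.
move=> hp hq hf; rewrite addrC -scaleN1r (scale_pair_conj hS _ hq hp hf).
by rewrite conjN conjC1 mulN1r addrC.
Qed.

Lemma pair_Zl n (a : C) p f : sneg S n p -> Hpos S n f ->
  spair S (a *: p) f = Num.conj a * spair S p f.
Proof.
move=> hp hf; have h0 := sub0 (scale_neg_sub hS n).
have e := scale_pair_conj hS a hp h0 hf.
have e0 := scale_pair_conj hS 1 h0 h0 hf.
move: e; rewrite addr0 => ->; move/eqP: e0.
rewrite scaler0 add0r conjC1 mul1r -subr_eq0 opprD addNKr oppr_eq0 => /eqP ->.
by rewrite addr0.
Qed.

Lemma pair_Om n u f : H0 u -> Hpos S n f -> spair S (Om n u) f = hip H0 u (Om n f).
Proof. exact: scale_Omt_pair. Qed.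

Lemma pair_bound n p f : sneg S n p -> Hpos S n f ->
  `|spair S p f| <= (hnorm (Hneg S n) p * hnorm (Hpos S n) f)%:C.
Proof.
move=> /Om_neg_surj [u hu <-] hf; rewrite pair_Om //.
have -> : hnorm (Hneg S n) (Om n u) = hnorm H0 u by rewrite /hnorm hip_Hneg.
exact: (cauchy_schwarz pH hu (Om_H0 hf)).
Qed.

Lemma hnorm_Om n u : H0 u -> hnorm (Hscale S (- n%:Z)) (Om n u) = hnorm H0 u.
Proof.
move=> hu; case: n => [|n]; last by rewrite /hnorm hip_Hneg.
by rewrite oppr0 /hnorm /= !(scale_Om0 hS).
Qed.

(* Both sides are continuous in p, and they agree on the dense image of H_2. *)
Lemma pair_L n p f : sneg S n p -> Hpos S n.+2 f ->
  spair S (L p) f = spair S p (L f).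
Proof.
move=> /Om_neg_surj [u hu <-] hf.
have hLf : Hpos S n (L f) by exact: L_Hpos.
have hfn : Hpos S n f by apply: Hpos_le hf; rewrite -addn2 leq_addr.
have [Lm [M hM]] := scale_L_bounded hS n.+2.
have e1 : 2 - n.+2%:Z = - n%:Z by lia.
rewrite e1 in Lm hM.
have Lmem q : sneg S n q -> sneg S n.+2 (L q).
  by move=> hq; have := Lm q; rewrite -[Hscale _ _ _]/(hlev _ _) hlevN => /(_ hq).
have bd v : H0 v -> `|spair S (L (Om n v)) f - spair S (Om n v) (L f)|
    <= (hnorm H0 v * (`|M| * hnorm (Hpos S n.+2) f + hnorm (Hpos S n) (L f)))%:C.
  move=> hv; have hOv := Om_neg n hv.
  apply: le_trans (ler_normB _ _) _; rewrite mulrDr realcD lerD //.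
  - apply: le_trans (pair_bound (Lmem _ hOv) hf) _; rewrite lecR mulrA ler_wpM2r ?hnorm_ge0 //.
    have h := hM (Om n v); rewrite -[Hscale _ _ _]/(hlev _ _) hlevN in h.
    apply: le_trans (h hOv) _; rewrite hnorm_Om // [in leRHS]mulrC ler_wpM2r ?hnorm_ge0 //.
    exact: ler_norm.
  - apply: le_trans (pair_bound hOv hLf) _.
    have -> : hnorm (Hneg S n) (Om n v) = hnorm H0 v by rewrite /hnorm hip_Hneg.
    by [].
have eq0 v : Hpos S 2 v -> spair S (L (Om n v)) f = spair S (Om n v) (L f).
  move=> hv; rewrite (scale_Om_L hS) !pair_Om //; [|exact: Hpos_H0 hv|exact: L_H0].
  by rewrite -L_symmetric ?(scale_Om_L hS) //; apply: Om_H2.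
apply/eqP; rewrite -subr_eq0; apply/eqP/eq0_le_eps => e e0.
set K := `|M| * hnorm (Hpos S n.+2) f + hnorm (Hpos S n) (L f) in bd.
have K0 : 0 <= K by rewrite addr_ge0 ?mulr_ge0 ?hnorm_ge0.
have K1 : 0 < K + 1 by rewrite ltr_wpDl.
have [v [hv Hv lt]] := H2_dense hu (divr_gt0 e0 K1).
have Huv : H0 (u - v) by emem.
have hOu := Om_neg n hu; have hOv := Om_neg n Hv.
have -> : spair S (L (Om n u)) f - spair S (Om n u) (L f)
  = spair S (L (Om n (u - v))) f - spair S (Om n (u - v)) (L f).
  rewrite !linearB /= (pair_Bl hOu hOv hLf) (pair_Bl (Lmem _ hOu) (Lmem _ hOv) hf).
  by rewrite (eq0 _ hv); ring.
apply: le_trans (bd _ Huv) _; rewrite lecR.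
have -> : e = e / (K + 1) * (K + 1) by rewrite divfK // gt_eqF.
have lt' : hnorm H0 (u - v) < e / (K + 1).
  by rewrite -opprB (hnormN pH) //; emem.
by apply: ler_pM; rewrite ?hnorm_ge0 ?lerDl // ltW.
Qed.

(** By duality: every test element is (L - conj z) g, and <x, (L - conj z) g> = <(L - z) x, g>.
    Injectivity on all of X is what makes the inverse in [resL] unambiguous. *)
Lemma shift_inj (z : C) x : rhoL S z -> L x - z *: x = 0 -> x = 0.
Proof.
move=> hz e; have [n hx] := scale_union hS x.
apply: (scale_pair_inj hS hx) => f hf.
have [g hg <-] := shift_surj_pos (rhoL_conj hz) hf.
have hgn : Hpos S n g by apply: Hpos_le hg; rewrite -addn2 leq_addr.
rewrite (pair_Br hx (L_Hpos hg)); last exact: (subZ (Hpos_sub n)).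
rewrite -(pair_L hx hg) (pair_Zr _ hx hgn).
have -> : L x = z *: x by apply/eqP; rewrite -subr_eq0 e.
by rewrite (pair_Zl _ hx hgn) subrr.
Qed.

Lemma shift_eq (z : C) x y : rhoL S z -> L x - z *: x = L y - z *: y -> x = y.
Proof.
move=> hz e; apply/eqP; rewrite -subr_eq0; apply/eqP/(shift_inj hz).
have -> : L (x - y) - z *: (x - y) = (L x - z *: x) - (L y - z *: y).
  by rewrite (linearB L); lmod.
by rewrite e subrr.
Qed.

Lemma resL_shift (z : C) x : rhoL S z -> resL S z (L x - z *: x) = x.
Proof.
move=> hz; rewrite /resL /inv_on; case: xgetP => [y -> [_ e]|/(_ x) []//].
exact: shift_eq e.
Qed.

Lemma sneg_hlev x : exists k : int, hlev k x.
Proof. by have [n hx] := scale_union hS x; exists (- n%:Z); rewrite hlevN. Qed.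

Lemma shift_resL (z : C) y : rhoL S z -> L (resL S z y) - z *: resL S z y = y.
Proof.
move=> hz; have [k hk] := sneg_hlev y; have [x hx <-] := shift_surj_lev hz hk.
by rewrite resL_shift.
Qed.

Lemma L_resL (z : C) y : rhoL S z -> L (resL S z y) = y + z *: resL S z y.
Proof. by move=> hz; rewrite -{2}(shift_resL y hz) subrK. Qed.

Lemma hlev_resL (k : int) (z : C) y : rhoL S z -> hlev k y -> hlev (k + 2) (resL S z y).
Proof.
by move=> hz hk; have [x hx <-] := shift_surj_lev hz hk; rewrite resL_shift.
Qed.

Lemma resLP (z a : C) x y : rhoL S z ->
  resL S z (a *: x + y) = a *: resL S z x + resL S z y.
Proof.
move=> hz; apply: (shift_eq hz); rewrite shift_resL // linearP /=.
rewrite -{1}(shift_resL x hz) -{1}(shift_resL y hz); lmod.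
Qed.

(* Every x in X equals (L-z)^k u with u in H_0. *)
Lemma Om_injX n x : Om n x = 0 -> x = 0.
Proof.
have hz : rhoL S 'i by apply: rhoL_nonreal; apply: oner_neq0.
have [k hk] := scale_union hS x; move: hk.
have {}hk : sneg S k x -> sneg S k.*2 x.
  move=> h; have : hlev (- k.*2%:Z) x; last by rewrite hlevN.
  by apply: (@hlev_le _ (- k%:Z)); [lia|rewrite hlevN].
move/hk; elim: k x {hk} => [|k IH] x; rewrite ?doubleS.
  rewrite sneg0 => hx e; apply: (@Om_neg_inj n) => //; first exact: ph0 pH.
  by rewrite linear0.
move=> hx e; have [y hy ey] := shift_surj_neg hz hx.
rewrite -ey in e *; suff -> : y = 0 by rewrite linear0 scaler0 subr0.
apply: IH => //; apply: (shift_inj hz).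
by rewrite (scale_Om_L hS) -linearZ -linearB.
Qed.
End Scale.

(** * The exit space and its moments *)

Lemma lincombD {R : realType} {V : lmodType R[i]} {d : nat} (e : 'I_d -> V) (a : R[i]) c c' :
  lincomb e (a *: c + c') = a *: lincomb e c + lincomb e c'.
Proof.
rewrite /lincomb scaler_sumr -big_split; apply: eq_bigr => i _ /=.
by rewrite !mxE scalerDl scalerA.
Qed.

Lemma lincomb_delta {R : realType} {V : lmodType R[i]} {d : nat} (e : 'I_d -> V) s :
  lincomb e (delta_mx s 0) = e s.
Proof.
rewrite /lincomb (bigD1 s) //= mxE !eqxx scale1r big1 ?addr0 // => j ne.
by rewrite mxE (negbTE ne) scale0r.
Qed.

Lemma lincomb0 {R : realType} {V : lmodType R[i]} {d : nat} (e : 'I_d -> V) :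
  lincomb e 0 = 0.
Proof. by rewrite /lincomb big1 // => i _; rewrite mxE scale0r. Qed.

Lemma lincomb_linear {R : realType} {V W : lmodType R[i]} {d : nat}
  (f : V -> W) (e : 'I_d -> V) c :
  (forall a x y, f (a *: x + y) = a *: f x + f y) ->
  f (lincomb e c) = lincomb (fun s => f (e s)) c.
Proof.
move=> lf; have f0 : f 0 = 0.
  by have := lf (-1) 0 0; rewrite scaler0 addr0 scaleN1r addNr.
by rewrite /lincomb; elim/big_rec2: _ => // i x y _ <-; rewrite lf.
Qed.

Section Model.
Context {R : realType} {X : lmodType R[i]} {m d : nat} (D : model X m d)
  (hD : standing D).
Local Notation C := R[i].
Local Notation L := (sL D).
Local Notation CV := 'cV[C]_d.
Local Notation phin := (lincomb (phi D)).
Local Notation H m := (Hpos D m).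
Local Notation hl := (hlev D).
Implicit Types (c b a : CV) (z w : C) (A B : 'M[C]_(d, m)).

Let hS : is_scale D := standing_scale hD.
Let sl k : linsubspace (hl k) := hlev_sub hS k.

Lemma phi_lev s : sneg D m.+2 (phi D s). Proof. by have [] := standing_phi hD s. Qed.

Lemma phin_lev c : sneg D m.+2 (phin c).
Proof.
apply: (sub_sum (scale_neg_sub hS _)) => s _.
by apply: (subZ (scale_neg_sub hS _)); apply: phi_lev.
Qed.

Lemma phin_hl c : hl (- m.+2%:Z) (phin c).
Proof. by rewrite hlevN //; apply: phin_lev. Qed.

Lemma H_m x : H m.+2 x -> H m x.
Proof. by apply: (Hpos_le (n := m)); rewrite -addn2 leq_addr. Qed.

Lemma pair_phin c f : H m.+2 f -> spair D (phin c) f = cdot c (phipair D f).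
Proof.
move=> hf; rewrite /lincomb /cdot.
have h0 : spair D 0 f = 0.
  by rewrite -(scale0r 0) (pair_Zl hS _ (sub0 (scale_neg_sub hS m.+2)) hf) conjC0 mul0r.
have key (r : seq 'I_d) : sneg D m.+2 (\sum_(s <- r) c s 0 *: phi D s) /\
    spair D (\sum_(s <- r) c s 0 *: phi D s) f
    = \sum_(s <- r) Num.conj (c s 0) * phipair D f s 0.
  elim: r => [|s r [IH1 IH2]]; first by rewrite !big_nil; split=> //; exact: sub0 (scale_neg_sub hS _).
  rewrite !big_cons; split.
    by apply: (subZD (scale_neg_sub hS _)) => //; apply: phi_lev.
  by rewrite (scale_pair_conj hS _ (phi_lev s) IH1 hf) IH2 mxE.
by have [] := key (index_enum 'I_d).
Qed.

Lemma phipairD (a : C) f g : H m.+2 f -> H m.+2 g ->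
  phipair D (a *: f + g) = a *: phipair D f + phipair D g.
Proof.
move=> hf hg; apply/matrixP => s j; rewrite !mxE.
exact: (pair_linr hS a (phi_lev s) hf hg).
Qed.

(** A combination lying in H_{-m} is continuous on H_m and vanishes on dom L_min, which is dense
    there. Linear independence of the phi_s then gives c = 0. *)
Lemma phin_lowest c : hl (- m%:Z) (phin c) -> c = 0.
Proof.
rewrite hlevN // => hc; apply: (standing_indep hD).
apply: (scale_pair_inj hS hc) => f hf.
apply: eq0_le_eps => e e0.
set N := hnorm (Hneg D m) (phin c).
have N0 : 0 < N + 1 by rewrite ltr_wpDl ?hnorm_ge0.
have [g [[w [e1 /= [hg pg]]] Hg lt]] := standing_Lmin_dense hD hf (divr_gt0 e0 N0).
have pc0 : spair D (phin c) g = 0 by rewrite pair_phin // pg cdot0r.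
have hfg : H m (g - f) by apply: (subB (Hpos_sub hS m)).
have := pair_bound hS hc hfg; rewrite (pair_Br hS hc Hg hf) pc0 sub0r normrN => le.
apply: le_trans le _; rewrite lecR.
have -> : e = (N + 1) * (e / (N + 1)) by rewrite mulrCA mulfV ?mulr1 // gt_eqF.
apply: ler_pM; rewrite ?hnorm_ge0 ?lerDl //.
exact: ltW.
Qed.

Lemma phin_resL z c : rhoL D z -> resL D z (phin c) = lincomb (gs D z) c.
Proof. by move=> hz; apply: lincomb_linear => a x y; apply: (resLP hS). Qed.

Lemma gz_hl z c : rhoL D z -> hl (- m%:Z) (lincomb (gs D z) c).
Proof.
move=> hz; rewrite -phin_resL //; have := hlev_resL hS hz (phin_hl c).
by have -> : - m.+2%:Z + 2 = - m%:Z by lia.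
Qed.

Lemma L_gz z c : rhoL D z ->
  L (lincomb (gs D z) c) = z *: lincomb (gs D z) c + phin c.
Proof. by move=> hz; rewrite -phin_resL // (L_resL hS) // addrC. Qed.

Lemma zpt_rho j : rhoL D (zpt D j). Proof. exact: standing_z. Qed.

(** In terms of the coefficient matrix of k, [zscale] is the operator l and [colsum] is c(k); on K
    the extended L is l + phi(c(k)). *)
Definition zscale A : 'M[C]_(d, m) := \matrix_(s, j) (zpt D j * A s j).
Definition colsum A : CV := \sum_j col j A.

Lemma KcombE A : Kcomb D A = \sum_j lincomb (gs D (zpt D j)) (col j A).
Proof.
rewrite /Kcomb exchange_big; apply: eq_bigr => j _; rewrite /lincomb.
by apply: eq_bigr => s _; rewrite mxE.
Qed.

Lemma KcombZD (a : C) A B : Kcomb D (a *: A + B) = a *: Kcomb D A + Kcomb D B.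
Proof.
rewrite !KcombE scaler_sumr -big_split; apply: eq_bigr => j _ /=.
rewrite -lincombD; congr lincomb.
by apply/matrixP => s k; rewrite !mxE.
Qed.

Lemma Kcomb0 : Kcomb D 0 = 0.
Proof.
by have := KcombZD (-1) 0 0; rewrite scaler0 addr0 scaleN1r addNr.
Qed.

Lemma Kcomb_hl A : hl (- m%:Z) (Kcomb D A).
Proof.
by rewrite KcombE; apply: (sub_sum (sl _)) => j _; apply: gz_hl; apply: zpt_rho.
Qed.

Lemma phin_sum (I : Type) (r : seq I) (F : I -> CV) :
  phin (\sum_(i <- r) F i) = \sum_(i <- r) phin (F i).
Proof.
elim: r => [|i r IH]; first by rewrite !big_nil lincomb0.
by rewrite !big_cons -IH -[F i in LHS]scale1r lincombD scale1r.
Qed.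

Lemma L_Kcomb A : L (Kcomb D A) = Kcomb D (zscale A) + phin (colsum A).
Proof.
rewrite !KcombE linear_sum /= phin_sum -big_split; apply: eq_bigr => j _ /=.
rewrite L_gz; last exact: zpt_rho.
congr (_ + _); rewrite /lincomb scaler_sumr; apply: eq_bigr => s _.
by rewrite !mxE scalerA.
Qed.

(* Each application of L lowers the regularity by two and exposes the next
   moment, because no combination of the phi_s lies in H_{-m}. *)
Lemma Kcomb_moments n A : hl (- m%:Z + 2 * n%:Z) (Kcomb D A) ->
  forall i, (i < n)%N -> \sum_j zpt D j ^+ i *: col j A = 0.
Proof.
elim: n A => [//|n IH] A hA.
have hLA : hl (- m%:Z + 2 * n%:Z) (L (Kcomb D A)).
  have := hlev_L hS hA; congr (hl _ _); lia.
have cs0 : colsum A = 0.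
  apply: phin_lowest.
  have -> : phin (colsum A) = L (Kcomb D A) - Kcomb D (zscale A) by rewrite L_Kcomb addrC addKr.
  by apply: (subB (sl _)); [apply: (hlev_le hS) hLA; lia | apply: Kcomb_hl].
move: hLA; rewrite L_Kcomb cs0 lincomb0 addr0 => /IH {}IH [|i] hi.
  by rewrite -[RHS]cs0; apply: eq_bigr => j _; rewrite expr0 scale1r.
rewrite -[RHS](IH i) //; apply: eq_bigr => j _.
by apply/matrixP => s k; rewrite !mxE exprSr mulrA.
Qed.

Lemma moments_inj (n : nat) (B : 'M[C]_(n, m)) :
  (forall i, (i < m)%N -> \sum_j zpt D j ^+ i *: col j B = 0) -> B = 0.
Proof.
move=> h; pose W := (Vandermonde m (\row_j zpt D j))^T.
have uW : W \in unitmx.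
  rewrite unitmx_tr unitmxE unitfE det_Vandermonde.
  apply/prodf_neq0 => i _; apply/prodf_neq0 => j lt; rewrite !mxE subr_eq0.
  apply/eqP => /(standing_z_inj hD) e; by rewrite e ltnn in lt.
rewrite -[B](mulmxK uW); suff -> : B *m W = 0 by rewrite mul0mx.
apply/matrixP => s i; rewrite !mxE.
have := h i (ltn_ord i) => /matrixP /(_ s 0); rewrite summxE mxE => e.
by rewrite -[RHS]e; apply: eq_bigr => j _; rewrite !mxE mulrC.
Qed.

(** From H_{-m} to H_m there are m steps of two, giving as many vanishing moments as there are
    points z_j. *)
Lemma Kcomb_Hm A : H m (Kcomb D A) -> A = 0.
Proof.
move=> h; apply: moments_inj; apply: Kcomb_moments.
by have -> : - m%:Z + 2 * m%:Z = m%:Z by lia.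
Qed.

Lemma Kcomb_inj A B : Kcomb D A = Kcomb D B -> A = B.
Proof.
move=> e; apply/eqP; rewrite -subr_eq0; apply/eqP/Kcomb_Hm.
have -> : A - B = -1 *: B + A by rewrite scaleN1r addrC.
rewrite KcombZD e scaleN1r addNr; exact: sub0 (Hpos_sub hS m).
Qed.

Lemma Kcoef_Kcomb A : Kcoef D (Kcomb D A) = A.
Proof.
rewrite /Kcoef; case: xgetP => [B -> /Kcomb_inj //|/(_ A) []//].
Qed.

(** * Partial fractions and the vectors f_s *)

Definition PtLl (l : seq 'I_m) (x : X) := foldr (fun j y => L y - zpt D j *: y) x l.

Lemma PtLl_inj l x y : PtLl l x = PtLl l y -> x = y.
Proof. by elim: l => //= j l IH /(shift_eq hS (zpt_rho j)) /IH. Qed.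

Lemma PtLl_hl l (k : int) x : hl k (PtLl l x) -> hl (k + 2 * (size l)%:Z) x.
Proof.
elim: l k => [|j l IH] k /=; first by rewrite mulr0 addr0.
move=> /(hlev_resL hS (zpt_rho j)); rewrite (resL_shift hS); last exact: zpt_rho.
by move/IH; congr (hl _ _); lia.
Qed.

(* Partial fractions, by (L-z)^-1 (L-w)^-1 = ((L-z)^-1 - (L-w)^-1)/(z-w). *)
Lemma partial_fractions l : uniq l -> exists w : 'I_m -> C,
  forall y, l != [::] -> PtLl l (\sum_(j <- l) w j *: resL D (zpt D j) y) = y.
Proof.
elim: l => [_|j l IH]; first by exists (fun=> 0).
move=> /= /andP[nj /IH [w hw]].
(* The induction really starts at one point: over the empty list the sum is 0 while the product of
   shifts is the identity. *)
have [l0|ln] := eqVneq l [::].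
  exists (fun=> 1) => y _; rewrite l0 big_seq1 scale1r /=.
  by rewrite (shift_resL hS) //; exact: zpt_rho.
(* Each old term becomes a difference quotient of two resolvents; the weight at the new point
   collects all the subtracted halves. *)
exists (fun i => if i == j then - \sum_(k <- l) w k / (zpt D k - zpt D j)
                 else w i / (zpt D i - zpt D j)) => y _.
have zj := zpt_rho j.
suff -> : \sum_(i <- j :: l) (if i == j then - \sum_(k <- l) w k / (zpt D k - zpt D j)
      else w i / (zpt D i - zpt D j)) *: resL D (zpt D i) y
    = \sum_(i <- l) w i *: resL D (zpt D i) (resL D (zpt D j) y).
  by rewrite hw // (shift_resL hS).
rewrite big_cons eqxx scaleNr scaler_suml -sumrN -big_split !big_seq /=.
apply: eq_bigr => i il; have ne : i != j by apply: contraNneq nj => <-.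
rewrite (negbTE ne).
have zi := zpt_rho i.
have nz : zpt D i - zpt D j != 0 by rewrite subr_eq0 (inj_eq (standing_z_inj hD)).
apply: (shift_eq hS zi).
set p := resL _ _ y; set q := resL _ _ y; set r := resL _ _ p.
have e1 : L p = y + zpt D j *: p by exact: (L_resL hS).
have e2 : L q = y + zpt D i *: q by exact: (L_resL hS).
have e3 : L r = p + zpt D i *: r by exact: (L_resL hS).
rewrite linearD linearN !linearZ /= e1 e2 e3; lmod_with (R[i]); field => //.
Qed.

Context (hm : (2 <= m)%N) (hd : (1 <= d)%N).

(** The weights are the residues of 1/Ptilde and do not depend on s, so the coefficient matrix of
    k_min(c) is the product of the column c and the row w. *)
Lemma fs_partial : exists w : 'rV[C]_m, forall s, fs D s = Kcomb D (delta_mx s 0 *m w).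
Proof.
have [w hw] := partial_fractions (enum_uniq 'I_m).
have ne : enum 'I_m != [::].
  by rewrite -size_eq0 size_enum_ord; case: m hm.
exists (\row_j w j) => s.
have e : PtL D (Kcomb D (delta_mx s 0 *m \row_j w j)) = phi D s.
  rewrite -[RHS](hw _ ne) -/(PtLl (enum 'I_m) _); congr PtLl.
  rewrite KcombE big_enum /=; apply: eq_bigr => j _.
  rewrite /lincomb (bigD1 s) //= big1 ?addr0.
    by rewrite !mxE big_ord1 !mxE !eqxx mul1r.
  by move=> k ne'; rewrite !mxE big_ord1 !mxE (negbTE ne') mul0r scale0r.
rewrite /fs /inv_on; case: xgetP => [y -> [_ ey]|/(_ _ (conj I e)) //].
by apply: (@PtLl_inj (enum 'I_m)); rewrite -[LHS]/(PtL D _) ey -e.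
Qed.

Lemma PtL_fs s : PtL D (fs D s) = phi D s.
Proof.
have [w hw] := partial_fractions (enum_uniq 'I_m).
rewrite /fs /inv_on; case: xgetP => [y -> [_ ey] //|].
have ne : enum 'I_m != [::] by rewrite -size_eq0 size_enum_ord; case: m hm.
by move=> /(_ _ (conj I (hw (phi D s) ne))).
Qed.

Lemma fs_hl s : hl (m%:Z - 2) (fs D s).
Proof.
have := @PtLl_hl (enum 'I_m) (- m.+2%:Z) (fs D s).
rewrite -[PtLl _ _]/(PtL D _) PtL_fs size_enum_ord.
have -> : - m.+2%:Z + 2 * m%:Z = m%:Z - 2 by lia.
by apply; rewrite hlevN //; apply: phi_lev.
Qed.

Lemma kmin_hl c : hl (m%:Z - 2) (kmin D c).
Proof. by apply: (sub_sum (sl _)) => s _; apply: (subZ (sl _)); apply: fs_hl. Qed.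

Lemma kmin_partial : exists w : 'rV[C]_m, forall c, kmin D c = Kcomb D (c *m w).
Proof.
have [w hw] := fs_partial; exists w => c.
rewrite {2}(lincombE_id c) /kmin.
have -> : lincomb (fun s => delta_mx s 0) c *m w = \sum_s c s 0 *: (delta_mx s 0 *m w).
  rewrite /lincomb mulmx_suml; apply: eq_bigr => s _.
  by rewrite -scalemxAl.
rewrite /lincomb.
elim: (index_enum _) => [|s r IH]; first by rewrite !big_nil Kcomb0.
by rewrite !big_cons KcombZD IH hw.
Qed.

(** Ptilde(L) takes k_min(c) to phi(c). *)
Lemma kmin_eq0 c : kmin D c = 0 -> c = 0.
Proof.
move=> k0; apply: (standing_indep hD); rewrite -(_ : PtL D (kmin D c) = phin c).
  rewrite k0 /PtL; elim: (enum _) => //= j l ->.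
  by rewrite linear0 scaler0 subrr.
have -> : phin c = lincomb (fun s => PtL D (fs D s)) c.
  by apply: eq_bigr => s _; rewrite PtL_fs.
apply: lincomb_linear => a x y; rewrite /PtL.
elim: (enum _) => //= j l ->; rewrite (linearP L); lmod.
Qed.

(* The first m-1 moments of k in K vanish exactly when k is in H_{m-2}; they
   determine the coefficients up to multiples of the residues of 1/Ptilde. *)
Lemma Kcomb_kmin A : hl (m%:Z - 2) (Kcomb D A) -> exists c, Kcomb D A = kmin D c.
Proof.
have [w hw] := kmin_partial.
have e2 : - m%:Z + 2 * m.-1%:Z = m%:Z - 2 by lia.
rewrite -e2 => /Kcomb_moments mA.
(* The moments of w vanish below m - 1, since k_min takes values in H_{m-2}; the one of order m - 1
   does not, since otherwise w = 0 and k_min = 0. *)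
pose nu i := \sum_j zpt D j ^+ i * w 0 j.
have mom c i : \sum_j zpt D j ^+ i *: col j (c *m w) = nu i *: c.
  apply/matrixP => s k; rewrite summxE !mxE mulr_suml; apply: eq_bigr => j _.
  by rewrite !mxE big_ord1 !ord1; ring.
pose s0 : 'I_d := Ordinal hd.
have nu0 i : (i < m.-1)%N -> nu i = 0.
  move=> hi; have := kmin_hl (delta_mx s0 0); rewrite hw -e2.
  move=> /Kcomb_moments /(_ i hi); rewrite mom => /matrixP /(_ s0 0).
  by rewrite !mxE !eqxx mulr1.
have nun : nu m.-1 != 0.
  apply/eqP => n0; have w0 : w = 0.
    apply: moments_inj => i hi.
    apply/matrixP => s k; rewrite summxE !mxE.
    have -> : \sum_j (zpt D j ^+ i *: col j w) s k = nu i.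
      by apply: eq_bigr => j _; rewrite !mxE !ord1.
    have [lt|ge] := ltnP i m.-1; first exact: nu0.
    by have -> : i = m.-1 by lia.
  have := kmin_eq0 (c := delta_mx s0 0); rewrite hw w0 mulmx0 Kcomb0 => /(_ erefl).
  by move/matrixP/(_ s0 0)/eqP; rewrite !mxE !eqxx oner_eq0.
(* The c for which c w has the same moment of order m - 1 as A; the lower moments of both are
   zero. *)
exists ((nu m.-1)^-1 *: \sum_j zpt D j ^+ m.-1 *: col j A).
rewrite hw; congr Kcomb; apply/eqP; rewrite -subr_eq0; apply/eqP/moments_inj => i hi.
set c := _ *: _.
have -> : \sum_j zpt D j ^+ i *: col j (A - c *m w)
  = \sum_j zpt D j ^+ i *: col j A - nu i *: c.
  rewrite -mom -sumrB; apply: eq_bigr => j _; rewrite -scalerBr; congr (_ *: _).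
  by apply/matrixP => s k; rewrite !mxE.
have [lt|ge] := ltnP i m.-1; first by rewrite mA // nu0 // scale0r subr0.
have -> : i = m.-1 by lia.
by rewrite /c scalerA divff // scale1r subrr.
Qed.
End Model.

(** * Defect elements and the function R *)

Lemma sum_mxvec_index {R : nmodType} {d m : nat} (F : 'I_(d * m) -> R) :
  \sum_i F i = \sum_s \sum_j F (mxvec_index s j).
Proof.
rewrite pair_bigA /= (reindex _ (curry_mxvec_bij d m)).
by apply: eq_bigr => -[s j].
Qed.

Section DefectElements.
Context {R : realType} {X : lmodType R[i]} {m d : nat} (D : model X m d)
  (hD : standing D).
Local Notation C := R[i].
Local Notation L := (sL D).
Local Notation CV := 'cV[C]_d.
Local Notation phin := (lincomb (phi D)).
Local Notation H m := (Hpos D m).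
Local Notation hl := (hlev D).
Implicit Types (c b a : CV) (z w : C) (A B : 'M[C]_(d, m)).

Let hS : is_scale D := standing_scale hD.
Let pHm : preh (H m) := Hpos_preh hS m.
Let sH n : linsubspace (H n) := Hpos_sub hS n.

Lemma PLinv_PL x : PLinv D (PL D x) = x.
Proof.
rewrite /PLinv /inv_on; case: xgetP => [y -> [_]|/(_ x) []//].
rewrite /PL => e; apply/eqP; rewrite -subr_eq0; apply/eqP.
apply: (Om_injX hS (n := m)); apply: (Om_injX hS (n := m)).
by rewrite !linearB /= e subrr.
Qed.

Lemma Gs_spec z s : rhoL D z -> H m (Gs D z s) /\ PL D (Gs D z s) = gs D z s.
Proof.
move=> hz; have := gz_hl hD (delta_mx s 0) hz; rewrite hlevN // lincomb_delta.
move=> /(Om_neg_surj hS) [u hu e]; have [g hg eg] := Om_surj hS m hu.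
have -> : Gs D z s = g by rewrite /Gs -e -eg -/(PL D g) PLinv_PL.
by rewrite /PL eg.
Qed.

Lemma Gz_H z c : rhoL D z -> H m (Gz D z c).
Proof.
move=> hz; apply: (sub_sum (sH m)) => s _.
by apply: (subZ (sH m)); have [] := Gs_spec s hz.
Qed.

Lemma PL_Gz z c : rhoL D z -> PL D (Gz D z c) = lincomb (gs D z) c.
Proof.
move=> hz; rewrite /Gz (lincomb_linear (f := PL D)); last first.
  by move=> a x y; rewrite /PL !linearP.
by apply: eq_bigr => s _; have [_ ->] := Gs_spec s hz.
Qed.

Lemma L_Gz z c : rhoL D z -> L (Gz D z c) = z *: Gz D z c + lincomb (es D) c.
Proof.
move=> hz.
have es_E s : L (Gs D z s) = z *: Gs D z s + es D s.
  have [hG eG] := Gs_spec s hz.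
  rewrite -[LHS](subrK (z *: Gs D z s)) addrC; congr (_ + _).
  rewrite -[LHS]PLinv_PL /es; congr PLinv.
  have -> : PL D (L (Gs D z s) - z *: Gs D z s) = L (PL D (Gs D z s)) - z *: PL D (Gs D z s).
    by rewrite /PL !linearB !linearZ /= !(scale_Om_L hS).
  by rewrite eG (shift_resL hS).
rewrite /Gz (lincomb_linear (f := L)); last by move=> a x y; rewrite linearP.
rewrite /lincomb scaler_sumr -big_split; apply: eq_bigr => s _ /=.
by rewrite es_E scalerDr !scalerA mulrC.
Qed.

Lemma es_kmin c : lincomb (es D) (Cmx D *m c) = kmin D c.
Proof.
rewrite /kmin /lincomb.
under [RHS]eq_bigr do rewrite (standing_fs hD) scaler_sumr.
rewrite exchange_big; apply: eq_bigr => s _ /=.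
rewrite mxE scaler_suml; apply: eq_bigr => j _.
by rewrite scalerA mulrC.
Qed.

Lemma L_Gtz z c : rhoL D z -> L (Gtz D z c) = z *: Gtz D z c + kmin D c.
Proof. by move=> hz; rewrite /Gtz L_Gz // es_kmin. Qed.

Lemma GzD z (k : C) b c : Gz D z (k *: b + c) = k *: Gz D z b + Gz D z c.
Proof. exact: lincombD. Qed.

Lemma GtzD z (k : C) b c : Gtz D z (k *: b + c) = k *: Gtz D z b + Gtz D z c.
Proof. by rewrite /Gtz mulmxDr -scalemxAr GzD. Qed.

Lemma hip_Gz z c f : rhoL D z -> H m f ->
  hip (H m) (Gz D z c) f = spair D (lincomb (gs D z) c) f.
Proof.
move=> hz hf; rewrite -PL_Gz // /PL (pair_Om hS) //.
by apply: (Om_H0 hS); exact: Gz_H.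
Qed.

(** P(L) = Omega_m^2 is isometric from H_m to H_{-m} and takes G_z to g_z. Scalar products in K thus
    become scalar products of defect vectors, which R computes. *)
Lemma ipm_gz z w b c : rhoL D z -> rhoL D w ->
  ipm D (lincomb (gs D w) b) (lincomb (gs D z) c) = hip (H m) (Gz D w b) (Gz D z c).
Proof.
move=> hz hw; rewrite /ipm -!PL_Gz // (hip_Hneg hS) //; apply: (Om_H0 hS); exact: Gz_H.
Qed.

(** In the pairing with g_z(c) the operator L - conj z moves to the left, where (L - z) g_z(c) =
    phi(c). *)
Lemma hip_Gz_shift z c f : rhoL D z -> H m.+2 f ->
  hip (H m) (Gz D z c) (L f - Num.conj z *: f) = cdot c (phipair D f).
Proof.
move=> hz hf; have hfm := H_m hf; have hLf := L_Hpos hS hf.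
have hg : sneg D m (lincomb (gs D z) c) by rewrite -hlevN //; apply: gz_hl.
rewrite hip_Gz //; last exact: Hshift.
rewrite (pair_Br hS hg) //; last exact: (subZ (sH m)).
rewrite (pair_Zr hS _ hg) // -(pair_Zl hS _ hg) // -(pair_L hS hg) //.
have h2 x : sneg D m x -> sneg D m.+2 x.
  by move=> /(scale_neg_incl hS) /(scale_neg_incl hS).
rewrite (L_gz hD) // (scale_pair_conj hS _ (h2 _ hg) (phin_lev hD c) hf).
by rewrite (pair_Zl hS _ hg) // addrC addKr (pair_phin hD).
Qed.

(** * The continued functionals and the identities for R *)

Definition phih (f : X) : CV := \col_s phic D s f.

Lemma phihD (k : C) f g : H m f -> H m g -> phih (k *: f + g) = k *: phih f + phih g.
Proof.
by move=> hf hg; apply/matrixP => s j; rewrite !mxE; apply: (standing_phic_linear hD).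
Qed.

Lemma phih0 : phih 0 = 0.
Proof.
have h0 := sub0 (sH m); have := phihD (-1) h0 h0.
by rewrite scaler0 addr0 scaleN1r addNr.
Qed.

Lemma phihB f g : H m f -> H m g -> phih (f - g) = phih f - phih g.
Proof. by move=> hf hg; rewrite addrC -scaleN1r phihD // scaleN1r addrC. Qed.

Lemma phihE f : H m.+2 f -> phih f = phipair D f.
Proof. by move=> hf; apply/matrixP => s j; rewrite !mxE (standing_phic_ext hD). Qed.

Lemma Rmx_phih z c : rhoL D z -> Rmx D z *m c = phih (Gz D z c).
Proof.
move=> hz; apply/matrixP => s j; rewrite ord1 !mxE /Gz /lincomb.
have lin := standing_phic_linear hD s.
have h0 := sub0 (sH m).
have key (r : seq 'I_d) : H m (\sum_(k <- r) c k 0 *: Gs D z k) /\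
   phic D s (\sum_(k <- r) c k 0 *: Gs D z k) = \sum_(k <- r) c k 0 * phic D s (Gs D z k).
  elim: r => [|k r [IH1 IH2]].
    rewrite !big_nil; split=> //; have := phih0 => /matrixP /(_ s 0).
    by rewrite !mxE.
  have [hk _] := Gs_spec k hz.
  by rewrite !big_cons; split; [exact: (subZD (sH m))|rewrite lin // IH2].
have [_ ->] := key (index_enum 'I_d); apply: eq_bigr => k _.
by rewrite mxE mulrC.
Qed.

Lemma H_regular z f : rhoL D z -> H m f -> H m (L f - z *: f) -> H m.+2 f.
Proof.
move=> hz hf h; have [g hg e] := shift_surj_pos hS hz h.
by rewrite (shift_eq hS hz (esym e)).
Qed.

Lemma Gz_shift z w c : rhoL D z -> rhoL D w ->
  L (Gz D z c - Gz D w c) - z *: (Gz D z c - Gz D w c) = (z - w) *: Gz D w c.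
Proof.
move=> hz hw; rewrite (linearB L) /= !L_Gz //; lmod.
Qed.

Lemma Gz_diff z w c : rhoL D z -> rhoL D w -> H m.+2 (Gz D z c - Gz D w c).
Proof.
move=> hz hw; apply: (H_regular hz).
  by apply: (subB (sH m)); exact: Gz_H.
by rewrite Gz_shift //; apply: (subZ (sH m)); exact: Gz_H.
Qed.

(** G_z(c) - G_w(c) lies in H_{m+2}, where the continuation is the original pairing; there
    [hip_Gz_shift] and (L - z)(G_z - G_w) = (z - w) G_w apply. *)
Lemma Rmx_diff z w b c : rhoL D z -> rhoL D w ->
  cdot b (Rmx D z *m c) - cdot b (Rmx D w *m c)
  = (z - w) * hip (H m) (Gz D (Num.conj z) b) (Gz D w c).
Proof.
move=> hz hw; have hz' := rhoL_conj hS hz.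
have hG1 := Gz_H b hz'; have hG2 := Gz_H c hw.
rewrite !Rmx_phih // -cdotBr -phihB; [|exact: Gz_H|exact: Gz_H].
rewrite phihE; last exact: Gz_diff.
rewrite -(hip_Gz_shift (z := Num.conj z)) //; last exact: Gz_diff.
by rewrite conjCK Gz_shift // hipZr.
Qed.

(** For nonreal w this is the symmetry of a Nevanlinna function. For real w in the resolvent set,
    R(w) is compared by [Rmx_diff] with R(i) and R(-i), whose adjoints are known. *)
Lemma Rmx_adj w b c : rhoL D w ->
  cdot b (Rmx D (Num.conj w) *m c) = cdot (Rmx D w *m b) c.
Proof.
move=> hw; have [re|nz] := eqVneq (complex.Im w) 0; last first.
  have [_ <- _] := standing_R hD nz.
  by rewrite cdot_adjr.
have ew := conj_Im0 re; rewrite ew.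
pose z : C := 'i; have nz : complex.Im z != 0 by apply: oner_neq0.
have hz := rhoL_nonreal hS nz; have hz' := rhoL_conj hS hz.
have [_ ez _] := standing_R hD nz.
have h1 := Rmx_diff c b hz hw.
have h2 := Rmx_diff b c hw hz'.
rewrite ew in h2.
have h3 : cdot (Rmx D z *m b) c = cdot b (Rmx D (Num.conj z) *m c).
  by rewrite -ez cdot_adjr.
have hG1 := Gz_H b hw; have hG2 := Gz_H c hz'.
have h4 : Num.conj (cdot c (Rmx D z *m b) - cdot c (Rmx D w *m b))
   = (Num.conj z - w) * hip (H m) (Gz D w b) (Gz D (Num.conj z) c).
  by rewrite h1 conjM conjB ew -(preh_sym pHm hG2 hG1).
rewrite conjB !cdot_conj h3 in h4.
have : cdot b (Rmx D w *m c) - cdot b (Rmx D (Num.conj z) *m c)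
  = - (cdot b (Rmx D (Num.conj z) *m c) - cdot (Rmx D w *m b) c).
  by rewrite h2 h4; ring.
by move=> e; apply/eqP; rewrite -subr_eq0 -(addrNK (cdot b (Rmx D (Num.conj z) *m c))
  (cdot b (Rmx D w *m c))) e; apply/eqP; ring.
Qed.

Lemma hip_Gz_Gz z w b c : rhoL D z -> rhoL D w ->
  (z - Num.conj w) * hip (H m) (Gz D w b) (Gz D z c)
  = cdot b (Rmx D z *m c) - cdot (Rmx D w *m b) c.
Proof.
move=> hz hw; rewrite -Rmx_adj //.
have := Rmx_diff b c (rhoL_conj hS hw) hz; rewrite conjCK => e.
have -> : (z - Num.conj w) * hip (H m) (Gz D w b) (Gz D z c)
  = - ((Num.conj w - z) * hip (H m) (Gz D w b) (Gz D z c)) by ring.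
by rewrite -e; ring.
Qed.

Lemma Gz_inj z c : rhoL D z -> Gz D z c = 0 -> c = 0.
Proof.
move=> hz e; apply: (standing_indep hD).
have g0 : lincomb (gs D z) c = 0 by rewrite -PL_Gz // e /PL !linear0.
by have := L_gz hD c hz; rewrite g0 linear0 scaler0 add0r.
Qed.

(** * The form of l and the coefficient maps on K *)

Lemma lop_Kcomb A : lop D (Kcomb D A) = Kcomb D (zscale D A).
Proof.
by rewrite /lop (Kcoef_Kcomb hD).
Qed.

Let pN : preh (Hneg D m) := Hneg_preh hS m.

Lemma Kcomb_neg A : Hneg D m (Kcomb D A).
Proof. by have := Kcomb_hl hD A; rewrite hlevN. Qed.

Definition Rsum A : CV := \sum_j Rmx D (zpt D j) *m col j A.

Lemma cdot_sumr (I : Type) (r : seq I) (F : I -> CV) x :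
  cdot x (\sum_(j <- r) F j) = \sum_(j <- r) cdot x (F j).
Proof. by apply: (hip_sumr (@Cspace_preh R d)). Qed.
Lemma cdot_suml (I : Type) (r : seq I) (F : I -> CV) x :
  cdot (\sum_(j <- r) F j) x = \sum_(j <- r) cdot (F j) x.
Proof. by apply: (hip_suml (@Cspace_preh R d)). Qed.

(** Termwise this is [hip_Gz_Gz], since l contributes z_k on the right and conj z_j on the left. For
    A = B the right side is 2i Im <c(k), M d(k)>, so K_max consists of the k for which <k, l k> is
    real. *)
Lemma lop_form A B :
  ipm D (Kcomb D A) (lop D (Kcomb D B)) - ipm D (lop D (Kcomb D A)) (Kcomb D B)
  = cdot (colsum A) (Rsum B) - cdot (Rsum A) (colsum B).
Proof.
have gN j c : Hneg D m (lincomb (gs D (zpt D j)) c).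
  by have := gz_hl hD c (zpt_rho hD j); rewrite hlevN.
have expand A1 B1 : ipm D (Kcomb D A1) (Kcomb D B1) = \sum_j \sum_k
   ipm D (lincomb (gs D (zpt D j)) (col j A1)) (lincomb (gs D (zpt D k)) (col k B1)).
  rewrite /ipm {1}KcombE (hip_suml pN) //; last exact: Kcomb_neg.
  by apply: eq_bigr => j _; rewrite KcombE (hip_sumr pN).
have colz j A1 : lincomb (gs D (zpt D j)) (col j (zscale D A1))
    = zpt D j *: lincomb (gs D (zpt D j)) (col j A1).
  rewrite /lincomb scaler_sumr; apply: eq_bigr => s _.
  by rewrite !mxE scalerA.
rewrite !lop_Kcomb !expand -sumrB.
have -> : cdot (colsum A) (Rsum B) - cdot (Rsum A) (colsum B) =
  \sum_j \sum_k (cdot (col j A) (Rmx D (zpt D k) *m col k B)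
                 - cdot (Rmx D (zpt D j) *m col j A) (col k B)).
  rewrite /colsum /Rsum !cdot_suml -sumrB; apply: eq_bigr => j _.
  by rewrite !cdot_sumr -sumrB.
apply: eq_bigr => j _; rewrite -sumrB; apply: eq_bigr => k _.
have zj := zpt_rho hD j; have zk := zpt_rho hD k.
rewrite !colz -hip_Gz_Gz // -ipm_gz //.
have e1 := hipZr pN (zpt D k) (gN j (col j A)) (gN k (col k B)).
have e2 := hipZl pN (zpt D j) (gN j (col j A)) (gN k (col k B)).
by rewrite /ipm e1 e2; ring.
Qed.

Lemma dcoef_Kcomb A s j : dcoef D (Kcomb D A) (mxvec_index s j) 0 = A s j.
Proof. by rewrite /dcoef mxE (Kcoef_Kcomb hD) mxvecE. Qed.

Lemma ccoef_Kcomb A : ccoef D (Kcomb D A) = colsum A.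
Proof.
apply/matrixP => s k; rewrite mxE /colsum summxE; apply: eq_bigr => j _.
by rewrite dcoef_Kcomb mxE.
Qed.

Lemma Mmx_dcoef A : Mmx D *m dcoef D (Kcomb D A) = Rsum A.
Proof.
apply/matrixP => s k; rewrite ord1 mxE sum_mxvec_index /Rsum summxE exchange_big /=.
apply: eq_bigr => j _; rewrite mxE; apply: eq_bigr => s' _.
by rewrite dcoef_Kcomb [col j A _ _]mxE /Mmx mxE mxvecE mxE.
Qed.

Context (hm : (2 <= m)%N) (hd : (1 <= d)%N).

Lemma kmin_neg c : Hneg D m (kmin D c).
Proof.
have := kmin_hl hD hm hd c => /(hlev_le hS (j := - m%:Z)); rewrite hlevN //; apply; lia.
Qed.

Lemma fs_neg s : Hneg D m (fs D s).
Proof. by have := kmin_neg (delta_mx s 0); rewrite /kmin lincomb_delta. Qed.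

Lemma Gb_dcoef A : adjmx (Gb D) *m dcoef D (Kcomb D A) = \col_s ipm D (fs D s) (Kcomb D A).
Proof.
apply/matrixP => s k; rewrite ord1 !mxE sum_mxvec_index /Kcomb.
have gN s' j : Hneg D m (gs D (zpt D j) s').
  by have := gz_hl hD (delta_mx s' 0) (zpt_rho hD j); rewrite hlevN // lincomb_delta.
have N0 := preh_sub pN.
rewrite /ipm (hip_sumr pN); [|exact: fs_neg|]; last first.
  by move=> s'; apply: (sub_sum N0) => j _; apply: (subZ N0).
apply: eq_bigr => s' _; rewrite (hip_sumr pN); [|exact: fs_neg|]; last first.
  by move=> j; apply: (subZ N0).
apply: eq_bigr => j _; rewrite (hipZr pN) //; last exact: fs_neg.
rewrite -/(Kcomb D A) dcoef_Kcomb mulrC; congr (_ * _).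
rewrite !mxE mxvecE mxE /ipm -(preh_sym pN) //; exact: fs_neg.
Qed.

(** The K-part of Gamma_1 is, up to sign, the adjoint of k_min; this is what balances k_min in
    Green's identity. *)
Lemma cdot_Gb A c : cdot c (adjmx (Gb D) *m dcoef D (Kcomb D A)) = ipm D (kmin D c) (Kcomb D A).
Proof.
rewrite Gb_dcoef /kmin /ipm /lincomb (hip_suml pN); last first.
- by move=> s; apply: (subZ (preh_sub pN)); exact: fs_neg.
- exact: Kcomb_neg.
apply: eq_bigr => s _; rewrite mxE (hipZl pN) //; [exact: fs_neg|exact: Kcomb_neg].
Qed.
End DefectElements.

(** * The exit subspace *)

Section ExitSpace.
Context {R : realType} {X : lmodType R[i]} {m d : nat} (D : model X m d)
  (hD : standing D) (hm : (2 <= m)%N) (hd : (1 <= d)%N)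
  (K1 : set X) (hK1 : linsubspace K1)
  (hK1min : Kmin D `<=` K1) (hK1max : K1 `<=` Kmax D).
Local Notation C := R[i].
Local Notation L := (sL D).
Local Notation CV := 'cV[C]_d.
Local Notation phin := (lincomb (phi D)).
Local Notation H m := (Hpos D m).
Local Notation hl := (hlev D).
Implicit Types (c b : CV) (z : C) (A B : 'M[C]_(d, m)).

Let hS : is_scale D := standing_scale hD.
Let pHm : preh (H m) := Hpos_preh hS m.
Let sH n : linsubspace (H n) := Hpos_sub hS n.
Let pN : preh (Hneg D m) := Hneg_preh hS m.

Lemma Kspace_Kcomb A : Kspace D (Kcomb D A). Proof. by exists A. Qed.

Lemma Kspace_preh : preh (Kspace D).
Proof.
have N : forall x, Kspace D x -> Hneg D m x.
  by move=> _ [A _ <-]; exact: Kcomb_neg.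
split.
- split; first by exists 0 => //; exact: Kcomb0.
  by move=> a _ _ [A _ <-] [B _ <-]; exists (a *: A + B) => //; rewrite KcombZD.
- by move=> a x y z /N hx /N hy /N hz; apply: (preh_linr pN).
- by move=> x y /N hx /N hy; apply: (preh_sym pN).
- by move=> x /N hx; apply: (preh_ge0 pN).
- by move=> x /N hx; apply: (preh_def pN).
Qed.
Let pK := Kspace_preh.

Lemma K1_K k : K1 k -> Kspace D k. Proof. by move/hK1max => []. Qed.

Lemma kmin_Kspace c : Kspace D (kmin D c).
Proof. by have [w ->] := kmin_partial hD hm; exists (c *m w). Qed.

Lemma kmin_K1 c : K1 (kmin D c).
Proof.
apply: hK1min; split; first exact: kmin_Kspace.
have := kmin_hl hD hm hd c; have -> : m%:Z - 2 = (m - 2)%N%:Z by lia.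
by [].
Qed.

Lemma K1space_preh : preh (K1space D K1).
Proof.
split=> //.
- by move=> a x y z /K1_K hx /K1_K hy /K1_K hz; apply: (preh_linr pK).
- by move=> x y /K1_K hx /K1_K hy; apply: (preh_sym pK).
- by move=> x /K1_K hx; apply: (preh_ge0 pK).
- by move=> x /K1_K hx; apply: (preh_def pK).
Qed.
Let p1 := K1space_preh.

Lemma lop_K k : Kspace D k -> Kspace D (lop D k).
Proof. by move=> [A _ <-]; rewrite (lop_Kcomb hD); exact: Kspace_Kcomb. Qed.

Lemma lopD (a : C) x y : Kspace D x -> Kspace D y ->
  lop D (a *: x + y) = a *: lop D x + lop D y.
Proof.
move=> [A _ <-] [B _ <-]; rewrite -KcombZD !(lop_Kcomb hD) -KcombZD; congr Kcomb.
by apply/matrixP => s j; rewrite !mxE; ring.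
Qed.

(* By polarization: the skew-Hermitian form of l vanishes on the diagonal of
   K_max, hence on any linear subspace of it. *)
Lemma lop_symmetric x y : K1 x -> K1 y -> ipm D x (lop D y) = ipm D (lop D x) y.
Proof.
pose B x y := ipm D x (lop D y) - ipm D (lop D x) y.
have diag k : K1 k -> B k k = 0.
  move=> /hK1max [[A _ <-]]; rewrite /B (lop_form hD) (ccoef_Kcomb hD) (Mmx_dcoef hD) => e.
  by rewrite -[cdot (Rsum _ _) _]cdot_conj (conj_Im0 e) subrr.
have BD t u v : K1 u -> K1 v -> B (t *: u + v) (t *: u + v)
    = B v v + t * B v u + Num.conj t * B u v + Num.conj t * t * B u u.
  move=> /K1_K hu /K1_K hv; have hlu := lop_K hu; have hlv := lop_K hv.
  rewrite /B lopD // /ipm -!/(hip (Kspace D) _ _).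
  have mem1 : Kspace D (t *: u) by emem.
  have mem2 : Kspace D (t *: lop D u) by emem.
  have mem3 : Kspace D (t *: u + v) by emem.
  have mem4 : Kspace D (t *: lop D u + lop D v) by emem.
  rewrite -![hip (Hneg D m)]/(hip (Kspace D)).
  rewrite (hipDl pK mem1 hv mem4) (hipDl pK mem2 hlv mem3).
  rewrite !(hipDr pK _ mem2 hlv) // !(hipDr pK _ mem1 hv) // !(hipZl pK) // !(hipZr pK) //.
  ring.
move=> hx hy; apply/eqP; rewrite -subr_eq0 -/(B x y); apply/eqP.
have h1 := BD 1 _ _ hx hy; have h2 := BD 'i _ _ hx hy.
rewrite !diag // in h1 h2; last 2 first.
- exact: (subZD hK1).
- exact: (subZD hK1).
rewrite !mulr0 !addr0 add0r conjC1 !mul1r in h1.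
rewrite !mulr0 !addr0 add0r in h2.
have e : B y x = - B x y by apply/eqP; rewrite -addr_eq0 -h1.
move: h2; rewrite e; have -> : Num.conj ('i : C) = - 'i by apply/eqP; rewrite eq_complex /= oppr0 !eqxx.
have -> : 'i * - B x y + - 'i * B x y = (- 2 * 'i) * B x y by ring.
move/esym/eqP; rewrite !mulf_eq0 => /orP[/orP[]|/eqP //].
- by rewrite oppr_eq0 pnatr_eq0.
- by rewrite eq_complex /= oner_eq0 andbF.
Qed.

Lemma in_span_K x : Kspace D x ->
  in_span (flatten [seq [seq gs D (zpt D j) s | j <- enum 'I_m] | s <- enum 'I_d]) x.
Proof.
move=> [A _ <-]; rewrite /Kcomb.
have -> : \sum_s \sum_j A s j *: gs D (zpt D j) s
  = \sum_(s <- enum 'I_d) \sum_(j <- enum 'I_m) A s j *: gs D (zpt D j) s.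
  by rewrite big_enum; apply: eq_bigr => s _; rewrite big_enum.
elim: (enum 'I_d) => [|s l IH]; first by rewrite big_nil.
rewrite big_cons /=; apply: in_span_cat => //.
elim: (enum 'I_m) => [|j l' IH'] /=; first by rewrite big_nil.
by exists (A s j); rewrite big_cons addrC addKr.
Qed.

Local Notation P := (oproj (Kspace D) K1).

Lemma oproj_spec x : Kspace D x ->
  K1 (P x) /\ forall w, K1 w -> hip (Kspace D) w (x - P x) = 0.
Proof.
move=> hx; have [p hp] := span_projection pK hK1 K1_K (fun x hx => in_span_K (K1_K hx)) hx.
by rewrite /oproj; case: xgetP => [q -> //|/(_ p)].
Qed.

Lemma proj_K1 x : Kspace D x -> K1 (P x). Proof. by move/oproj_spec => []. Qed.

Lemma proj_ip x w : Kspace D x -> K1 w -> ipm D w (P x) = ipm D w x.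
Proof.
move=> hx hw; have [h1 h2] := oproj_spec hx; have /eqP := h2 w hw.
have hP := K1_K h1; have hwK := K1_K hw.
by rewrite (hipBr pK) // subr_eq0 => /eqP.
Qed.

Lemma proj_eq x p : Kspace D x -> K1 p ->
  (forall w, K1 w -> ipm D w p = ipm D w x) -> P x = p.
Proof.
move=> hx hp h; have h1 := proj_K1 hx.
have hb : K1 (P x - p) by apply: (subB hK1).
apply/eqP; rewrite -subr_eq0; apply/eqP/(preh_def p1 hb).
have hPK := K1_K h1; have hpK := K1_K hp; have hbK := K1_K hb.
by rewrite -[hip _ _ _]/(hip (Kspace D) _ _) (hipBr pK) // -!/(ipm D _ _) [ipm D _ _]proj_ip //
  [X in _ - X]h // subrr.
Qed.

Lemma proj_id k : K1 k -> P k = k.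
Proof. by move=> hk; apply: proj_eq => //; exact: K1_K. Qed.

Lemma projD (a : C) x y : Kspace D x -> Kspace D y -> P (a *: x + y) = a *: P x + P y.
Proof.
move=> hx hy; have h1 := proj_K1 hx; have h2 := proj_K1 hy.
apply: proj_eq; [exact: (subZD (preh_sub pK))|exact: (subZD hK1)|] => w hw.
have k1 := K1_K h1; have k2 := K1_K h2; have kw := K1_K hw.
rewrite -![ipm D]/(hip (Kspace D)) !(preh_linr pK) //.
by congr (_ * _ + _); exact: proj_ip.
Qed.

(** * The operator l_1 and its resolvent *)

Definition l1f k := P (lop D k).

Lemma l1P k v : l1 D K1 (k, v) <-> K1 k /\ v = l1f k.
Proof. by split=> [[]|[h1 h2]]; [|split]. Qed.

Lemma l1f_K1 k : K1 k -> K1 (l1f k).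
Proof. by move=> hk; apply: proj_K1; apply: lop_K; exact: K1_K. Qed.

Lemma l1fD (a : C) x y : K1 x -> K1 y -> l1f (a *: x + y) = a *: l1f x + l1f y.
Proof.
by move=> hx hy; rewrite /l1f lopD ?projD //; try apply: lop_K; exact: K1_K.
Qed.

Lemma l1f0 : l1f 0 = 0.
Proof.
have h0 := sub0 hK1; have := l1fD (-1) h0 h0.
by rewrite scaler0 addr0 scaleN1r addNr.
Qed.

Lemma l1f_sym x y : K1 x -> K1 y -> ipm D x (l1f y) = ipm D (l1f x) y.
Proof.
move=> hx hy; have kx := K1_K hx; have ky := K1_K hy.
have lx := lop_K kx; have ly := lop_K ky.
rewrite /l1f proj_ip // lop_symmetric //.
have := preh_sym pK ky (K1_K (proj_K1 lx)); rewrite -!/(ipm D _ _) => ->.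
by rewrite [ipm D y _]proj_ip //; apply: (preh_sym pK).
Qed.

Local Notation reg1 := (rho (K1space D K1) (l1 D K1)).
Definition rl z k := rapp (resolvent (l1 D K1) z) k.

Lemma res_l1P z h u : resolvent (l1 D K1) z (h, u) <-> K1 u /\ l1f u = h + z *: u.
Proof. by rewrite resolventP l1P; split=> -[]. Qed.

Lemma res_l1 z h : reg1 z -> K1 h -> resolvent (l1 D K1) z (h, rl z h).
Proof.
move=> [sv dom _ _] hh; have [u hu] : rdom (resolvent (l1 D K1) z) h by rewrite dom.
by rewrite /rl /rapp; case: xgetP => [v -> //|/(_ u)].
Qed.

Lemma rl_eq z h u : reg1 z -> resolvent (l1 D K1) z (h, u) -> u = rl z h.
Proof.
move=> hz hu; have [sv dom _ _] := hz; apply: (sv _ _ _ hu); apply: res_l1 => //.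
by have : rdom (resolvent (l1 D K1) z) h; [exists u|rewrite dom].
Qed.

Lemma rl_K1 z h : reg1 z -> K1 h -> K1 (rl z h).
Proof. by move=> hz /(res_l1 hz) /res_l1P []. Qed.

Lemma l1f_rl z h : reg1 z -> K1 h -> l1f (rl z h) = h + z *: rl z h.
Proof. by move=> hz /(res_l1 hz) /res_l1P []. Qed.

Lemma l1f_inj z u : reg1 z -> K1 u -> l1f u = z *: u -> u = 0.
Proof.
move=> hz hu e; have [sv _ _ _] := hz.
apply: (sv 0); apply/res_l1P; rewrite ?add0r //.
by split; [exact: (sub0 hK1)|rewrite l1f0 scaler0].
Qed.

Lemma rlD z (a : C) x y : reg1 z -> K1 x -> K1 y ->
  rl z (a *: x + y) = a *: rl z x + rl z y.
Proof.
move=> hz hx hy; apply/esym/(rl_eq hz)/res_l1P.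
have r1 := rl_K1 hz hx; have r2 := rl_K1 hz hy.
split; first exact: (subZD hK1).
by rewrite l1fD // !l1f_rl //; lmod.
Qed.

(** The lower bound for a symmetric operator, as for L, but the range of l_1 - z is
    finite-dimensional and so has an orthogonal projection at once. *)
Lemma l1_nonreal_rho z : complex.Im z != 0 -> reg1 z.
Proof.
move=> nz.
have pz : 0 < `|complex.Im z| by rewrite normr_gt0.
have bd h u : K1 u -> l1f u = h + z *: u ->
    `|complex.Im z| * hnorm (K1space D K1) u <= hnorm (K1space D K1) h.
  move=> hu e; have hv := l1f_K1 hu.
  have real : complex.Im (hip (K1space D K1) u (l1f u)) = 0.
    apply: Im0_conj; rewrite -(preh_sym p1 hu hv); apply/esym; exact: l1f_sym.
  have := norm_ge_Im p1 z hu hv real.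
  by rewrite e addrK.
have inj w u : complex.Im w != 0 -> K1 u -> l1f u = w *: u -> u = 0.
  move=> nw hu e; have hv := l1f_K1 hu.
  have real : complex.Im (hip (K1space D K1) u (l1f u)) = 0.
    apply: Im0_conj; rewrite -(preh_sym p1 hu hv); apply/esym; exact: l1f_sym.
  have := norm_ge_Im p1 w hu hv real; rewrite e subrr (hnorm0 p1) => le0.
  apply: (hnorm_eq0 p1 hu); apply/eqP.
  have pw : 0 < `|complex.Im w| by rewrite normr_gt0.
  by rewrite eq_le hnorm_ge0 andbT -(ler_pM2l pw) mulr0.
split.
- move=> h u v /res_l1P [hu eu] /res_l1P [hv ev].
  apply/eqP; rewrite -subr_eq0; apply/eqP/(inj z) => //; first exact: (subB hK1).
  rewrite addrC -scaleN1r l1fD // eu ev; lmod.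
- apply/seteqP; split=> [h [u /res_l1P [hu e]]|h hh].
    have -> : h = - z *: u + l1f u by rewrite e; lmod.
    by apply: (subZD hK1) => //; exact: l1f_K1.
  pose S := [set y | exists u, K1 u /\ l1f u = y + z *: u].
  have sS : linsubspace S.
    split; first by exists 0; split; [exact: (sub0 hK1)|rewrite l1f0 scaler0 addr0].
    move=> k x y [u [hu eu]] [v [hv ev]]; exists (k *: u + v).
    by split; [exact: (subZD hK1)|rewrite l1fD // eu ev; lmod].
  have SE : S `<=` Kspace D.
    move=> y [u [hu e]]; have -> : y = - z *: u + l1f u by rewrite e; lmod.
    by apply: K1_K; apply: (subZD hK1) => //; exact: l1f_K1.
  have hk := K1_K hh.
  have [p [[u [hu eu]] hp]] := span_projection pK sS SE (fun x hx => in_span_K (SE _ hx)) hk.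
  exists u; apply/res_l1P; split=> //; rewrite eu; congr (_ + _).
  apply/eqP; rewrite eq_sym -subr_eq0; apply/eqP.
  have K1p : K1 p.
    have -> : p = - z *: u + l1f u by rewrite eu; lmod.
    by apply: (subZD hK1) => //; exact: l1f_K1.
  have K1q : K1 (h - p) by apply: (subB hK1).
  apply: (inj (Num.conj z)); rewrite ?Im_conj ?oppr_eq0 //.
  have lq := l1f_K1 K1q.
  have K1d : K1 (l1f (h - p) - Num.conj z *: (h - p)).
    by apply: (subB hK1) => //; exact: (subZ hK1).
  apply/eqP; rewrite -subr_eq0; apply/eqP/(preh_def p1 K1d).
  (* With q = h - p orthogonal to the range, <(l_1 - z) v, q> = 0. By symmetry this is <v, v> for v
     = (l_1 - conj z) q, so q is in the kernel of l_1 - conj z, which is zero. *)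
  set v := l1f (h - p) - _ in K1d *.
  have : S (l1f v - z *: v) by exists v; rewrite subrK.
  move/hp; have lv := l1f_K1 K1d; set q := h - p in K1q lq v K1d lv *.
  have kq := K1_K K1q; have kv := K1_K K1d; have klq := K1_K lq; have klv := K1_K lv.
  have kzv : Kspace D (z *: v) by emem.
  have kzq : Kspace D (Num.conj z *: q) by emem.
  rewrite (hipBl pK) // (hipZl pK) // => <-.
  have -> : hip (K1space D K1) v v = hip (Kspace D) v (l1f q - Num.conj z *: q) by [].
  rewrite (hipBr pK) // (hipZr pK) //; congr (_ - _); exact: l1f_sym.
- by move=> h u /res_l1P [].
- exists (`|complex.Im z|^-1) => h u /res_l1P [hu e].
  by rewrite ler_pdivlMl //; apply: bd.
Qed.

Lemma reg1_conj z : reg1 z -> reg1 (Num.conj z).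
Proof.
have [re|nz] := eqVneq (complex.Im z) 0; first by rewrite (conj_Im0 re).
by move=> _; apply: l1_nonreal_rho; rewrite Im_conj oppr_eq0.
Qed.

(** * The sum of H_m with the exit spaces *)

Lemma Hm_K x : H m x -> Kspace D x -> x = 0.
Proof.
by move=> h [A _ e]; rewrite -e in h *; rewrite (Kcomb_Hm hD h) Kcomb0.
Qed.

Lemma HK_eq f k f' k' : H m f -> Kspace D k -> H m f' -> Kspace D k' ->
  f + k = f' + k' -> f = f' /\ k = k'.
Proof.
move=> hf hk hf' hk' e; have e1 : f - f' = k' - k.
  by rewrite -[f](addrK k) e; lmod.
have z0 : f - f' = 0.
  by apply: Hm_K; [exact: (subB (sH m))|rewrite e1; exact: phB].
split; apply/eqP; first by rewrite -subr_eq0 z0.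
by rewrite eq_sym -subr_eq0 -e1 z0.
Qed.

Lemma componentsE f k : H m f -> Kspace D k ->
  components (H m) (Kspace D) (f + k) = (f, k).
Proof.
move=> hf hk; rewrite /components; case: xgetP => [[f' k'] _ [/= h1 h2 e]|/(_ (f, k)) []//].
by have [-> ->] := HK_eq hf hk h1 h2 e.
Qed.

Lemma hip_HK f k f' k' : H m f -> Kspace D k -> H m f' -> Kspace D k' ->
  hip (H1 D K1) (f + k) (f' + k') = hip (H m) f f' + ipm D k k'.
Proof. by move=> h1 h2 h3 h4; rewrite /= !componentsE. Qed.

Lemma H1_I f k : H m f -> K1 k -> H1 D K1 (f + k).
Proof. by move=> hf hk; exists f, k. Qed.

Lemma H1_preh : preh (H1 D K1).
Proof.
have e0 f f' k k' (a : C) : a *: (f + k) + (f' + k') = (a *: f + f') + (a *: k + k') :> X.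
  lmod.
split.
- split.
    exists 0, 0; split; [exact: (sub0 (sH m))|exact: (sub0 hK1)|by rewrite addr0].
  move=> a _ _ [f [k [hf hk ->]]] [f' [k' [hf' hk' ->]]]; rewrite e0.
  by apply: H1_I; [exact: (subZD (sH m))|exact: (subZD hK1)].
- move=> a _ _ _ [f [k [hf /K1_K hk ->]]] [f' [k' [hf' /K1_K hk' ->]]]
    [g [l [hg /K1_K hl ->]]].
  have h1 : H m (a *: f' + g) by exact: (subZD (sH m)).
  have h2 : Kspace D (a *: k' + l) by exact: (subZD (preh_sub pK)).
  rewrite e0 !hip_HK // (preh_linr pHm) // -![ipm D]/(hip (Kspace D)) (preh_linr pK) //.
  ring.
- move=> _ _ [f [k [hf /K1_K hk ->]]] [f' [k' [hf' /K1_K hk' ->]]].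
  by rewrite !hip_HK // (preh_sym pHm hf hf') conjD -![ipm D]/(hip (Kspace D)) (preh_sym pK hk hk').
- move=> _ [f [k [hf /K1_K hk ->]]]; rewrite hip_HK //.
  by rewrite addr_ge0 ?(preh_ge0 pHm) // (preh_ge0 pK).
- move=> _ [f [k [hf /K1_K hk ->]]]; rewrite hip_HK // => /eqP.
  have g1 := preh_ge0 pHm hf; have g2 : 0 <= ipm D k k by exact: (preh_ge0 pK).
  rewrite paddr_eq0 // => /andP[/eqP/(preh_def pHm hf) -> /eqP/(preh_def pK hk) ->].
  by rewrite addr0.
Qed.

Lemma oproj_H1 f k : H m f -> Kspace D k -> oproj (Hcal D) (H1 D K1) (f + k) = f + P k.
Proof.
move=> hf hk; have h1 := proj_K1 hk; have hPK := K1_K h1.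
have sp : H1 D K1 (f + P k) /\
    forall w, H1 D K1 w -> hip (Hcal D) w (f + k - (f + P k)) = 0.
  split; first exact: H1_I.
  move=> _ [g [l [hg hl1 ->]]].
  have -> : f + k - (f + P k) = 0 + (k - P k) by lmod.
  have hl := K1_K hl1; have hB : Kspace D (k - P k) by emem.
  rewrite -[hip _ _ _]/(hip (H1 D K1) _ _) hip_HK //; last exact: (sub0 (sH m)).
  rewrite (hip0r pHm) // add0r -[ipm D _ _]/(hip (Kspace D) _ _) (hipBr pK) //.
  by apply/eqP; rewrite subr_eq0; apply/eqP/esym; exact: proj_ip.
rewrite /oproj; case: xgetP => [v _ [H1v hv]|/(_ _ sp)] //.
have H1B : H1 D K1 (f + P k - v) := phB H1_preh (H1_I hf h1) H1v.
apply/esym/eqP; rewrite -subr_eq0; apply/eqP/(preh_def H1_preh H1B).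
have := hv _ H1B; have := sp.2 _ H1B.
case: H1v => g [l [hg hl1 ev]]; rewrite ev in H1B *.
have hl := K1_K hl1.
have -> : f + P k - (g + l) = (f - g) + (P k - l) by lmod.
have -> : f + k - (g + l) = (f - g) + (k - l) by lmod.
have -> : f + k - (f + P k) = 0 + (k - P k) by lmod.
have q1 : H m (f - g) by exact: (subB (sH m)).
have q2 : Kspace D (P k - l) by emem.
have q3 : Kspace D (k - l) by emem.
have q4 : Kspace D (k - P k) by emem.
have q0 := sub0 (sH m).
rewrite -![hip (Hcal D)]/(hip (H1 D K1)) !hip_HK // (hip0r pHm) // add0r.
have -> : k - l = (k - P k) + (P k - l) by lmod.
have := hipDr pK q2 q4 q2; rewrite -![hip (Kspace D)]/(ipm D) => -> ->.
by rewrite add0r.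
Qed.
End ExitSpace.

(** * The boundary triple of B_max *)

Section ExitTriple.
Context {R : realType} {X : lmodType R[i]} {m d : nat} (D : model X m d)
  (hD : standing D) (hm : (2 <= m)%N) (hd : (1 <= d)%N)
  (K1 : set X) (hK1 : linsubspace K1)
  (hK1min : Kmin D `<=` K1) (hK1max : K1 `<=` Kmax D).
Local Notation C := R[i].
Local Notation L := (sL D).
Local Notation CV := 'cV[C]_d.
Local Notation phin := (lincomb (phi D)).
Local Notation H m := (Hpos D m).
Local Notation hl := (hlev D).
Local Notation reg1 := (rho (K1space D K1) (l1 D K1)).
Local Notation l1f := (l1f D K1).
Local Notation rl := (rl D K1).
Implicit Types (c b : CV) (z : C) (A B : 'M[C]_(d, m)).

Let hS : is_scale D := standing_scale hD.
Let pHm : preh (H m) := Hpos_preh hS m.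
Let sH n : linsubspace (H n) := Hpos_sub hS n.
Let pK := Kspace_preh hD.
Let K1K := K1_K hK1max.

Lemma phipair_surj (x : CV) : exists2 g, H m.+2 g & phipair D g = x.
Proof.
pose S := [set y | exists2 g, H m.+2 g & phipair D g = y].
apply: (@subspace_full _ _ S).
- split; first exists 0; first exact: sub0 (sH _).
    by have h0 := sub0 (sH m.+2); have := phipairD hD (-1) h0 h0;
      rewrite scaler0 addr0 scaleN1r addNr.
  move=> a _ _ [f hf <-] [g hg <-]; exists (a *: f + g); first exact: (subZD (sH _)).
  exact: (phipairD hD).
- move=> y hy; apply: (standing_indep hD).
  apply: (scale_pair_inj hS (phin_lev hD y)) => f hf.
  by rewrite (pair_phin hD) // -cdot_conj hy ?conjC0 //; exists f.
Qed.

(** A functional vanishing on the common kernel of finitely many functionals is a combination of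
    them. The vectors g_s dual to the phi_s give the coefficients, conjugated because the pairing is
    conjugate-linear in its first argument. *)
Lemma annihilator (p : X) : sneg D m.+2 p ->
  (forall g, H m.+2 g -> phipair D g = 0 -> spair D p g = 0) ->
  exists c, p = phin c.
Proof.
move=> hp h0.
have [g hg] := choice (fun s : 'I_d =>
  let: ex_intro2 g h1 h2 := phipair_surj (delta_mx s 0) in
  ex_intro (fun g => H m.+2 g /\ phipair D g = delta_mx s 0) g (conj h1 h2)).
pose c : CV := \col_s Num.conj (spair D p (g s)); exists c.
apply/eqP; rewrite -subr_eq0; apply/eqP.
have hpc : sneg D m.+2 (p - phin c).
  by apply: (subB (scale_neg_sub hS _)) => //; exact: (phin_lev hD).
apply: (scale_pair_inj hS hpc) => f hf.
rewrite (pair_Bl hS hp (phin_lev hD c) hf) (pair_phin hD) //.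
have key (r : seq 'I_d) (x : CV) : [/\ H m.+2 (\sum_(s <- r) x s 0 *: g s),
   phipair D (\sum_(s <- r) x s 0 *: g s) = \sum_(s <- r) x s 0 *: delta_mx s 0 &
   spair D p (\sum_(s <- r) x s 0 *: g s) = \sum_(s <- r) x s 0 * spair D p (g s)].
  elim: r => [|s r [k1 k2 k3]].
    have h00 := sub0 (sH m.+2); rewrite !big_nil; split=> //.
    + by have := phipairD hD (-1) h00 h00; rewrite scaler0 addr0 scaleN1r addNr.
    + by have := pair_Zr hS 0 hp h00; rewrite scale0r mul0r.
  have [q1 q2] := hg s; rewrite !big_cons; split.
  + exact: (subZD (sH _)).
  + by rewrite (phipairD hD) // q2 k2.
  + by rewrite (pair_linr hS _ hp q1 k1) k3.
have [k1 k2 k3] := key (index_enum 'I_d) (phipair D f).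
set q := \sum_(s <- _) _ in k1 k2 k3.
have e2 : phipair D q = phipair D f by rewrite k2 [RHS]lincombE_id.
have := h0 (f - q); rewrite (pair_Br hS hp hf k1) k3 => e.
have : H m.+2 (f - q) by exact: (subB (sH _)).
move/e => {}e.
have ez : phipair D (f - q) = 0.
  by rewrite addrC -scaleN1r (phipairD hD) // e2 scaleN1r addNr.
move/eqP: (e ez); rewrite subr_eq0 => /eqP ->.
apply/eqP; rewrite subr_eq0; apply/eqP; rewrite /cdot.
by apply: eq_bigr => s _; rewrite [c s 0]mxE conjCK mulrC.
Qed.

Lemma L_lop k : Kspace D k -> exists b, L k = lop D k + phin b.
Proof.
by move=> [A _ <-]; exists (colsum A); rewrite (L_Kcomb hD) (lop_Kcomb hD).
Qed.

Lemma H_neg x : H m x -> sneg D m x.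
Proof.
move=> h; have : hl (- m%:Z) x; last by rewrite hlevN.
by apply: (hlev_le hS (k := m%:Z)); [lia|].
Qed.

Lemma K_neg x : Kspace D x -> sneg D m x.
Proof. by move=> [A _ <-]; exact: (Kcomb_neg hD). Qed.

Lemma Gtz_H z c : rhoL D z -> H m (Gtz D z c).
Proof. exact: (Gz_H hD). Qed.

Let kminK := kmin_Kspace hD hm.
Let kmin1 := kmin_K1 hD hm hd hK1min.

(** Applying the extended L to the first entry gives the second plus some phi(b), and phi(b)
    vanishes on dom L_min. *)
Lemma Amax_intro z f k c : rhoL D z -> H m.+2 f -> Kspace D k ->
  Amax D (f + Gtz D z c + k,
          (L f + z *: Gtz D z c) + (lop D k + kmin D c)).
Proof.
move=> hz hf hk; have hG := Gtz_H c hz; have hfm := H_m hf.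
have hLf := L_Hpos hS hf; have hlk := lop_K hD hk.
have h1 : H m (f + Gtz D z c) by exact: (subD (sH m)).
have h2 : H m (L f + z *: Gtz D z c) by apply: (subD (sH m)) => //; exact: (subZ (sH m)).
have h3 : Kspace D (lop D k + kmin D c) by apply: (phD pK) => //; exact: kminK.
have N := scale_neg_sub hS m.
split=> /=; [|by exists (f + Gtz D z c), k|by do 2!eexists; split; [exact: h2|exact: h3|]].
split=> /=.
- by apply: (subD N); [exact: H_neg|exact: K_neg].
- by apply: (subD N); [exact: H_neg|exact: K_neg].
- move=> g [w [e /= [hg pg]]].
  set u := f + _ + k; have hu : sneg D m u.
    by apply: (subD N); [exact: H_neg|exact: K_neg].
  rewrite -(pair_L hS hu hg).
  have [b eb] := L_lop hk.
  have -> : L u = (L f + z *: Gtz D z c) + (lop D k + kmin D c) + phin b.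
    by rewrite /u !(linearD L) /= (L_Gtz hD) // eb; lmod.
  set v := L f + _ + _.
  have hv : sneg D m.+2 v.
    by do 2!apply: (scale_neg_incl hS); apply: (subD N); [exact: H_neg|exact: K_neg].
  rewrite -[v in RHS]scale1r (scale_pair_conj hS 1 hv (phin_lev hD b) hg).
  by rewrite (pair_phin hD) // pg cdot0r addr0 conjC1 mul1r.
Qed.

(** v - L u annihilates dom L_min, hence is some phi(a). Comparing components gives k' - l k = L f_0
    - f' + phi(a + b). The other terms lie in H_{-m}, so a + b = 0; then k' - l k lies in both K and
    H_{m-2}, which makes it k_min(c). *)
Lemma Amax_elim z u v : rhoL D z -> Amax D (u, v) -> exists f k c,
  [/\ H m.+2 f, Kspace D k, u = f + Gtz D z c + k &
      v = (L f + z *: Gtz D z c) + (lop D k + kmin D c)].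
Proof.
move=> hz [[/= hu hv lm] [f0 [k [hf0 hk eu]]] [f' [k' [hf' hk' ev]]]].
rewrite /= in eu ev.
have hu2 : sneg D m.+2 (L u).
  have : hl (- m%:Z) u by rewrite hlevN.
  move/(hlev_L hS); have -> : - m%:Z - 2 = - m.+2%:Z by lia.
  by rewrite hlevN.
have [a ea] : exists c, v - L u = phin c.
  apply: annihilator.
    apply: (subB (scale_neg_sub hS _)) => //.
    by do 2!apply: (scale_neg_incl hS).
  move=> g hg pg.
  have hv2 : sneg D m.+2 v by do 2!apply: (scale_neg_incl hS).
  rewrite (pair_Bl hS hv2 hu2 hg) (pair_L hS hu hg) lm ?subrr //.
  by exists (L g).
have [b eb] := L_lop hk.
have e1 : k' - lop D k = L f0 - f' + phin (a + b).
  have -> : a + b = 1 *: a + b by rewrite scale1r.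
  rewrite lincombD scale1r -ea eu (linearD L) /= eb ev; lmod.
have hlk := lop_K hD hk.
have hkk : Kspace D (k' - lop D k) by exact: (phB pK).
have hLf0 : hl (m%:Z - 2) (L f0 - f').
  apply: (subB (hlev_sub hS _)).
    by have h : hl m%:Z f0 by []; exact: (hlev_L hS h).
  by apply: (hlev_le hS (k := m%:Z)); [lia|].
have ab0 : a + b = 0.
  apply: (phin_lowest hD).
  have -> : phin (a + b) = (k' - lop D k) - (L f0 - f') by rewrite e1; lmod.
  apply: (subB (hlev_sub hS _)).
    by rewrite hlevN //; exact: K_neg.
  by apply: (hlev_le hS) hLf0; lia.
rewrite ab0 lincomb0 addr0 in e1.
have [c ec] : exists c, k' - lop D k = kmin D c.
  have [A _ eA] := hkk; rewrite -eA; apply: (Kcomb_kmin hD hm hd).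
  by rewrite eA e1.
have hG := Gtz_H c hz.
(* L Gtilde_z(c) contains the term k_min(c), so the subtraction brings L of the remainder into H_m
   and the remainder into H_{m+2}. *)
exists (f0 - Gtz D z c), k, c.
have eL : L (f0 - Gtz D z c) = f' - z *: Gtz D z c.
  rewrite (linearB L) /= (L_Gtz hD) // -ec e1; lmod.
split=> //.
- apply: (H_regular hD hz); first exact: (subB (sH m)).
  rewrite eL; apply: (subB (sH m)); first by apply: (subB (sH m)) => //; exact: (subZ (sH m)).
  by apply: (subZ (sH m)); exact: (subB (sH m)).
- by rewrite subrK.
- rewrite eL ev subrK -ec; lmod.
Qed.

(** Because K_min is contained in K_1, the projection onto H_1 fixes k_min(c) and only turns l into
    l_1. *)
Lemma BmaxP z u v : rhoL D z -> Bmax D K1 (u, v) <-> exists f k c,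
  [/\ H m.+2 f, K1 k, u = f + Gtz D z c + k &
      v = (L f + z *: Gtz D z c) + (l1f k + kmin D c)].
Proof.
move=> hz.
have orth f k c : H m.+2 f -> K1 k ->
  oproj (Hcal D) (H1 D K1) (L f + z *: Gtz D z c + (lop D k + kmin D c))
  = (L f + z *: Gtz D z c) + (l1f k + kmin D c).
  move=> hf hk; have hG := Gtz_H c hz; have hlk := lop_K hD (K1K hk).
  rewrite (oproj_H1 hD hK1 hK1max); last 2 first.
  - by apply: (subD (sH m)); [exact: (L_Hpos hS)|exact: (subZ (sH m))].
  - by apply: (phD pK) => //; exact: kminK.
  congr (_ + _); rewrite addrC -{1}[kmin D c]scale1r (projD hD hK1 hK1max) //.
  by rewrite (proj_id hD hK1 hK1max (kmin1 c)) scale1r addrC.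
split=> [[y [/= hA [f0 [k0 [hf0 hk0 eu]]]] ev]|[f [k [c [hf hk eu ev]]]]].
- have [f [k [c [hf hk eu' ey]]]] := Amax_elim hz hA.
  have hG := Gtz_H c hz.
  have hfG : H m (f + Gtz D z c) by apply: (subD (sH m)) => //; exact: H_m.
  have [_ ek] := HK_eq hD hf0 (K1K hk0) hfG hk (etrans (esym eu) eu').
  exists f, k, c; rewrite -ek; split=> //; first by rewrite ek.
  by move: ev; rewrite /graph /= => ->; rewrite ey -ek orth.
- have hG := Gtz_H c hz.
  have hfG : H m (f + Gtz D z c) by apply: (subD (sH m)) => //; exact: H_m.
  exists ((L f + z *: Gtz D z c) + (lop D k + kmin D c)).
    split=> /=; rewrite eu; first by apply: Amax_intro => //; exact: K1K.
    by exists (f + Gtz D z c), k.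
  by rewrite /graph /= ev orth.
Qed.

Lemma generic_point : exists2 z0 : C, complex.Im z0 != 0 & forall j, z0 != zpt D j.
Proof.
pose t : R := 1 + \sum_j `|complex.Im (zpt D j)|.
have t0 : 0 < t by rewrite ltr_pwDl // sumr_ge0.
exists (0 +i* t); first by rewrite /= gt_eqF.
move=> j; apply/eqP => e; have et : t = complex.Im (zpt D j) by rewrite -e.
have : t <= `|complex.Im (zpt D j)| by rewrite {1}et ler_norm.
rewrite /t (bigD1 j) //= leNgt => /negP; apply.
have s0 : 0 <= \sum_(i < m | i != j) `|complex.Im (zpt D i)| by exact: sumr_ge0.
lra.
Qed.

Definition gb (k : X) : CV := adjmx (Gb D) *m dcoef D k.

Lemma gbE k : Kspace D k -> gb k = \col_s ipm D (fs D s) k.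
Proof. by move=> [A _ <-]; exact: (Gb_dcoef hD hm hd). Qed.

Lemma cdot_gb c k : Kspace D k -> cdot c (gb k) = ipm D (kmin D c) k.
Proof. by move=> [A _ <-]; exact: (cdot_Gb hD hm hd). Qed.

Lemma fs_K s : Kspace D (fs D s).
Proof. by have := kminK (delta_mx s 0); rewrite /kmin lincomb_delta. Qed.

Lemma gbD (a : C) k k' : Kspace D k -> Kspace D k' -> gb (a *: k + k') = a *: gb k + gb k'.
Proof.
move=> hk hk'; rewrite !gbE //; last exact: (subZD (preh_sub pK)).
apply/matrixP => s j; rewrite !mxE; apply: (preh_linr pK) => //; exact: fs_K.
Qed.

Lemma Gtz_phih z c : rhoL D z -> adjmx (Cmx D) *m phih D (Gtz D z c) = Rtmx D z *m c.
Proof. by move=> hz; rewrite /Gtz -(Rmx_phih hD) // /Rtmx !mulmxA. Qed.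

Lemma Gtz_diff z z' c : rhoL D z -> rhoL D z' -> H m.+2 (Gtz D z c - Gtz D z' c).
Proof. exact: (Gz_diff hD). Qed.

(** The H_m and K parts separate. Applying L to the two forms of the H_m part puts k_min(c - c')
    into H_m, and K meets H_m trivially. *)
Lemma decomp_uniq z z' f f' k k' c c' : rhoL D z -> rhoL D z' ->
  H m.+2 f -> H m.+2 f' -> Kspace D k -> Kspace D k' ->
  f + Gtz D z c + k = f' + Gtz D z' c' + k' ->
  [/\ c = c', k = k' & f + Gtz D z c = f' + Gtz D z' c'].
Proof.
move=> hz hz' hf hf' hk hk' e.
have hG := Gtz_H c hz; have hG' := Gtz_H c' hz'.
have h1 : H m (f + Gtz D z c) by apply: (subD (sH m)) => //; exact: H_m.
have h2 : H m (f' + Gtz D z' c') by apply: (subD (sH m)) => //; exact: H_m.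
have [e1 e2] := HK_eq hD h1 hk h2 hk' e; split=> //.
apply/eqP; rewrite -subr_eq0; apply/eqP; apply: (kmin_eq0 hD hm).
apply: (Hm_K hD); last exact: kminK.
have eL : L (f + Gtz D z c) = L (f' + Gtz D z' c') by rewrite e1.
rewrite !(linearD L) /= !(L_Gtz hD) // in eL.
have -> : kmin D (c - c') = (L f' - L f) + (z' *: Gtz D z' c' - z *: Gtz D z c).
  have -> : c - c' = (-1) *: c' + c by rewrite scaleN1r addrC.
  rewrite /kmin lincombD -!/(kmin D _) scaleN1r.
  have -> : kmin D c = (L f + (z *: Gtz D z c + kmin D c)) - L f - z *: Gtz D z c by lmod.
  by rewrite eL; lmod.
apply: (subD (sH m)); apply: (subB (sH m)); try exact: (L_Hpos hS); exact: (subZ (sH m)).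
Qed.

(** Writing <phi, f> + R(z) C c as the continued functional at f + Gtilde_z(c) removes the
    dependence on z and admits z = z_j. *)
Lemma GammatE z f k c : rhoL D z -> H m.+2 f -> Kspace D k ->
  Gammat D (f + Gtz D z c + k)
  = (c, adjmx (Cmx D) *m phih D (f + Gtz D z c) - gb k).
Proof.
move=> hz hf hk.
have val z' f' c' : rhoL D z' -> H m.+2 f' ->
  adjmx (Cmx D) *m phipair D f' + Rtmx D z' *m c' = adjmx (Cmx D) *m phih D (f' + Gtz D z' c').
  move=> hz' hf'; rewrite -Gtz_phih // -mulmxDr; congr (_ *m _).
  have := phihD hD 1 (H_m hf') (Gtz_H c' hz'); rewrite !scale1r => ->.
  by rewrite (phihE hD hf').
rewrite /Gammat; case: xgetP => [p _ [z' [f' [k' [c' [hz' _ [hf' hk'] eu ->]]]]]|].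
  have eu' : f + Gtz D z c + k = f' + Gtz D z' c' + k' by rewrite eu; lmod.
  have [-> -> ->] := decomp_uniq hz hz' hf hf' hk hk' eu'.
  by rewrite val.
have [z0 nz0 ne] := generic_point; have hz0 := rhoL_nonreal hS nz0.
set p := (X in _ = X) => /(_ p) []; exists z0, (f + (Gtz D z c - Gtz D z0 c)), k, c.
have hf0 : H m.+2 (f + (Gtz D z c - Gtz D z0 c)).
  by apply: (subD (sH _)) => //; exact: Gtz_diff.
split=> //; first by lmod.
rewrite val // /p; congr (_, _ *m phih D _ - _); lmod.
Qed.

Definition exit_r0 z (h : X) : X :=
  resL D z (components (H m) (Kspace D) h).1 + rl z (components (H m) (Kspace D) h).2.
Definition exit_gam z c : X := Gtz D z c - rl z (kmin D c).

Definition exit_reg : set C := [set z | rhoL D z /\ reg1 z].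

Lemma exit_r0E z f k : H m f -> K1 k -> exit_r0 z (f + k) = resL D z f + rl z k.
Proof. by move=> hf hk; rewrite /exit_r0 (componentsE hD hf (K1K hk)). Qed.

Lemma Qmx_gb z c : reg1 z -> Qmx D K1 z *m c = gb (rl z (kmin D c)).
Proof.
move=> hz.
have hfs s : K1 (fs D s) by have := kmin1 (delta_mx s 0); rewrite /kmin lincomb_delta.
have rK k : K1 k -> K1 (rl z k) by exact: rl_K1.
have key (r : seq 'I_d) : K1 (\sum_(s <- r) c s 0 *: fs D s) /\
  rl z (\sum_(s <- r) c s 0 *: fs D s) = \sum_(s <- r) c s 0 *: rl z (fs D s).
  elim: r => [|s r [IH1 IH2]].
    rewrite !big_nil; split; first exact: (sub0 hK1).
    have h0 := sub0 hK1; have := rlD hD hK1 hK1max (-1) hz h0 h0.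
    by rewrite scaler0 addr0 scaleN1r addNr.
  rewrite !big_cons; split; first exact: (subZD hK1).
  by rewrite (rlD hD hK1 hK1max) // IH2.
have [k1 ek] := key (index_enum 'I_d); rewrite -/(lincomb _ _) -/(kmin _ _) in k1 ek.
rewrite gbE; last by apply: K1K; exact: rK.
apply/matrixP => s j; rewrite ord1 !mxE ek /ipm.
have := hip_sumr pK (index_enum 'I_d) (F := fun s => c s 0 *: rl z (fs D s)) (fs_K s).
rewrite -[hip (Kspace D)]/(hip (Hneg D m)) => ->; last first.
  by move=> s'; apply: (phZ pK); apply: K1K; exact: rK.
apply: eq_bigr => s' _; rewrite mxE mulrC; apply/esym.
by apply: (hipZr pK); [exact: fs_K|apply: K1K; exact: rK].
Qed.

Lemma L_sym_Hm f g : H m.+2 f -> H m.+2 g -> hip (H m) f (L g) = hip (H m) (L f) g.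
Proof.
move=> hf hg; rewrite /= -!(scale_Om_L hS); apply: (L_symmetric hS); exact: (Om_H2 hS).
Qed.

Lemma exit_boundary_triple : boundary_triple (H1 D K1) (Bmax D K1) (Gammat D)
  exit_reg exit_r0 exit_gam (MGamma D K1).
Proof.
have pE := H1_preh hD hK1 hK1max.
have nzi : complex.Im ('i : C) != 0 by apply: oner_neq0.
have hzi := rhoL_nonreal hS nzi.
split.
- exact: pE.
- split.
    apply/(BmaxP _ _ hzi); exists 0, 0, 0; split; [exact: sub0 (sH _)|exact: sub0 hK1| |].
    + by rewrite /Gtz mulmx0 /Gz lincomb0 !addr0.
    + rewrite /Gtz mulmx0 /Gz /kmin !lincomb0 linear0 scaler0 (l1f0 hD hK1 hK1max).
      by rewrite !addr0.
  move=> a [u u'] [v v'] /(BmaxP _ _ hzi) [f [k [c [hf hk -> ->]]]].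
  move=> /(BmaxP _ _ hzi) [g [l [b [hg hl1 -> ->]]]].
  apply/(BmaxP _ _ hzi); exists (a *: f + g), (a *: k + l), (a *: c + b); split.
  + exact: (subZD (sH _)).
  + exact: (subZD hK1).
  + by rewrite /= GtzD; lmod.
  + rewrite /= GtzD (l1fD hD hK1 hK1max) // /kmin lincombD (linearP L) /=; lmod.
- move=> [u v] /(BmaxP _ _ hzi) [f [k [c [hf hk -> ->]]]] /=.
  have hG := Gtz_H c hzi; split; apply: H1_I => //.
  + by apply: (subD (sH m)) => //; exact: H_m.
  + by apply: (subD (sH m)); [exact: L_Hpos|exact: (subZ (sH m))].
  + by apply: (subD hK1); [exact: l1f_K1|exact: kmin1].
- move=> a u v [u' /(BmaxP _ _ hzi) [f [k [c [hf /K1K hk -> _]]]]].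
  move=> [v' /(BmaxP _ _ hzi) [g [l [b [hg /K1K hl1 -> _]]]]].
  have -> : a *: (f + Gtz D 'i c + k) + (g + Gtz D 'i b + l)
    = (a *: f + g) + Gtz D 'i (a *: c + b) + (a *: k + l) by rewrite GtzD; lmod.
  rewrite !GammatE //; [|exact: (subZD (sH _))|exact: (subZD (preh_sub pK))].
  rewrite gbD // GtzD.
  have -> : a *: f + g + (a *: Gtz D 'i c + Gtz D 'i b)
     = a *: (f + Gtz D 'i c) + (g + Gtz D 'i b) by lmod.
  have h1 : H m (f + Gtz D 'i c) by apply: (subD (sH m)); [exact: H_m|exact: Gtz_H].
  have h2 : H m (g + Gtz D 'i b) by apply: (subD (sH m)); [exact: H_m|exact: Gtz_H].
  rewrite (phihD hD) // mulmxDr -scalemxAr [RHS]surjective_pairing; congr pair.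
  rewrite /= scalerBr; move: (_ *m _) (_ *m _) (gb _) (gb _) => x1 x2 x3 x4.
  by rewrite opprD addrACA.
(* Green's identity, with both elements written at z = i. [eK] is the K part, from the symmetry of
   l_1 and the duality of k_min with G_b. In the H_m part [e1] treats two regular components, [e2]
   and [e3] the mixed terms, [e4] two defect vectors. *)
- move=> u u' v v' /(BmaxP _ _ hzi) [f [k [c [hf hk1 -> ->]]]].
  move=> /(BmaxP _ _ hzi) [g [l [b [hg hl1 -> ->]]]].
  have hk := K1K hk1; have hl := K1K hl1; rewrite !GammatE //.
  set z : C := 'i in hzi nzi *.
  have hGc := Gtz_H c hzi; have hGb := Gtz_H b hzi.
  have hfm := H_m hf; have hgm := H_m hg.
  have hLf := L_Hpos hS hf; have hLg := L_Hpos hS hg.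
  have q1 := kminK c; have q2 := kminK b.
  have lk := l1f_K1 hD hK1 hK1max hk1; have ll := l1f_K1 hD hK1 hK1max hl1.
  have lkK := K1K lk; have llK := K1K ll.
  have zc : H m (z *: Gtz D z c) by exact: (subZ (sH m)).
  have zb : H m (z *: Gtz D z b) by exact: (subZ (sH m)).
  rewrite !(hip_HK hD) //; try solve [exact: (subD (sH m)) | exact: (phD pK)].
  have eK : ipm D k (l1f l + kmin D b) - ipm D (l1f k + kmin D c) l
     = cdot (gb k) b - cdot c (gb l).
    rewrite cdot_gb // -cdot_conj cdot_gb // -![ipm D]/(hip (Kspace D)).
    rewrite (hipDr pK) // (hipDl pK) // -(preh_sym pK q2 hk).
    have := l1f_sym hD hK1 hK1max hk1 hl1; rewrite -![ipm D]/(hip (Kspace D)) => ->.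
    by ring.
  have e1 := L_sym_Hm hf hg.
  have e2 := hip_Gz_shift hD (Cmx D *m c) hzi hg; rewrite -/(Gtz D z c) in e2.
  have e3 := hip_Gz_shift hD (Cmx D *m b) hzi hf; rewrite -/(Gtz D z b) in e3.
  have e4 := hip_Gz_Gz hD (Cmx D *m c) (Cmx D *m b) hzi hzi.
  rewrite -/(Gtz D z b) -/(Gtz D z c) in e4.
  have zf : H m (Num.conj z *: f) by exact: (subZ (sH m)).
  have zg : H m (Num.conj z *: g) by exact: (subZ (sH m)).
  rewrite (hipBr pHm) // (hipZr pHm) // in e2.
  rewrite (hipBr pHm) // (hipZr pHm) // in e3.
  have e3' : hip (H m) (L f) (Gtz D z b) - z * hip (H m) f (Gtz D z b)
      = cdot (phipair D f) (Cmx D *m b).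
    rewrite -cdot_conj -e3 conjB conjM conjCK.
    by rewrite -(preh_sym pHm hGb hLf) -(preh_sym pHm hGb hfm).
  have hfG : H m (f + Gtz D z c) by exact: (subD (sH m)).
  have hgG : H m (g + Gtz D z b) by exact: (subD (sH m)).
  have hLfz : H m (L f + z *: Gtz D z c) by exact: (subD (sH m)).
  have hLgz : H m (L g + z *: Gtz D z b) by exact: (subD (sH m)).
  have := phihD hD 1 hfm hGc; have := phihD hD 1 hgm hGb; rewrite !scale1r => -> ->.
  cbn [fst snd].
  have eR y : Rtmx D z *m y = adjmx (Cmx D) *m (Rmx D z *m (Cmx D *m y)) :> CV.
    by rewrite -Gtz_phih // /Gtz (Rmx_phih hD).
  have M1 x y : cdot x (Rtmx D z *m y) = cdot (Cmx D *m x) (Rmx D z *m (Cmx D *m y)).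
    by rewrite eR cdot_adjr.
  have M2 x y : cdot (Rtmx D z *m x) y = cdot (Rmx D z *m (Cmx D *m x)) (Cmx D *m y).
    by rewrite eR cdot_adjl.
  rewrite (phihE hD hf) (phihE hD hg) !mulmxDr !Gtz_phih // !cdotBr !cdotBl !cdotDr !cdotDl M1 M2.
  rewrite cdot_adjr cdot_adjl -e2 -e3'.
  have e4' := canRL (subrK _) (esym e4); rewrite e4'.
  rewrite (hipDr pHm hfG hLg zb) (hipDl pHm hfm hGc hLg) (hipDl pHm hfm hGc zb).
  rewrite (hipDl pHm hLf zc hgG) (hipDr pHm hLf hgm hGb) (hipDr pHm zc hgm hGb).
  rewrite !(hipZr pHm) // !(hipZl pHm) // e1.
  move: eK => /eqP; rewrite subr_eq => /eqP ->.
  ring.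
- move=> z [h1 h2]; split; [exact: (rhoL_conj hS)|exact: (reg1_conj hD hK1 hK1max)].
- move=> z nz; split; [exact: (rhoL_nonreal hS)|exact: (l1_nonreal_rho hD hK1 hK1max)].
- move=> z _ [hz hz1] [f [k [hf hk ->]]]; rewrite exit_r0E //.
  have hres : H m.+2 (resL D z f).
    have [g hg e] := shift_surj_pos hS hz hf.
    by rewrite -e (resL_shift hS).
  have hr := rl_K1 hz1 hk.
  have e : resL D z f + rl z k = resL D z f + Gtz D z 0 + rl z k.
    by rewrite /Gtz mulmx0 /Gz lincomb0 addr0.
  split; last by rewrite e GammatE //; exact: K1K.
  apply/(BmaxP _ _ hz); exists (resL D z f), (rl z k), 0; split=> //.
  rewrite (L_resL hS) // (l1f_rl hz1 hk) /Gtz mulmx0 /Gz /kmin !lincomb0; lmod.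
- move=> z u [hz hz1] /(BmaxP _ _ hz) [f [k [c [hf hk eu ev]]]].
  rewrite eu GammatE //=; last exact: K1K.
  move=> c0; rewrite c0 /Gtz mulmx0 /Gz /kmin !lincomb0 scaler0 !addr0 in eu ev *.
  have hfm := H_m hf; have hkK := K1K hk; have hlf := l1f_K1 hD hK1 hK1max hk.
  rewrite eu scalerDr in ev.
  have [e1 e2] := HK_eq hD (subZ (sH m) z hfm) (phZ pK z hkK) (L_Hpos hS hf) (K1K hlf) ev.
  rewrite (l1f_inj hD hK1 hK1max hz1 hk (esym e2)) addr0.
  by apply: (shift_inj hS hz); rewrite -e1 subrr.
(* (B_max - z) Gtilde_z(c) = k_min(c), and the K component - (l_1 - z)^{-1} k_min(c) cancels it. *)
- move=> z c [hz hz1].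
  have hk := kmin1 c; have hr := rl_K1 hz1 hk.
  have e : exit_gam z c = 0 + Gtz D z c + (-1) *: rl z (kmin D c).
    by rewrite /exit_gam; lmod.
  have hr' : K1 ((-1) *: rl z (kmin D c)) by exact: (subZ hK1).
  split; last by rewrite e GammatE //; [exact: sub0 (sH _)|exact: K1K].
  apply/(BmaxP _ _ hz); exists 0, ((-1) *: rl z (kmin D c)), c; split=> //.
    exact: sub0 (sH _).
  have el : l1f ((-1) *: rl z (kmin D c)) = - (kmin D c + z *: rl z (kmin D c)).
    have := l1fD hD hK1 hK1max (-1) hr (sub0 hK1).
    by rewrite (l1f0 hD hK1 hK1max) !addr0 (l1f_rl hz1 hk) => ->; lmod.
  by rewrite el linear0 /exit_gam; lmod.
- move=> z c [hz hz1].
  have hk := kmin1 c; have hr := rl_K1 hz1 hk.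
  have e : exit_gam z c = 0 + Gtz D z c + ((-1) *: rl z (kmin D c) + 0).
    by rewrite /exit_gam; lmod.
  have h0 := sub0 (sH m.+2); have h0K := sub0 (preh_sub pK).
  have hrK := K1K hr.
  rewrite e GammatE //=; last exact: (subZD (preh_sub pK)).
  rewrite gbD // add0r Gtz_phih // /MGamma mulmxDl Qmx_gb //.
  have -> : gb 0 = 0.
    by have := gbD (-1) h0K h0K; rewrite scaler0 addr0 scaleN1r addNr.
  by rewrite addr0 scaleN1r opprK.
Qed.
End ExitTriple.

(** * Holomorphic matrix functions *)

Section Holomorphic.
Context {R : realType}.
Local Notation C := R[i].
Implicit Types (f g : C -> C) (z : C).

Lemma pos_real (e : C) : 0 < e -> e = (complex.Re e)%:C /\ 0 < complex.Re e.
Proof. by case: e => a b; rewrite ltcE /= => /andP[/eqP -> h]. Qed.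

(** Radii in the topology of [R[i]] are complex numbers; here the difference quotient is controlled
    by real ones. *)
Lemma holomorphic_atP f z : holomorphic_at f z <-> exists l : C,
  forall e : R, 0 < e -> exists2 r : R, 0 < r & forall h : C, h != 0 ->
    `|h| < r%:C -> `|l - h^-1 * (f (h + z) - f z)| < e%:C.
Proof.
rewrite /holomorphic_at /derivable.
have eqf h : h^-1 *: (((f : C^o -> C^o) \o shift z) (h *: (1 : C^o)) - f z : C^o)
    = h^-1 * (f (h + z) - f z) by rewrite /= /GRing.scale /= mulr1.
split.
- move=> /cvg_ex [l /= hl]; exists l => e e0.
  have e0' : 0 < e%:C by rewrite ltcR.
  move/cvgrPdist_lt : hl => /(_ _ e0').
  move=> /nbhs_ballP [r /= r0 hr].
  have [er rr0] := pos_real r0; exists (complex.Re r) => // h h0 hlt.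
  have := hr h; rewrite /ball /= sub0r normrN er => /(_ hlt h0).
  by rewrite eqf.
- move=> [l hl]; apply/cvg_ex; exists l; apply/cvgrPdist_lt => e e0.
  have [ee re0] := pos_real e0; have [r r0 hr] := hl _ re0.
  apply/nbhs_ballP; exists (r%:C); first by rewrite /= ltcR.
  move=> h; rewrite /ball /= sub0r normrN => hlt h0.
  by rewrite eqf ee; apply: hr.
Qed.

Lemma holomorphic_near f g z (r : R) : 0 < r ->
  (forall w, `|w - z| < r%:C -> f w = g w) -> holomorphic_at g z -> holomorphic_at f z.
Proof.
move=> r0 e /holomorphic_atP [l hl]; apply/holomorphic_atP; exists l => eps e0.
have [r' r'0 hr'] := hl _ e0; exists (Num.min r r'); first by rewrite lt_min r0.
move=> h h0 hlt.
have h1 : `|h| < r%:C by apply: lt_le_trans hlt _; rewrite lecR ge_min lexx.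
have h2 : `|h| < r'%:C by apply: lt_le_trans hlt _; rewrite lecR ge_min lexx orbT.
have -> : f (h + z) = g (h + z) by apply: e; rewrite addrK.
have -> : f z = g z by apply: e; rewrite subrr normr0 ltcR.
exact: hr'.
Qed.

Lemma holomorphic_cst (c : C) z : holomorphic_at (fun=> c) z.
Proof. exact: derivable_cst. Qed.

Lemma holomorphicD f g z : holomorphic_at f z -> holomorphic_at g z ->
  holomorphic_at (fun w => f w + g w) z.
Proof. exact: derivableD. Qed.

Lemma holomorphicM f g z : holomorphic_at f z -> holomorphic_at g z ->
  holomorphic_at (fun w => f w * g w) z.
Proof. exact: derivableM. Qed.

Lemma holomorphicV f z : f z != 0 -> holomorphic_at f z ->
  holomorphic_at (fun w => (f w)^-1) z.
Proof. exact: derivableV. Qed.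

Lemma holomorphic_sum (I : Type) (r : seq I) (F : I -> C -> C) z :
  (forall i, holomorphic_at (F i) z) -> holomorphic_at (fun w => \sum_(i <- r) F i w) z.
Proof.
move=> h; elim: r => [|i r IH].
  have -> : (fun w => \sum_(i <- [::]) F i w) = (fun=> \sum_(i <- [::]) F i 0).
    by apply/funext => w; rewrite !big_nil.
  exact: holomorphic_cst.
have -> : (fun w => \sum_(j <- i :: r) F j w) = (fun w => F i w + \sum_(j <- r) F j w).
  by apply/funext => w; rewrite big_cons.
exact: (holomorphicD (h i) IH).
Qed.

Lemma holomorphic_prod (I : Type) (r : seq I) (F : I -> C -> C) z :
  (forall i, holomorphic_at (F i) z) -> holomorphic_at (fun w => \prod_(i <- r) F i w) z.
Proof.
move=> h; elim: r => [|i r IH].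
  have -> : (fun w => \prod_(i <- [::]) F i w) = (fun=> \prod_(i <- [::]) F i 0).
    by apply/funext => w; rewrite !big_nil.
  exact: holomorphic_cst.
have -> : (fun w => \prod_(j <- i :: r) F j w) = (fun w => F i w * \prod_(j <- r) F j w).
  by apply/funext => w; rewrite big_cons.
exact: (holomorphicM (h i) IH).
Qed.

Definition holomorphic_mx {p q} (M : C -> 'M[C]_(p, q)) z :=
  forall i j, holomorphic_at (fun w => M w i j) z.

Lemma holomorphic_mx_cst p q (M : 'M[C]_(p, q)) z : holomorphic_mx (fun=> M) z.
Proof. by move=> i j; exact: holomorphic_cst. Qed.

Lemma holomorphic_mxD p q (M N : C -> 'M[C]_(p, q)) z :
  holomorphic_mx M z -> holomorphic_mx N z -> holomorphic_mx (fun w => M w + N w) z.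
Proof. move=> hM hN i j.
have -> : (fun w => (M w + N w) i j) = (fun w => M w i j + N w i j).
  by apply/funext => w; rewrite mxE.
exact: (holomorphicD (hM i j) (hN i j)). Qed.

Lemma holomorphic_mxM p q r (M : C -> 'M[C]_(p, q)) (N : C -> 'M[C]_(q, r)) z :
  holomorphic_mx M z -> holomorphic_mx N z -> holomorphic_mx (fun w => M w *m N w) z.
Proof.
move=> hM hN i j.
have -> : (fun w => (M w *m N w) i j) = (fun w => \sum_k M w i k * N w k j).
  by apply/funext => w; rewrite mxE.
by apply: holomorphic_sum => k; exact: (holomorphicM (hM i k) (hN k j)).
Qed.

Lemma holomorphic_det p (M : C -> 'M[C]_p) z :
  holomorphic_mx M z -> holomorphic_at (fun w => \det (M w)) z.
Proof.
move=> hM; rewrite /determinant; apply: holomorphic_sum => s.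
apply: (@holomorphicM (fun=> _)); first exact: holomorphic_cst.
by apply: holomorphic_prod => i; exact: hM.
Qed.

Lemma holomorphic_invmx p (M : C -> 'M[C]_p) z : (forall w, M w \in unitmx) ->
  holomorphic_mx M z -> holomorphic_mx (fun w => invmx (M w)) z.
Proof.
move=> uM hM i j.
have -> : (fun w => invmx (M w) i j) = (fun w => (\det (M w))^-1 * cofactor (M w) j i).
  by apply/funext => w; rewrite /invmx uM !mxE.
apply: (@holomorphicM (fun w => (\det (M w))^-1)).
  apply: (@holomorphicV (fun w => \det (M w))); last exact: holomorphic_det.
  by rewrite -unitfE -unitmxE.
rewrite /cofactor; apply: (@holomorphicM (fun=> _)); first exact: holomorphic_cst.
apply: holomorphic_det => k l.
have -> : (fun w => row' j (col' i (M w)) k l) = (fun w => M w (lift j k) (lift i l)).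
  by apply/funext => w; rewrite !mxE.
exact: hM.
Qed.

(* n - n0 = n (S - S0) n0 makes 1 - n0 (S - S0) invertible with inverse
   1 + n (S - S0), and n = (1 - n0 (S - S0))^-1 n0. *)
Lemma holomorphic_resolvent d (S n : C -> 'M[C]_d) (z : C) (r : R) : 0 < r ->
  (forall w, `|w - z| < r%:C -> n w - n z = n w *m (S w - S z) *m n z) ->
  (forall w, `|w - z| < r%:C -> n w - n z = n z *m (S w - S z) *m n w) ->
  holomorphic_mx S z -> holomorphic_mx n z.
Proof.
move=> r0 h1 h2 hS.
pose B w := (`|w - z| < r%:C)%R.
(* Set to 1 off the disc, so that E is invertible everywhere, as [holomorphic_invmx] requires;
   holomorphy at z sees the disc only. *)
pose E w := if B w then 1%:M - n z *m (S w - S z) else 1%:M.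
have Bz : B z by rewrite /B subrr normr0 ltcR.
have EV w : B w -> (1%:M + n w *m (S w - S z)) *m E w = 1%:M.
  move=> hw; rewrite /E hw mulmxBr mulmx1 mulmxDl mul1mx.
  have e := h1 _ hw; have {}e : n w = n w *m (S w - S z) *m n z + n z by rewrite -e subrK.
  rewrite {1}e; move: (S w - S z) => Dl.
  rewrite mulmxDl !mulmxA.
  by rewrite [X in _ - X]addrC addrK.
have uE w : E w \in unitmx.
  have [hw|nw] := boolP (B w); last by rewrite /E (negbTE nw) unitmx1.
  by have [] := mulmx1_unit (EV _ hw).
have nE w : B w -> n w = invmx (E w) *m n z.
  move=> hw; rewrite -[LHS](mulKmx (uE w)); congr (_ *m _).
  by rewrite /E hw mulmxBl mul1mx -h2 // opprB addrC subrK.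
have hE : holomorphic_mx E z.
  move=> i j; apply: (holomorphic_near (g := fun w => (1%:M - n z *m (S w - S z)) i j) r0).
    by move=> w hw; rewrite /E /B hw.
  have -> : (fun w => (1%:M - n z *m (S w - S z)) i j)
     = (fun w => (1%:M + (- n z) *m (S w + - S z)) i j).
    by apply/funext => w; rewrite mulNmx.
  have h3 := holomorphic_mxD hS (@holomorphic_mx_cst _ _ (- S z) z).
  have h4 := holomorphic_mxM (@holomorphic_mx_cst _ _ (- n z) z) h3.
  have h5 := holomorphic_mxD (@holomorphic_mx_cst _ _ 1%:M z) h4.
  exact: (h5 i j).
move=> i j.
apply: (holomorphic_near (g := fun w => (invmx (E w) *m n z) i j) r0).
  by move=> w hw; rewrite (nE _ hw).
have h := holomorphic_mxM (holomorphic_invmx uE hE) (@holomorphic_mx_cst _ _ (n z) z).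
exact: (h i j).
Qed.

End Holomorphic.

(** * The resolvent matrix *)

Section ResolventMatrix.
Context {R : realType} {X : lmodType R[i]} {m d : nat} (D : model X m d)
  (hD : standing D) (hm : (2 <= m)%N) (hd : (1 <= d)%N)
  (K1 : set X) (hK1 : linsubspace K1)
  (hK1min : Kmin D `<=` K1) (hK1max : K1 `<=` Kmax D).
Local Notation C := R[i].
Local Notation L := (sL D).
Local Notation CV := 'cV[C]_d.
Local Notation H m := (Hpos D m).
Local Notation reg1 := (rho (K1space D K1) (l1 D K1)).
Local Notation l1f := (l1f D K1).
Local Notation rl := (rl D K1).
Local Notation gb := (gb D).
Implicit Types (c b : CV) (z : C) (Th : lrel CV CV).

Let hS : is_scale D := standing_scale hD.
Let pHm : preh (H m) := Hpos_preh hS m.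
Let sH n : linsubspace (H n) := Hpos_sub hS n.
Let pK := Kspace_preh hD.
Let K1K := K1_K hK1max.
Let bt := exit_boundary_triple hD hm hd hK1 hK1min hK1max.
Let kmin1 := kmin_K1 hD hm hd hK1min.

Lemma BThetaE Th : BTheta D K1 Th = brestr (Bmax D K1) (Gammat D) Th.
Proof. by []. Qed.

Lemma Bmax_single_valued : single_valued (Bmax D K1).
Proof.
have nzi : complex.Im ('i : C) != 0 by apply: oner_neq0.
have hz := rhoL_nonreal hS nzi.
move=> u v v' /(BmaxP hD hm hd hK1 hK1min hK1max _ _ hz) [f [k [c [hf hk -> ->]]]].
move=> /(BmaxP hD hm hd hK1 hK1min hK1max _ _ hz) [g [l [b [hg hl eu ->]]]].
have [ec -> e] := decomp_uniq hD hm hz hz hf hg (K1K hk) (K1K hl) eu.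
by move: e; rewrite ec => /addIr ->.
Qed.

Lemma B0P u v : B0 D K1 (u, v) <->
  exists f k, [/\ H m.+2 f, K1 k, u = f + k & v = L f + l1f k].
Proof.
split=> [[[f f'] [[k k'] [[/= ef hf] /l1P [hk ek] []]]]|[f [k [hf hk -> ->]]]].
  move: ef; rewrite /graph /= => -> -> ->; exists f, k; split=> //.
  by rewrite ek.
by exists (f, L f), (k, l1f k).
Qed.

Lemma rho_B0_res z h k : rho (H1 D K1) (B0 D K1) z -> H m h -> K1 k ->
  exists f l, [/\ H m.+2 f, K1 l, L f - z *: f = h & l1f l = k + z *: l].
Proof.
move=> [_ dom _ _] hh hk.
have : rdom (resolvent (B0 D K1) z) (h + k) by rewrite dom; exact: H1_I.
move=> [u /resolventP /B0P [f [l [hf hl -> e]]]].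
have hfm := H_m hf; have hlf := l1f_K1 hD hK1 hK1max hl.
have e' : (h + z *: f) + (k + z *: l) = L f + l1f l by rewrite -e; lmod.
have [e1 e2] := HK_eq hD (subD (sH m) hh (subZ (sH m) z hfm))
  (K1K (subD hK1 hk (subZ hK1 z hl))) (L_Hpos hS hf) (K1K hlf) e'.
by exists f, l; split=> //; rewrite -e1 addrK.
Qed.

Lemma rho_B0_intro z f l : H m.+2 f -> K1 l ->
  resolvent (B0 D K1) z ((L f - z *: f) + (l1f l - z *: l), f + l).
Proof.
move=> hf hl; apply/resolventP/B0P; exists f, l; split=> //; lmod.
Qed.

Lemma H1_norm_H f : H m f -> hnorm (H1 D K1) f = hnorm (H m) f.
Proof.
move=> hf; have h0 := sub0 (preh_sub pK).
rewrite /hnorm -{1 2}[f]addr0 (hip_HK hD) // -[ipm D]/(hip (Kspace D)) (hip0r pK) //.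
by rewrite addr0.
Qed.

Lemma H1_norm_K k : K1 k -> hnorm (H1 D K1) k = hnorm (K1space D K1) k.
Proof.
move=> hk; have h0 := sub0 (sH m); have hkK := K1K hk.
by rewrite /hnorm -{1 2}[k]add0r (hip_HK hD) // (hip0r pHm) // add0r.
Qed.

Lemma rho_B0_l1 z : rho (H1 D K1) (B0 D K1) z -> reg1 z.
Proof.
move=> hz; have [sv _ _ [M hM]] := hz.
have h0 := sub0 (sH m.+2).
have B0k h u : resolvent (l1 D K1) z (h, u) -> resolvent (B0 D K1) z (h, u).
  move=> /res_l1P [hu e]; have := rho_B0_intro z h0 hu.
  by rewrite linear0 scaler0 subr0 !add0r e addrK.
have memh h u : resolvent (l1 D K1) z (h, u) -> K1 h.
  move=> /res_l1P [hu e]; have -> : h = - z *: u + l1f u by rewrite e; lmod.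
  by apply: (subZD hK1) => //; exact: l1f_K1.
split.
- by move=> h u v /B0k h1 /B0k h2; exact: sv h1 h2.
- apply/seteqP; split=> [h [u /memh]//|h hh].
  have [f [l [_ hl _ e]]] := rho_B0_res hz (sub0 (sH m)) hh.
  by exists l; apply/res_l1P.
- by move=> h u /res_l1P [].
- exists M => h u hu; have hh := memh _ _ hu; have [hu1 _] := (res_l1P _ _ _ _ _).1 hu.
  by rewrite -!H1_norm_K //; apply: hM; exact: B0k.
Qed.

(** B_0 acts on H_m as L_m, and Omega_m is a unitary equivalence between L_m in H_m and L in H_0. *)
Lemma rho_B0_L z : rho (H1 D K1) (B0 D K1) z -> rhoL D z.
Proof.
move=> hz; have [sv _ _ [M hM]] := hz.
have h0 := sub0 hK1; have l0 := l1f0 hD hK1 hK1max.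
have B0f f : H m.+2 f -> resolvent (B0 D K1) z (L f - z *: f, f).
  move=> hf; have := rho_B0_intro z hf h0.
  by rewrite l0 scaler0 subr0 !addr0.
have lift h u : resolvent (sL0 D) z (h, u) ->
    exists f, [/\ H m.+2 f, u = sOm D m f & h = sOm D m (L f - z *: f)].
  move=> /resolventP /(sL0E hS) [hu e]; have [f hf ef] := Om_H2_surj hS m hu.
  exists f; split=> //.
  have -> : h = L u - z *: u by rewrite -e addrK.
  by rewrite -ef (scale_Om_L hS) [in RHS]linearB [in RHS]linearZ.
split.
- move=> h u v /lift [f [hf -> ->]] /lift [g [hg -> e]].
  have e' : L f - z *: f = L g - z *: g.
    have h1 := Hshift hS z hf; have h2 := Hshift hS z hg.
    apply/eqP; rewrite -subr_eq0; apply/eqP; apply: (Om_inj hS (n := m)).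
      exact: (subB (sH m)).
    by rewrite linearB /= e subrr.
  congr (sOm D m _); apply: sv (B0f _ hf) _; rewrite e'; exact: B0f.
- apply/seteqP; split=> [h [u /lift [f [hf _ ->]]]|h hh].
    by apply: (Om_H0 hS); exact: Hshift.
  have [y hy ey] := Om_surj hS m hh.
  have [f [l [hf _ e _]]] := rho_B0_res hz hy h0.
  exists (sOm D m f); apply/resolventP/(sL0E hS); split; first exact: Om_H2.
  by rewrite (scale_Om_L hS) -ey -e [sOm D m (_ - _)]linearB linearZ /= subrK.
- by move=> h u /lift [f [hf -> _]]; apply: (Om_H0 hS); exact: H_m.
- exists M => h u /lift [f [hf -> ->]].
  have h1 := H_m hf; have h2 := Hshift hS z hf.
  by have := hM _ _ (B0f _ hf); rewrite !H1_norm_H.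
Qed.

Lemma resolvent_Lpos z f u : rhoL D z ->
  resolvent (Lpos D m) z (f, u) <-> H m f /\ u = resL D z f.
Proof.
move=> hz; split=> [/resolventP [/= e hu]|[hf ->]].
  have e' : f = L u - z *: u by move: e; rewrite /graph /= => <-; rewrite addrK.
  by rewrite e' (resL_shift hS) //; split=> //; exact: Hshift.
have [g hg e] := shift_surj_pos hS hz hf.
by apply/resolventP; split=> /=; rewrite -?e ?(resL_shift hS) // /graph /= subrK.
Qed.

Lemma resL_H z f : rhoL D z -> H m f -> H m.+2 (resL D z f).
Proof.
move=> hz hf; have [g hg <-] := shift_surj_pos hS hz hf.
by rewrite (resL_shift hS).
Qed.

Lemma resolvent_l1 z k u : reg1 z ->
  resolvent (l1 D K1) z (k, u) <-> K1 k /\ u = rl z k.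
Proof.
move=> hz; split=> [h|[hk ->]]; last exact: res_l1.
split; last exact: rl_eq.
have [_ dom _ _] := hz; have : rdom (resolvent (l1 D K1) z) k by exists u.
by rewrite dom.
Qed.

(** Testing the adjoint relation between (f, k) and g + l on the difference (g - f) + (l - k) gives
    |g - f|^2 + |l - k|^2 = 0. *)
Lemma Umap_adj p u : radj (H1 D K1) (hextsum (Hm D) (K1space D K1)) (Umap D K1) (p, u) <->
  [/\ H m p.1, K1 p.2 & u = p.1 + p.2].
Proof.
case: p => f k; split=> [[[/= hf hk] [g [l [hg hl]]]]|[/= hf hk ->]].
  move=> eu; have {}eu : u = g + l := eu; subst u; move=> h.
  have hkK := K1K hk; have hlK := K1K hl.
  have h1 : H m (g - f) by exact: (subB (sH m)).
  have h2 : K1 (l - k) by exact: (subB hK1).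
  have h2K := K1K h2.
  have hU : Umap D K1 ((g - f) + (l - k), (g - f, l - k)) by split.
  have e : hip (H m) f (g - f) + hip (Kspace D) k (l - k)
      = hip (H1 D K1) (g + l) ((g - f) + (l - k)) := h _ _ hU.
  rewrite (hip_HK hD K1 hg hlK h1 h2K) in e.
  have : hip (H m) (g - f) (g - f) + hip (Kspace D) (l - k) (l - k) = 0.
    rewrite (hipBl pHm) // (hipBl pK) // addrACA -opprD.
    by apply/eqP; rewrite subr_eq0 -e.
  move/eqP; rewrite paddr_eq0 ?(preh_ge0 pHm) ?(preh_ge0 pK) //.
  move=> /andP[/eqP/(preh_def pHm h1) e1 /eqP/(preh_def pK h2K) e2].
  by split=> //; rewrite -[g](subrK f) -[l](subrK k) e1 e2 !add0r.
split=> //=; first exact: H1_I.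
move=> _ [g l] [/= hg hl ->]; apply/esym.
exact: (hip_HK hD K1 hf (K1K hk) hg (K1K hl)).
Qed.

Lemma exit_r0_Gamma1 z f k : rhoL D z -> reg1 z -> H m f -> K1 k ->
  (Gammat D (exit_r0 D K1 z (f + k))).2
  = adjmx (Cmx D) *m phipair D (resL D z f) - gb (rl z k).
Proof.
move=> hz hz1 hf hk; rewrite (exit_r0E hD hK1max) //.
have hr := resL_H hz hf; have hrl := rl_K1 hz1 hk.
have e : resL D z f + rl z k = resL D z f + Gtz D z 0 + rl z k.
  by rewrite /Gtz mulmx0 /Gz lincomb0 addr0.
rewrite e (GammatE hD hm) //=; last exact: K1K.
by rewrite /Gtz mulmx0 /Gz lincomb0 addr0 (phihE hD).
Qed.

Lemma BTheta_resolvent Th z f k u : rhoL D z -> reg1 z -> H m f -> K1 k ->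
  resolvent (BTheta D K1 Th) z (f + k, u) <-> exists c,
    u = (resL D z f + Gtz D z c) + (rl z k - rl z (kmin D c)) /\
    Th (c, (adjmx (Cmx D) *m phipair D (resL D z f) - gb (rl z k)) + MGamma D K1 z *m c).
Proof.
move=> hz hz1 hf hk; have hreg : exit_reg D K1 z by [].
rewrite BThetaE (brestr_resolvent bt _ _ _ hreg) exit_r0_Gamma1 //.
have e c : exit_r0 D K1 z (f + k) + exit_gam D K1 z c
   = (resL D z f + Gtz D z c) + (rl z k - rl z (kmin D c)).
  by rewrite (exit_r0E hD hK1max) // /exit_gam; lmod.
split=> [[_ [c [-> h]]]|[c [-> h]]]; first by exists c; rewrite e.
by split; [exact: H1_I|exists c; rewrite e].
Qed.

(** [BTheta_resolvent] describes the resolvent by a single vector c = W (x_1 - x_2), where x_1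
    depends on f and x_2 on k. As W is a linear operator on all of C^d, c = W x_1 - W x_2 splits
    into the columns of the block matrix. *)
Lemma resolvent_matrix Th z : linsubspace Th ->
  rho (H1 D K1) (BTheta D K1 Th) z -> rho (H1 D K1) (B0 D K1) z ->
  let rL := resolvent (Lpos D m) z in
  let rl := resolvent (l1 D K1) z in
  let W := rinv (rsub Th (graph (mulmx (MGamma D K1 z)))) in
  let GC := graph (fun c => Gz D z (Cmx D *m c)) in
  let CphirL := graph (fun f => adjmx (Cmx D) *m phipair D f) \oR rL in
  let Gbdrl := graph (fun k => adjmx (Gb D) *m dcoef D k) \oR rl in
  let k_min := graph (kmin D) in
  Umap D K1 \oR resolvent (BTheta D K1 Th) z
    \oR radj (H1 D K1) (hextsum (Hm D) (K1space D K1)) (Umap D K1) =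
  block_rel
    (radd rL (GC \oR W \oR CphirL))
    (ropp (GC \oR W \oR Gbdrl))
    (ropp (rl \oR k_min \oR W \oR CphirL))
    (radd rl (rl \oR k_min \oR W \oR Gbdrl)).
Proof.
move=> sTh hrho hB0 rL rlr W GC CphirL Gbdrl k_min.
have hz := rho_B0_L hB0; have hz1 := rho_B0_l1 hB0.
have hreg : exit_reg D K1 z by [].
have [tot uniq] := brestr_rho_unique bt sTh hreg hrho.
set M := MGamma D K1 z in W tot uniq *.
have WP x c : W (x, c) <-> Th (c, x + M *m c).
  split=> [[t [s [/= h]]]|h]; first by rewrite /graph /= => -> ->; rewrite subrK.
  by exists (x + M *m c), (M *m c); split=> //=; rewrite addrK.
have Wfun x c c' : W (x, c) -> W (x, c') -> c = c'.
  move=> /WP h1 /WP h2; apply/eqP; rewrite -subr_eq0; apply/eqP/uniq.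
  have := subB sTh h1 h2; congr Th; congr pair; rewrite /=.
  by rewrite mulmxBr opprD addrACA subrr add0r.
have WB x x' c c' : W (x, c) -> W (x', c') -> W (x - x', c - c').
  move=> /WP h1 /WP h2; apply/WP.
  have := subB sTh h1 h2; congr Th; congr pair; rewrite /=.
  by rewrite mulmxBr opprD addrACA.
have Wtot x : exists c, W (x, c) by have [c hc] := tot x; exists c; apply/WP.
have t1P f c : H m f -> (W \oR CphirL) (f, c) <->
    W (adjmx (Cmx D) *m phipair D (resL D z f), c).
  move=> hf; split=> [[x [y /= /(resolvent_Lpos _ _ hz) [_ ->]]]|h].
    by rewrite /graph /= => ->.
  exists (adjmx (Cmx D) *m phipair D (resL D z f)) => //=.
  by exists (resL D z f) => //; apply/resolvent_Lpos.
have t2P k c : K1 k -> (W \oR Gbdrl) (k, c) <-> W (gb (rl z k), c).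
  move=> hk; split=> [[x [y /= /(resolvent_l1 _ _ hz1) [_ ->]]]|h].
    by rewrite /graph /= => ->.
  exists (gb (rl z k)) => //=.
  by exists (rl z k) => //; apply/resolvent_l1.
have c1P f y : H m f -> (GC \oR W \oR CphirL) (f, y) <->
    exists2 c, W (adjmx (Cmx D) *m phipair D (resL D z f), c) & y = Gtz D z c.
  move=> hf; split=> [[x h1 [c h2 e]]|[c /(t1P _ _ hf) [x h1 h2] ->]].
    exists c; last exact: e.
    by apply/(t1P _ _ hf); exists x.
  by exists x => //; exists c.
have c2P k y : K1 k -> (GC \oR W \oR Gbdrl) (k, y) <->
    exists2 c, W (gb (rl z k), c) & y = Gtz D z c.
  move=> hk; split=> [[x h1 [c h2 e]]|[c /(t2P _ _ hk) [x h1 h2] ->]].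
    exists c; last exact: e.
    by apply/(t2P _ _ hk); exists x.
  by exists x => //; exists c.
have c3P f y : H m f -> (rlr \oR k_min \oR W \oR CphirL) (f, y) <->
    exists2 c, W (adjmx (Cmx D) *m phipair D (resL D z f), c) & y = rl z (kmin D c).
  move=> hf; split=> [[x h1 [c h2 [k]]]|[c /(t1P _ _ hf) [x h1 h2] ->]].
    rewrite /k_min /graph /= => -> /(resolvent_l1 _ _ hz1) [_ ->]; exists c => //.
    by apply/(t1P _ _ hf); exists x.
  by exists x => //; exists c => //; exists (kmin D c) => //; apply/resolvent_l1.
have c4P k y : K1 k -> (rlr \oR k_min \oR W \oR Gbdrl) (k, y) <->
    exists2 c, W (gb (rl z k), c) & y = rl z (kmin D c).
  move=> hk; split=> [[x h1 [c h2 [k']]]|[c /(t2P _ _ hk) [x h1 h2] ->]].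
    rewrite /k_min /graph /= => -> /(resolvent_l1 _ _ hz1) [_ ->]; exists c => //.
    by apply/(t2P _ _ hk); exists x.
  by exists x => //; exists c => //; exists (kmin D c) => //; apply/resolvent_l1.
have GtzB c c' : Gtz D z (c - c') = Gtz D z c - Gtz D z c'.
  by rewrite (_ : c - c' = -1 *: c' + c) ?GtzD ?scaleN1r 1?addrC.
have rkB c c' : rl z (kmin D (c - c')) = rl z (kmin D c) - rl z (kmin D c').
  rewrite (_ : c - c' = -1 *: c' + c) ?scaleN1r 1?addrC // /kmin addrC -scaleN1r lincombD.
  by rewrite -/(kmin D c) -/(kmin D c') (rlD hD hK1 hK1max) // scaleN1r addrC.
have rlK c : K1 (rl z (kmin D c)) by apply: rl_K1.
apply/seteqP; split=> [[[f k] [g l]]|[[f k] [g l]]].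
- move=> [u /Umap_adj [/= hf hk ->] [w /(BTheta_resolvent _ _ hz hz1 hf hk)]].
  move=> [c [-> /WP hc]] [/= hg hl e].
  have [c1 h1] := Wtot (adjmx (Cmx D) *m phipair D (resL D z f)).
  (* c_1 is W x_1; subtracting the given relation W (x_1 - x_2, c) shows that c_1 - c is W x_2. *)
  pose c2 := c1 - c.
  have h2 : W (gb (rl z k), c2).
    by have := WB _ _ _ _ h1 hc; congr W; rewrite opprB addrC subrK.
  have ec : c = c1 - c2 by rewrite /c2 opprB addrC subrK.
  have rlk := rl_K1 hz1 hk.
  have [eg el] := HK_eq hD (subD (sH m) (H_m (resL_H hz hf)) (Gtz_H hD c hz))
    (K1K (subB hK1 rlk (rlK c))) hg (K1K hl) e.
  exists (resL D z f + Gtz D z c1), (- Gtz D z c2), (- rl z (kmin D c1)),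
    (rl z k + rl z (kmin D c2)); split=> /=.
  + exists (resL D z f), (Gtz D z c1); split=> //=; first by apply/resolvent_Lpos.
    by apply/c1P => //; exists c1.
  + by rewrite /ropp /= opprK; apply/c2P => //; exists c2.
  + by rewrite /ropp /= opprK; apply/c3P => //; exists c1.
  + exists (rl z k), (rl z (kmin D c2)); split=> //=; first by apply/resolvent_l1.
    by apply/c4P => //; exists c2.
  + by rewrite -eg -el ec GtzB rkB; congr pair; lmod.
- move=> [a [b [c' [e [/= [y1 [y2 [/= r1 r2 ->]]] t2 t3 [y3 [y4 [/= r3 r4 ->]]] eq]]]]].
  have [hf ey1] := (resolvent_Lpos _ _ hz).1 r1.
  have [hk ey3] := (resolvent_l1 _ _ hz1).1 r3.
  have [c1 w1 e1] := (c1P _ _ hf).1 r2; have [c2 w2 e2] := (c2P _ _ hk).1 t2.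
  have [c3 w3 e3] := (c3P _ _ hf).1 t3; have [c4 w4 e4] := (c4P _ _ hk).1 r4.
  (* Each entry of the block relation chooses its own value of W; single-valuedness identifies the
     choices within a column. *)
  have e13 := Wfun _ _ _ w3 w1; have e24 := Wfun _ _ _ w4 w2.
  have rlk := rl_K1 hz1 hk.
  have h12 := WB _ _ _ _ w1 w2.
  have [-> ->] : g = resL D z f + Gtz D z (c1 - c2) /\
     l = rl z k - rl z (kmin D (c1 - c2)).
    case: eq => -> ->; rewrite ey1 ey3 e1 e4 e24 GtzB rkB.
    have -> : b = - Gtz D z c2 by rewrite -e2 opprK.
    have -> : c' = - rl z (kmin D c1) by rewrite -e13 -e3 opprK.
    by split; lmod.
  exists (f + k); first by apply/Umap_adj.
  exists ((resL D z f + Gtz D z (c1 - c2)) + (rl z k - rl z (kmin D (c1 - c2)))).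
    by apply/BTheta_resolvent => //; exists (c1 - c2); split=> //; apply/WP.
  split=> //=.
  + by apply: (subD (sH m)); [apply: H_m; exact: resL_H|exact: Gtz_H].
  + by apply: (subB hK1).
Qed.
End ResolventMatrix.

(** * The Nevanlinna family *)

Section GeneralizedResolvent.
Context {R : realType} {X : lmodType R[i]} {m d : nat} (D : model X m d)
  (hD : standing D) (hm : (2 <= m)%N) (hd : (1 <= d)%N)
  (K1 : set X) (hK1 : linsubspace K1)
  (hK1min : Kmin D `<=` K1) (hK1max : K1 `<=` Kmax D).
Local Notation C := R[i].
Local Notation L := (sL D).
Local Notation CV := 'cV[C]_d.
Local Notation H m := (Hpos D m).
Local Notation reg1 := (rho (K1space D K1) (l1 D K1)).
Local Notation l1f := (l1f D K1).
Local Notation rl := (rl D K1).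
Local Notation Q := (Qmx D K1).
Local Notation Cm := (Cmx D).
Implicit Types (c b x y : CV) (z w : C).

Let hS : is_scale D := standing_scale hD.
Let pHm : preh (H m) := Hpos_preh hS m.
Let sH n : linsubspace (H n) := Hpos_sub hS n.
Let pK := Kspace_preh hD.
Let p1 := K1space_preh hD hK1 hK1max.
Let K1K := K1_K hK1max.
Let bt := exit_boundary_triple hD hm hd hK1 hK1min hK1max.
Let kmin1 := kmin_K1 hD hm hd hK1min.
Let l1nr z : complex.Im z != 0 -> reg1 z := @l1_nonreal_rho _ _ _ _ _ hD _ hK1 hK1max z.
Let uC : Cm \in unitmx := standing_C hD.

(** * Symmetry, imaginary part and holomorphy of Q *)

Lemma rl_l1f_sym z k k' : reg1 z -> K1 k -> K1 k' ->
  ipm D k (rl z k') = ipm D (rl (Num.conj z) k) k'.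
Proof.
move=> hz hk hk'; have hz' := reg1_conj hD hK1 hK1max hz.
have hu := rl_K1 hz hk'; have hv := rl_K1 hz' hk.
have eu := l1f_rl hz hk'; have ev := l1f_rl hz' hk.
have lu := l1f_K1 hD hK1 hK1max hu; have lv := l1f_K1 hD hK1 hK1max hv.
have -> : k = l1f (rl (Num.conj z) k) - Num.conj z *: rl (Num.conj z) k.
  by rewrite ev addrK.
have -> : ipm D (rl (Num.conj z) (l1f (rl (Num.conj z) k) - Num.conj z *: rl (Num.conj z) k)) k'
  = ipm D (rl (Num.conj z) k) (l1f (rl z k') - z *: rl z k').
  by rewrite ev eu !addrK.
set u := rl z k' in hu eu lu *; set v := rl _ k in hv ev lv *.
have uK := K1K hu; have vK := K1K hv; have luK := K1K lu; have lvK := K1K lv.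
have zv : Kspace D (Num.conj z *: v) by emem.
have zu : Kspace D (z *: u) by emem.
rewrite -![ipm D]/(hip (Kspace D)) (hipBl pK) // (hipBr pK) // (hipZl pK) // (hipZr pK) //.
by rewrite conjCK; congr (_ - _); apply/esym; exact: l1f_sym.
Qed.

Lemma cdot_Q z c b : reg1 z -> cdot c (Q z *m b) = ipm D (kmin D c) (rl z (kmin D b)).
Proof.
move=> hz; rewrite (Qmx_gb hD hm hd hK1 hK1min hK1max) // (cdot_gb hD hm hd) //.
by apply: K1K; exact: rl_K1.
Qed.

Lemma Q_adj z c b : reg1 z -> cdot (Q (Num.conj z) *m c) b = cdot c (Q z *m b).
Proof.
move=> hz; have hz' := reg1_conj hD hK1 hK1max hz.
rewrite -cdot_conj !cdot_Q // [RHS]rl_l1f_sym //.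
have h1 := kmin1 c; have h2 := kmin1 b.
by apply/esym; exact: (preh_sym pK (K1K h2) (K1K (rl_K1 hz' h1))).
Qed.

(** With u = (l_1 - z)^{-1} k_min(c), <c, Q(z) c> is <(l_1 - z) u, u>, and <l_1 u, u> is real. *)
Lemma Q_Im z c : reg1 z -> complex.Im (cdot c (Q z *m c))
  = complex.Im z * hnorm (K1space D K1) (rl z (kmin D c)) ^+ 2.
Proof.
move=> hz; rewrite cdot_Q //; have hk := kmin1 c; have hu := rl_K1 hz hk.
have eu := l1f_rl hz hk; have lu := l1f_K1 hD hK1 hK1max hu.
set u := rl z _ in hu eu lu *.
have -> : kmin D c = l1f u - z *: u by rewrite eu addrK.
have uK := K1K hu; have luK := K1K lu; have zuK : Kspace D (z *: u) by emem.
have r1 : complex.Im (ipm D (l1f u) u) = 0.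
  apply: Im0_conj; rewrite -(preh_sym pK luK uK).
  exact: l1f_sym.
rewrite -![ipm D]/(hip (Kspace D)) (hipBl pK) // (hipZl pK) //.
rewrite ImD ImN r1 add0r; have -> : hip (Kspace D) u u = (hnorm (K1space D K1) u ^+ 2)%:C.
  exact: (hip_hnorm p1 hu).
by rewrite ImMr Im_conj mulNr opprK.
Qed.

Lemma rl_resolvent z w k : reg1 z -> reg1 w -> K1 k ->
  rl w k - rl z k = (w - z) *: rl w (rl z k).
Proof.
move=> hz hw hk; have hu := rl_K1 hz hk; have hwu := rl_K1 hw hu.
apply/esym/eqP; rewrite eq_sym subr_eq eq_sym; apply/eqP.
apply: (rl_eq hw); apply/res_l1P; split; first exact: (subZD hK1).
by rewrite (l1fD hD hK1 hK1max) // !l1f_rl //; lmod.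
Qed.

(* (l_1 - w)^-1 - (l_1 - z)^-1 = (w - z)(l_1 - w)^-1 (l_1 - z)^-1, used twice. *)
Lemma rl_holomorphic z k k' : complex.Im z != 0 -> K1 k -> K1 k' ->
  holomorphic_at (fun w => ipm D k (rl w k')) z.
Proof.
move=> nz hk hk'; have hz := l1nr nz.
have h1 := rl_K1 hz hk'; have h2 := rl_K1 hz h1.
set p := rl z k' in h1 h2; set q := rl z p in h2.
have kK := K1K hk; have pK1 := K1K h1; have qK := K1K h2.
apply/holomorphic_atP; exists (ipm D k q) => e e0.
pose I := `|complex.Im z|; have I0 : 0 < I by rewrite normr_gt0.
pose N := hnorm (Kspace D) k * hnorm (Kspace D) q.
have N0 : 0 <= N by rewrite mulr_ge0 ?hnorm_ge0.
(* The first bound keeps |Im w| above |Im z| / 2, so the error h <k, (l_1 - w)^{-1} q> is at most 2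
   |h| N / |Im z|; the second makes this less than e. N + 1 avoids a zero denominator. *)
pose r := Num.min (I / 2) (e * I / (2 * (N + 1))).
have d0 : 0 < 2 * (N + 1) by rewrite mulr_gt0 // ltr_wpDl.
have r0 : 0 < r by rewrite lt_min !divr_gt0 // mulr_gt0.
exists r => // h h0 hlt; set w := h + z.
have hr1 : `|h| < (I / 2)%:C by apply: lt_le_trans hlt _; rewrite lecR ge_min lexx.
have Imh : `|complex.Im h| < I / 2.
  by rewrite -ltcR; apply: le_lt_trans (Im_le_norm h) hr1.
have Imw : I / 2 < `|complex.Im w|.
  rewrite /w ImD; have := ler_normB (complex.Im h + complex.Im z) (complex.Im h).
  rewrite addrAC subrr add0r -/I; lra.
have nw : complex.Im w != 0.
  by rewrite -normr_gt0; apply: le_lt_trans Imw; rewrite divr_ge0 // ltW.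
have hw := l1nr nw.
have hwp := rl_K1 hw h1; have hwq := rl_K1 hw h2.
have wpK := K1K hwp; have wqK := K1K hwq.
have e1 := rl_resolvent hz hw hk'; rewrite -/p in e1.
have e2 := rl_resolvent hz hw h1; rewrite -/q in e2.
have wz : w - z = h by rewrite /w addrK.
rewrite wz in e1 e2.
have eq1 : ipm D k (rl w k') - ipm D k p = h * ipm D k (rl w p).
  have hwk := K1K (rl_K1 hw hk').
  rewrite -![ipm D]/(hip (Kspace D)) -(hipBr pK) // e1 (hipZr pK) //.
have eq2 : ipm D k q - ipm D k (rl w p) = - (h * ipm D k (rl w q)).
  rewrite -![ipm D]/(hip (Kspace D)) -(hipBr pK) // -opprB e2 (hipNr pK) ?(hipZr pK) //.
  exact: (phZ pK).
rewrite eq1 mulKf // eq2 normrN normrM.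
have bq : hnorm (Kspace D) (rl w q) <= hnorm (Kspace D) q / `|complex.Im w|.
  have real : complex.Im (hip (K1space D K1) (rl w q) (l1f (rl w q))) = 0.
    apply: Im0_conj; rewrite -(preh_sym p1 hwq (l1f_K1 hD hK1 hK1max hwq)).
    by apply/esym; exact: l1f_sym.
  have := norm_ge_Im p1 w hwq (l1f_K1 hD hK1 hK1max hwq) real.
  rewrite (l1f_rl hw h2) addrK => le.
  by rewrite ler_pdivlMr ?normr_gt0 // mulrC; exact: le.
have cs : `|ipm D k (rl w q)| <= (N / `|complex.Im w|)%:C.
  apply: le_trans (cauchy_schwarz pK kK wqK) _; rewrite lecR /N -mulrA.
  by apply: ler_wpM2l; rewrite ?hnorm_ge0.
have cs2 : `|ipm D k (rl w q)| <= (2 * N / I)%:C.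
  apply: le_trans cs _; rewrite lecR -mulrA mulrCA; apply: ler_wpM2l => //.
  rewrite -[2 / I]invf_div lef_pV2 ?posrE ?divr_gt0 //; last by rewrite normr_gt0.
  exact: ltW.
apply: le_lt_trans (ler_wpM2l (normr_ge0 _) cs2) _.
have hr2 : `|h| < (e * I / (2 * (N + 1)))%:C.
  by apply: lt_le_trans hlt _; rewrite lecR ge_min lexx orbT.
rewrite norm_ReE -realcM ltcR; rewrite norm_ReE ltcR in hr2.
set t := complex.Re `|h| in hr2 *.
have t0 : 0 <= t by rewrite -ler0c -norm_ReE normr_ge0.
rewrite mulrA ltr_pdivrMr //.
move: hr2; rewrite ltr_pdivlMr // => hr2.
by apply: le_lt_trans hr2; apply: ler_wpM2l => //; rewrite ler_wpM2l // lerDl.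
Qed.

Lemma Q_holomorphic z : complex.Im z != 0 -> holomorphic_mx Q z.
Proof.
move=> nz s s'.
have fK s0 : K1 (fs D s0) by have := kmin1 (delta_mx s0 0); rewrite /kmin lincomb_delta.
have -> : (fun w => Q w s s') = (fun w => ipm D (fs D s) (rl w (fs D s'))).
  by apply/funext => w; rewrite mxE.
exact: rl_holomorphic.
Qed.

(** * The family tau *)

Section Theta.
Context (Th : lrel CV CV) (saTh : is_selfadjoint (Cspace R d) Th).
Let sTh : linsubspace Th := saTh.1.1.

Definition KNtau z : lrel CV CV := graph (mulmx (adjmx (invmx Cm)))
  \oR rsub (graph (mulmx (Q z))) Th \oR graph (mulmx (invmx Cm)).

Let invCK x : Cm *m (invmx Cm *m x) = x. Proof. exact: mulKVmx. Qed.
Let CKinv x : invmx Cm *m (Cm *m x) = x. Proof. exact: mulKmx. Qed.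
Let adjCK x : adjmx Cm *m (adjmx (invmx Cm) *m x) = x.
Proof. by rewrite mulmxA (adjmx_mul_inv uC).1 mul1mx. Qed.
Let adjCKV x : adjmx (invmx Cm) *m (adjmx Cm *m x) = x.
Proof. by rewrite mulmxA (adjmx_mul_inv uC).2 mul1mx. Qed.

Lemma KNtauP z x y : KNtau z (x, y) <->
  Th (invmx Cm *m x, Q z *m (invmx Cm *m x) - adjmx Cm *m y).
Proof.
split=> [[c ec [v [q [t [/= eq Tct ev]]] ey]]|h].
  have {}ec : c = invmx Cm *m x := ec.
  have {}eq : q = Q z *m c := eq.
  have {}ey : y = adjmx (invmx Cm) *m v := ey.
  by rewrite ey adjCK ev eq -ec opprB addrC subrK.
exists (invmx Cm *m x) => //.
exists (adjmx Cm *m y); last by rewrite /graph /= adjCKV.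
exists (Q z *m (invmx Cm *m x)), (Q z *m (invmx Cm *m x) - adjmx Cm *m y).
by split=> //=; rewrite opprB addrC subrK.
Qed.

Lemma Th_real c t : Th (c, t) -> complex.Im (cdot c t) = 0.
Proof.
move=> h; apply: Im0_conj; have := rsa_real (@Cspace_preh R d) saTh h => /= e.
by rewrite cdot_conj.
Qed.

Lemma KNtau_sub z : linsubspace (KNtau z).
Proof.
split.
  by apply/KNtauP; rewrite !mulmx0 subr0; exact: (sub0 sTh).
move=> a [x y] [x' y'] /KNtauP h1 /KNtauP h2; apply/KNtauP.
have := subZD sTh a h1 h2; congr Th; congr pair; rewrite /=.
  by rewrite mulmxDr -scalemxAr.
rewrite !mulmxDr -!scalemxAr scalerBr opprD.
by rewrite addrACA.
Qed.

Lemma KNtau_adj z : complex.Im z != 0 ->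
  radj (Cspace R d) (Cspace R d) (KNtau z) = KNtau (Num.conj z).
Proof.
move=> nz; have hz := l1nr nz.
have [_ eTh] := saTh.
apply/seteqP; split=> [[x y] [_ _ /= h]|[x y] /KNtauP h].
  apply/KNtauP; rewrite eTh; split=> //= c t hct.
  have ht : KNtau z (Cm *m c, adjmx (invmx Cm) *m (Q z *m c - t)).
    by apply/KNtauP; rewrite CKinv adjCK opprB addrC subrK.
  have := h _ _ ht; rewrite cdot_adjr => e.
  rewrite cdotBl Q_adj // cdot_adjl -e cdotBr; ring.
split=> //= a b /KNtauP hab.
have := h; rewrite {1}eTh => -[_ _ /(_ _ _ hab)] /=.
rewrite cdotBl cdotBr Q_adj // cdot_adjl invCK => e.
have -> : cdot x b = cdot (invmx Cm *m x) (adjmx Cm *m b) by rewrite cdot_adjr invCK.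
have -> : cdot (invmx Cm *m x) (adjmx Cm *m b) = cdot (invmx Cm *m x) (Q z *m (invmx Cm *m a))
  - (cdot (invmx Cm *m x) (Q z *m (invmx Cm *m a)) - cdot (invmx Cm *m x) (adjmx Cm *m b)) by ring.
by rewrite e; ring.
Qed.

(** A self-adjoint Theta contributes a real form, so the imaginary part is that of Q(z) at C^{-1}
    x. *)
Lemma KNtau_Im z x y : complex.Im z != 0 -> KNtau z (x, y) ->
  0 <= complex.Im (cdot x y) / complex.Im z.
Proof.
move=> nz /KNtauP h; have hz := l1nr nz.
have -> : cdot x y = cdot (invmx Cm *m x) (adjmx Cm *m y) by rewrite cdot_adjr invCK.
have := Th_real h; rewrite cdotBr ImD ImN Q_Im // => /eqP.
rewrite subr_eq0 => /eqP <-.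
by rewrite mulrAC divff // mul1r sqr_ge0.
Qed.

(** (tau(z) + w)^{-1} = - C (Theta - S(z))^{-1} C^* with S(z) = Q(z) + w C^* C. For z and w in one
    half-plane the imaginary part of the form of S(z) is definite, so [selfadjoint_sub_invertible]
    applies, and holomorphy of the inverse follows from that of S. *)
Lemma KNtau_resolvent w : complex.Im w != 0 -> exists N : C -> 'M[C]_d,
  forall z, 0 < complex.Im z * complex.Im w ->
    rinv (radd (KNtau z) (graph (fun x => w *: x))) = graph (mulmx (N z)) /\
    forall i j, holomorphic_at (fun v => N v i j) z.
Proof.
move=> nw; pose S z := Q z + w *: (adjmx Cm *m Cm).
pose F z : lrel CV CV := [set p | Th (p.2, p.1 + S z *m p.2)].
have cS z c : cdot c (S z *m c) = cdot c (Q z *m c) + w * cdot (Cm *m c) (Cm *m c).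
  by rewrite mulmxDl cdotDr -scalemxAl cdotZr -mulmxA cdot_adjr.
have SE z c : S z *m c = Q z *m c + w *: (adjmx Cm *m (Cm *m c)).
  by rewrite mulmxDl -scalemxAl -mulmxA.
have NE (n : 'M[C]_d) y : - (Cm *m n *m adjmx Cm) *m y = Cm *m (n *m (- (adjmx Cm *m y))).
  by rewrite mulNmx -mulmxA -mulmxA !mulmxN -(mulmxA n).
have Snz z : 0 < complex.Im z * complex.Im w -> complex.Im z != 0.
  by move=> p; apply: contraTneq p => ->; rewrite mul0r ltxx.
have pos z : 0 < complex.Im z * complex.Im w ->
    forall c, complex.Im (cdot c (S z *m c)) = 0 -> c = 0.
  move=> p c; have nz := Snz _ p; have hz := l1nr nz.
  have hh : cdot (Cm *m c) (Cm *m c) = (hnorm (Cspace R d) (Cm *m c) ^+ 2)%:C.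
    exact: (hip_hnorm (@Cspace_preh R d) I).
  rewrite cS ImD Q_Im // hh ImMr.
  set a := _ ^+ 2; set b := _ ^+ 2 => e.
  have a0 : 0 <= a by exact: sqr_ge0.
  have b0 : 0 <= b by exact: sqr_ge0.
  (* Multiplying by Im w gives two terms of the same sign with sum zero, so |C c|^2 = 0. *)
  have : complex.Im w ^+ 2 * b = - (complex.Im z * complex.Im w * a).
    have -> : complex.Im w ^+ 2 * b = complex.Im w * (complex.Im z * a + complex.Im w * b)
      - complex.Im z * complex.Im w * a by ring.
    by rewrite e mulr0 sub0r.
  move=> e2; have le0 : complex.Im w ^+ 2 * b <= 0.
    by rewrite e2 oppr_le0 mulr_ge0 // ltW.
  have : complex.Im w ^+ 2 * b == 0 by rewrite eq_le le0 mulr_ge0 ?sqr_ge0.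
  rewrite mulf_eq0 expf_eq0 /= (negbTE nw) /= expf_eq0 /= => /eqP.
  move=> /(hnorm_eq0 (@Cspace_preh R d) (x := Cm *m c) I) e3.
  by rewrite -(CKinv c) e3 mulmx0.
(* The condition sits under the existential so that choice yields a function on all of C, with
   arbitrary values off the half-plane. *)
have exN z : exists n : 'M[C]_d, 0 < complex.Im z * complex.Im w -> F z = graph (mulmx n).
  have [p|np] := boolP (0 < complex.Im z * complex.Im w); last by exists 0.
  have [tot uniq] := selfadjoint_sub_invertible saTh (pos _ p).
  have [n hn] : exists n : 'M[C]_d, F z = graph (mulmx n).
    apply: lrel_matrix => //.
    - split; first by rewrite /F /= mulmx0 addr0; exact: (sub0 sTh).
      move=> a [x y] [x' y'] h1 h2; rewrite /F /= in h1 h2 *.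
      have := subZD sTh a h1 h2; congr Th; congr pair; rewrite /=.
      by rewrite mulmxDr -scalemxAr scalerDr addrACA.
    - by move=> y; rewrite /F /= add0r => /uniq.
  by exists n.
have [n hn] := choice exN.
have nP z x c : 0 < complex.Im z * complex.Im w ->
    Th (c, x + S z *m c) <-> c = n z *m x.
  by move=> p; have -> : Th (c, x + S z *m c) = F z (x, c) by []; rewrite (hn _ p).
exists (fun z => - (Cm *m n z *m adjmx Cm)) => z p; split.
  apply/seteqP; split=> [[y x] [v [u [/= /KNtauP h]]]|[y x]].
    rewrite /graph /= => -> ey.
    have h2 : Th (invmx Cm *m x, - (adjmx Cm *m y) + S z *m (invmx Cm *m x)).
      move: h; congr Th; congr pair.
      rewrite SE invCK ey mulmxDr -scalemxAr opprD.
      by rewrite addrACA addNr addr0 addrC.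
    have := (nP _ _ _ p).1 h2 => e.
    by rewrite /graph /= NE -e invCK.
  rewrite /graph /= => ->.
  set c := n z *m (- (adjmx Cm *m y)).
  have -> : - (Cm *m n z *m adjmx Cm) *m y = Cm *m c.
    exact: NE.
  exists (y - w *: (Cm *m c)), (w *: (Cm *m c)); split=> //=; last by rewrite subrK.
  apply/KNtauP; rewrite CKinv.
  have := (nP z (- (adjmx Cm *m y)) c p).2 erefl; congr Th; congr pair.
  rewrite SE mulmxBr -scalemxAr opprB.
  by rewrite [LHS]addrC -addrA.
have nz := Snz _ p.
have Iz0 : 0 < `|complex.Im z| by rewrite normr_gt0.
(* The disc of radius |Im z| about z stays in its half-plane. *)
have near v : `|v - z| < `|complex.Im z|%:C -> 0 < complex.Im v * complex.Im w.
  move=> lt; have : `|complex.Im (v - z)| < `|complex.Im z|.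
    by rewrite -ltcR; apply: le_lt_trans (Im_le_norm _) lt.
  rewrite ImD ImN; move: p Iz0; move: (complex.Im v) (complex.Im z) (complex.Im w) => a b e.
  move=> p b0 lt'.
  have [e0|e0|e0] := ltgtP e 0.
  - have b1 : b < 0 by rewrite nmulr_lgt0 in p.
    rewrite nmulr_lgt0 //; move: lt'; rewrite (ltr0_norm b1) ltr_norml => /andP[]; lra.
  - have b1 : 0 < b by rewrite pmulr_lgt0 in p.
    rewrite pmulr_lgt0 //; move: lt'; rewrite (gtr0_norm b1) ltr_norml => /andP[]; lra.
  - by move: p; rewrite e0 mulr0 ltxx.
have hSh : holomorphic_mx S z.
  apply: (@holomorphic_mxD _ _ _ Q (fun=> w *: (adjmx Cm *m Cm))).
    exact: Q_holomorphic.
  exact: holomorphic_mx_cst.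
(* Theta (c, x + S u c) reads Theta (c, (x + (S u - S v) c) + S v c). *)
have ident u v : 0 < complex.Im u * complex.Im w -> 0 < complex.Im v * complex.Im w ->
    n u - n v = n v *m (S u - S v) *m n u.
  move=> hu hv.
  have eqx x : (n u - n v) *m x = (n v *m (S u - S v) *m n u) *m x.
    have h := (nP u x (n u *m x) hu).2 erefl.
    have h' : Th (n u *m x, (x + (S u - S v) *m (n u *m x)) + S v *m (n u *m x)).
      by move: h; congr Th; congr pair; rewrite mulmxBl -addrA subrK.
    have := (nP v _ _ hv).1 h'; rewrite mulmxDr => e.
    by rewrite mulmxBl {1}e addrC addKr !mulmxA.
  apply/matrixP => i j.
  have := eqx (delta_mx j 0) => /matrixP /(_ i 0).
  have dl (A : 'M[C]_d) : (A *m delta_mx j (0 : 'I_1)) i 0 = A i j.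
    rewrite mxE (bigD1 j) //= mxE !eqxx mulr1 big1 ?addr0 // => k ne.
    by rewrite mxE (negbTE ne) mulr0.
  by rewrite !dl.
have hn' : holomorphic_mx n z.
  apply: (holomorphic_resolvent Iz0 (S := S)) => //.
  - move=> v /near hv; have := ident z v p hv.
    rewrite -[n v - n z]opprB => ->.
    by rewrite -mulNmx -mulmxN opprB.
  - by move=> v /near hv; exact: ident.
have h1 := holomorphic_mxM (@holomorphic_mx_cst _ _ _ (- Cm) z) hn'.
have h2 := holomorphic_mxM h1 (@holomorphic_mx_cst _ _ _ (adjmx Cm) z).
move=> i j; have := h2 i j.
have -> : (fun v => (- (Cm *m n v *m adjmx Cm)) i j) = (fun v => (- Cm *m n v *m adjmx Cm) i j).
  by apply/funext => v; rewrite !mulNmx.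
by [].
Qed.

(** * The Krein-Naimark formula and uniqueness of tau *)

Lemma oproj_Hm f k : H m f -> K1 k -> oproj (H1 D K1) (Hm D) (f + k) = f.
Proof.
move=> hf hk; have hkK := K1K hk.
have sp : H m f /\ forall g, H m g -> hip (H1 D K1) g (f + k - f) = 0.
  split=> // g hg; have -> : f + k - f = 0 + k by lmod.
  have k0 := sub0 (preh_sub pK).
  rewrite -[g]addr0 (hip_HK hD) //; last exact: sub0 (sH m).
  by rewrite (hip0r pHm) // add0r; exact: (hip0l pK).
rewrite /oproj; case: xgetP => [g _ [hg hort]|/(_ f sp) //].
have hfg : H m (f - g) by exact: (subB (sH m)).
have := hort _ hfg; have -> : f + k - g = (f - g) + k by lmod.
have k0 := sub0 (preh_sub pK).
rewrite -{1}[f - g]addr0 (hip_HK hD) //.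
have -> : ipm D 0 k = 0 by exact: (hip0l pK).
by rewrite addr0 => /(preh_def pHm hfg)/eqP; rewrite subr_eq0 => /eqP ->.
Qed.

Lemma gamma_adj z f x : rhoL D z ->
  radj (Cspace R d) (Hm D) (graph (Gz D (Num.conj z))) (f, x) <->
  H m f /\ x = phipair D (resL D z f).
Proof.
move=> hz; have hz' := rhoL_conj hS hz.
have key c : H m f -> hip (H m) f (Gz D (Num.conj z) c) = cdot (phipair D (resL D z f)) c.
  move=> hf; have hr := resL_H hD hz hf.
  have hG := Gz_H hD c hz'.
  rewrite (preh_sym pHm hG hf) -cdot_conj; congr Num.conj.
  have := hip_Gz_shift hD c hz' hr; rewrite conjCK => <-.
  by rewrite (shift_resL hS).
split=> [[/= hf _ h]|[hf ->]].
  split=> //; apply: cdot_inj => c.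
  have e : hip (H m) f (Gz D (Num.conj z) c) = cdot x c := h c (Gz D _ c) erefl.
  by rewrite -cdot_conj -[RHS]cdot_conj -(key c hf) -e.
by split=> //= c y; rewrite /graph /= => ->; exact: key.
Qed.


(** The relation (tau + R)^{-1} x = e reads (Theta - M_Gamma)^{-1} C^* x = - C^{-1} e; this sign
    turns the plus of the block matrix into the minus of the Krein-Naimark formula. *)
Lemma radd_KNtau z x e :
  rinv (radd (KNtau z) (graph (mulmx (Rmx D z)))) (x, e) <->
  Th (- (invmx Cm *m e), adjmx Cm *m x + MGamma D K1 z *m (- (invmx Cm *m e))).
Proof.
have eR : adjmx Cm *m (Rmx D z *m e) = Rtmx D z *m (invmx Cm *m e).
  by rewrite /Rtmx -!(mulmxA (adjmx Cm)) -(mulmxA (Rmx D z)) invCK.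
have eq y : x = y + Rmx D z *m e ->
   (- (invmx Cm *m e), adjmx Cm *m x + MGamma D K1 z *m (- (invmx Cm *m e)))
   = - (invmx Cm *m e, Q z *m (invmx Cm *m e) - adjmx Cm *m y).
  move=> ->; congr pair; rewrite /= mulmxN /MGamma mulmxDl mulmxDr eR.
  rewrite opprB; move: (adjmx Cm *m y) (Rtmx D z *m _) (Q z *m _) => a b c.
  by rewrite opprD addrA addrK.
split=> [[y [v [/= /KNtauP h]]]|h].
  rewrite /graph /= => -> ex.
  by rewrite (eq y ex); exact: (subN sTh).
exists (x - Rmx D z *m e), (Rmx D z *m e); split=> //=; last by rewrite subrK.
apply/KNtauP; have := subN sTh h.
by rewrite (eq (x - Rmx D z *m e)) ?subrK // opprK.
Qed.

Lemma KN_formula_KNtau z : rhoL D z -> reg1 z ->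
  KN_formula D K1 (BTheta D K1 Th) (KNtau z) z.
Proof.
move=> hz hz1; rewrite /KN_formula.
have k0 : K1 0 := sub0 hK1.
have rl0 : rl z 0 = 0.
  have := rlD hD hK1 hK1max (-1) hz1 k0 k0.
  by rewrite scaler0 addr0 scaleN1r addNr.
have gb0 : gb D 0 = 0.
  have k0K := K1K k0; have := gbD hD hm hd (-1) k0K k0K.
  by rewrite scaler0 addr0 scaleN1r addNr.
have resP f u : H m f -> resolvent (BTheta D K1 Th) z (f, u) <-> exists c,
    u = (resL D z f + Gtz D z c) + - rl z (kmin D c) /\
    Th (c, adjmx Cm *m phipair D (resL D z f) + MGamma D K1 z *m c).
  move=> hf; rewrite -{1}[f]addr0 (BTheta_resolvent hD hm hd hK1 hK1min hK1max _ _ hz hz1 hf k0).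
  by rewrite rl0 gb0 subr0; split=> -[c [-> h]]; exists c; rewrite ?sub0r.
have pj f c : H m f ->
    oproj (H1 D K1) (Hm D) ((resL D z f + Gtz D z c) + - rl z (kmin D c)) = resL D z f + Gtz D z c.
  move=> hf; apply: oproj_Hm.
    by apply: (subD (sH m)); [apply: H_m; exact: (resL_H hD)|exact: Gtz_H].
  by apply: (subN hK1); exact: rl_K1.
have GN c : Gz D z (Cm *m - c) = - Gtz D z c.
  rewrite mulmxN (_ : - (Cm *m c) = -1 *: (Cm *m c) + 0); last by rewrite scaleN1r addr0.
  rewrite GzD -/(Gtz D z c) scaleN1r.
  by rewrite /Gz lincomb0 addr0.
apply/seteqP; split=> [[f y] [u [/= hu hf] ey]|[f y]].
- have {}ey : y = oproj (H1 D K1) (Hm D) u := ey.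
  have [c [eu h]] := (resP _ _ hf).1 hu.
  rewrite eu pj // in ey; rewrite ey.
  exists (resL D z f), (- Gtz D z c); split=> /=; [by apply/(resolvent_Lpos hD)| |by rewrite opprK].
  exists (phipair D (resL D z f)); first by apply/gamma_adj.
  exists (Cm *m - c); last by rewrite /graph /= GN.
  by apply/radd_KNtau; rewrite CKinv opprK.
- move=> [a [b [/= /(resolvent_Lpos hD _ _ hz) [hf ->] [x /(gamma_adj _ _ hz) [_ ex]]]]].
  move=> [e /radd_KNtau h eb] ->.
  have {}eb : b = Gz D z e := eb.
  rewrite ex in h.
  exists ((resL D z f + Gtz D z (- (invmx Cm *m e))) + - rl z (kmin D (- (invmx Cm *m e)))).
    by split=> //=; apply/resP => //; exists (- (invmx Cm *m e)).
  rewrite /graph /= pj //; congr (_ + _); rewrite eb.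
  by rewrite -[in LHS](invCK e) -[invmx Cm *m e in LHS]opprK GN opprK.
Qed.

(** G_z is injective, and the adjoint of G_{conj z} is onto C^d because <phi, .> is onto on H_{m+2}.
    The formula therefore determines (tau + R)^{-1}, and hence tau; exchanging the two families
    gives equality. *)
Lemma KN_formula_unique T z tau tau' : rhoL D z ->
  KN_formula D K1 T tau z -> KN_formula D K1 T tau' z -> tau' `<=` tau.
Proof.
move=> hz h1 h2.
have e12 := etrans (esym h2) h1.
have key x e : rinv (radd tau' (graph (mulmx (Rmx D z)))) (x, e) ->
    rinv (radd tau (graph (mulmx (Rmx D z)))) (x, e).
  move=> h.
  have [g hg eg] := phipair_surj hD x.
  set f := L g - z *: g; have hf : H m f by exact: (Hshift hS).
  have eg' : resL D z f = g by rewrite (resL_shift hS).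
  have rx : radj (Cspace R d) (Hm D) (graph (Gz D (Num.conj z))) (f, x).
    by apply/gamma_adj => //; rewrite eg'.
  have : rsub (resolvent (Lpos D m) z) (graph (Gz D z)
        \oR rinv (radd tau' (graph (mulmx (Rmx D z))))
        \oR radj (Cspace R d) (Hm D) (graph (Gz D (Num.conj z)))) (f, g - Gz D z e).
    exists g, (Gz D z e); split=> //=.
      by apply/(resolvent_Lpos hD) => //; rewrite eg'.
    by exists x => //; exists e.
  rewrite e12 => -[a [b [/= /(resolvent_Lpos hD _ _ hz) [_ ->] [x2 /(gamma_adj _ _ hz) [_ ex2]]]]].
  move=> [e2 he2 eb]; have {}eb : b = Gz D z e2 := eb.
  rewrite eg' eb => /addrI/oppr_inj ee.
  have -> : e = e2.
    apply/eqP; rewrite -subr_eq0; apply/eqP; apply: (Gz_inj hD hz).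
    have -> : e - e2 = -1 *: e2 + e by rewrite scaleN1r addrC.
    by rewrite GzD ee scaleN1r addNr.
  by rewrite -eg -eg' -ex2.
move=> [e y] hy.
have /key : rinv (radd tau' (graph (mulmx (Rmx D z)))) (y + Rmx D z *m e, e).
  by exists y, (Rmx D z *m e).
move=> [y2 [r [/= h er]]]; have {}er : r = Rmx D z *m e := er.
by rewrite er => /addIr ->.
Qed.

Lemma Lmin_BTheta : Lmin D `<=` BTheta D K1 Th.
Proof.
have nzi : complex.Im ('i : C) != 0 by apply: oner_neq0.
have hz := rhoL_nonreal hS nzi.
move=> [f g] [ef [/= hf pf]]; have {}ef : g = L f := ef.
have e0 : f = f + Gtz D 'i 0 + 0.
  by rewrite /Gtz mulmx0 /Gz lincomb0 !addr0.
split=> /=.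
  apply/(BmaxP hD hm hd hK1 hK1min hK1max _ _ hz); exists f, 0, 0; split=> //.
    exact: (sub0 hK1).
  rewrite ef (l1f0 hD hK1 hK1max) /Gtz mulmx0 /Gz /kmin !lincomb0; lmod.
have k0K := sub0 (preh_sub pK).
have gb0 : gb D 0 = 0.
  have := gbD hD hm hd (-1) k0K k0K.
  by rewrite scaler0 addr0 scaleN1r addNr.
rewrite e0 (GammatE hD hm) // gb0 /Gtz mulmx0 /Gz lincomb0 addr0 (phihE hD) // pf mulmx0 subr0.
exact: (sub0 sTh).
Qed.

Lemma BTheta_KN_corresponds : KN_corresponds D K1 (BTheta D K1 Th) reg1 KNtau.
Proof.
split.
- by split; [exact: (brestr_selfadjoint bt)|exact: Lmin_BTheta].
- split; last exact: KNtau_resolvent.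
  by move=> z nz; split; [exact: KNtau_sub|exact: KNtau_adj|move=> x y; exact: KNtau_Im].
- by move=> z _ hz hz1; exact: KN_formula_KNtau.
- move=> tau' _ h z nz; have hz := rhoL_nonreal hS nz.
  have h1 := KN_formula_KNtau hz (l1nr nz).
  have h2 := h z nz.
  by apply/seteqP; split; [exact: KN_formula_unique hz h1 h2|exact: KN_formula_unique hz h2 h1].
Qed.
End Theta.
End GeneralizedResolvent.

Unset Implicit Arguments.

Theorem theorem4p6 (R : realType) (X : lmodType R[i]) (m d : nat)
    (hm : (2 <= m)%N) (hd : (1 <= d)%N)
    (D : model X m d) (hD : standing D)
    (K1 : set X) (hK1 : linsubspace K1)
    (hK1min : Kmin D `<=` K1) (hK1max : K1 `<=` Kmax D) :
  (forall Theta : lrel 'cV[R[i]]_d 'cV[R[i]]_d,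
     is_closed (Cspace R d) (Cspace R d) Theta ->
     [/\ single_valued (BTheta D K1 Theta),
         is_closed (H1 D K1) (H1 D K1) (BTheta D K1 Theta) &
       forall z : R[i],
         rho (H1 D K1) (BTheta D K1 Theta) z -> rho (H1 D K1) (B0 D K1) z ->
         let rL := resolvent (Lpos D m) z in
         let rl := resolvent (l1 D K1) z in
         let W := rinv (rsub Theta (graph (mulmx (MGamma D K1 z)))) in
         let GC := graph (fun c => Gz D z (Cmx D *m c)) in
         let CphirL := graph (fun f => adjmx (Cmx D) *m phipair D f) \oR rL in
         let Gbdrl := graph (fun k => adjmx (Gb D) *m dcoef D k) \oR rl in
         let k_min := graph (kmin D) in
         Umap D K1 \oR resolvent (BTheta D K1 Theta) z
           \oR radj (H1 D K1) (hextsum (Hm D) (K1space D K1)) (Umap D K1) =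
         block_rel
           (radd rL (GC \oR W \oR CphirL))
           (ropp (GC \oR W \oR Gbdrl))
           (ropp (rl \oR k_min \oR W \oR CphirL))
           (radd rl (rl \oR k_min \oR W \oR Gbdrl))]) /\
  (forall Theta : lrel 'cV[R[i]]_d 'cV[R[i]]_d,
     is_selfadjoint (Cspace R d) Theta ->
     KN_corresponds D K1 (BTheta D K1 Theta) (rho (K1space D K1) (l1 D K1))
       (fun z => graph (mulmx (adjmx (invmx (Cmx D))))
                 \oR rsub (graph (mulmx (Qmx D K1 z))) Theta
                 \oR graph (mulmx (invmx (Cmx D))))).
Proof.
split=> [Theta clTheta|Theta saTheta]; last exact: BTheta_KN_corresponds.
split.
- move=> u v w [/= hv _] [/= hw _].
  exact: (Bmax_single_valued hD hm hd hK1 hK1min hK1max hv hw).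
- exact: (brestr_closed (exit_boundary_triple hD hm hd hK1 hK1min hK1max)).
- by move=> z h1 h2; apply: resolvent_matrix => //; have [[]] := clTheta.
Qed.
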